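(* Let $(\mathbf{T},h)$ be a cyclic commuting $d$-tuple on a Hilbert space $\mathcal{H}$, let $L_{\mathbf{T},h}=\sum_k\lambda_kf_k\otimes f_k$ be the spectral decomposition of $L_{\mathbf{T},h}$ on the Fock space $F^2$, and let $\mathcal{I}_{\mathbf{T}}=\{f\in F^2: f(\mathbf{T})=0\}$, $Z(\mathcal{I}_{\mathbf{T}})=\{z\in\mathbb{C}^d: f(z)=0\ \text{for all } f\in\mathcal{I}_{\mathbf{T}}\}$. Then $$\Big\{z\in Z(\mathcal{I}_{\mathbf{T}}):\ \sum_k\lambda_k^{-1}|f_k(z)|^2<\infty\Big\}=\overline{\sigma_p(\mathbf{T}^* )},$$ where $\overline{\sigma_p(\mathbf{T}^* )}=\{(\overline{\lambda_1},\dots,\overline{\lambda_d}): (\lambda_1,\dots,\lambda_d)\in\sigma_p(\mathbf{T}^* )\}$ denotes the set of complex conjugates of the joint eigenvalues of $\mathbf{T}^*=(T_1^*,\dots,T_d^* )$.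
   Context: A cyclic commuting $d$-tuple $(\mathbf{T},h)$ on a Hilbert space $\mathcal{H}$ is a tuple $\mathbf{T}=(T_1,\dots,T_d)$ of pairwise commuting bounded operators on $\mathcal{H}$ with a vector $h\in\mathcal{H}$ such that $\{p(\mathbf{T})h: p\in\mathbb{C}[z_1,\dots,z_d]\}$ is dense in $\mathcal{H}$. The Fock space $F^2$ is the space of entire functions $f$ on $\mathbb{C}^d$ with $\|f\|_{F^2}^2=\int|f|^2\,\pi^{-d}e^{-|z|^2}\,dm(z)<\infty$, where $m$ is Lebesgue measure. For entire $f=\sum_\alpha a_\alpha z^\alpha$, $f(\mathbf{T})=\sum_\alpha a_\alpha\mathbf{T}^\alpha$. Define $\iota:F^2\to\mathcal{H}$, $\iota f=f(\mathbf{T})h$; this is a compact operator, and $L_{\mathbf{T},h}=\iota^*\iota$ is a positive compact operator on $F^2$. In its spectral decomposition $L_{\mathbf{T},h}=\sum_k\lambda_kf_k\otimes f_k$, $\{\lambda_k\}$ is the sequence of nonzero eigenvalues counted with multiplicity in non-increasing order, $\{f_k\}$ is a (fixed) corresponding orthonormal sequence of eigenvectors in $F^2$, and $(f\otimes g)(r)=\langle r,g\rangle_{F^2}f$. $\sigma_p(\mathbf{T}^* )$ is the set of joint eigenvalues: $(\lambda_1,\dots,\lambda_d)\in\mathbb{C}^d$ belongs to it if there is a nonzero $v\in\mathcal{H}$ with $T_i^*v=\lambda_iv$ for all $i$. *)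

(* Defs.v *)
From HB Require Import structures.
From mathcomp Require Import all_boot all_order all_algebra.
From mathcomp Require Import all_classical all_reals all_analysis.
From mathcomp Require Import summability complex sesquilinear.
From mathcomp Require mpoly.

Set Implicit Arguments.
Unset Strict Implicit.
Unset Printing Implicit Defensive.
Import Order.TTheory GRing.Theory Num.Theory numFieldNormedType.Exports.

Local Open Scope classical_set_scope.
Local Open Scope ring_scope.
Import Normc.
Local Open Scope complex_scope.

(* mu \x nu, as a sigma-finite measure: this structure is not inferred for the
   library's \x unless the factors are subprobabilities. *)
Section sigma_finite_product.
Context {d1 d2 : measure_display} {X : measurableType d1} {Y : measurableType d2}.
Context {R : realType}.
Variable mu : {sigma_finite_measure set X -> \bar R}.
Variable nu : {sigma_finite_measure set Y -> \bar R}.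

Definition sf_product : set (X * Y) -> \bar R := (mu \x nu)%E.

HB.instance Definition _ := Measure.on sf_product.

Let sf_product_sigma_finite : sigma_finite setT sf_product.
Proof.
have /sigma_finiteP[F [TF ndF Foo]] := sigma_finiteT mu.
have /sigma_finiteP[G [TG ndG Goo]] := sigma_finiteT nu.
exists (fun n => F n `*` G n).
  rewrite -setXTT TF TG predeqE => -[x y]; split.
    move=> [/= [n _ Fnx] [k _ Gky]]; exists (maxn n k) => //; split.
    - by move: x Fnx; exact/subsetPset/ndF/leq_maxl.
    - by move: y Gky; exact/subsetPset/ndG/leq_maxr.
  by move=> [n _ []/= ? ?]; split; exists n.
move=> k; have [? ?] := Foo k; have [? ?] := Goo k.
split; first exact: measurableX.
rewrite /sf_product product_measure1E//.
by rewrite lte_mul_pinfty// ge0_fin_numE.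
Qed.

HB.instance Definition _ := Measure_isSigmaFinite.Build _ _ _ sf_product
  sf_product_sigma_finite.

End sigma_finite_product.

Section power_measure.
Context {disp : measure_display} {X : measurableType disp} {R : realType}.

Definition cons_pair n (p : X * n.-tuple X) : n.+1.-tuple X :=
  [tuple of p.1 :: p.2].

Lemma measurable_cons_pair n : measurable_fun setT (@cons_pair n).
Proof. exact: (measurable_cons measurable_fst measurable_snd). Qed.

Section cons_measure.
Variables (n : nat) (mu : {sigma_finite_measure set X -> \bar R}).
Variable nu : {sigma_finite_measure set (n.-tuple X) -> \bar R}.

Definition cons_measure : set (n.+1.-tuple X) -> \bar R :=
  pushforward (sf_product mu nu) (@cons_pair n).

Let cons_measure0 : cons_measure set0 = 0%E.
Proof. by rewrite /cons_measure /pushforward preimage_set0 measure0. Qed.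

Let cons_measure_ge0 A : (0 <= cons_measure A)%E.
Proof. by rewrite /cons_measure /pushforward measure_ge0. Qed.

Let cons_measure_sigma_additive : semi_sigma_additive cons_measure.
Proof.
move=> F mF tF mUF; rewrite /cons_measure /pushforward preimage_bigcup.
have mc B : measurable B -> measurable (@cons_pair n @^-1` B).
  by move=> mB; rewrite -[X in measurable X]setTI; exact: measurable_cons_pair.
apply: measure_semi_sigma_additive.
- by move=> i; exact: mc.
- apply/trivIsetP => /= i j _ _ ij; rewrite -preimage_setI.
  by move/trivIsetP : tF => /(_ _ _ _ _ ij) ->//; rewrite preimage_set0.
- by rewrite -preimage_bigcup; exact: mc.
Qed.

HB.instance Definition _ := isMeasure.Build _ _ _ cons_measure
  cons_measure0 cons_measure_ge0 cons_measure_sigma_additive.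

Let cons_measure_sigma_finite : sigma_finite setT cons_measure.
Proof.
have [F TF Foo] := sigma_finiteT (sf_product mu nu).
pose unc (t : n.+1.-tuple X) := (thead t, [tuple of behead t]).
have uncK (p : X * n.-tuple X) : unc (cons_pair p) = p.
  by case: p => x t; congr pair; apply: val_inj.
have munc : measurable_fun setT unc.
  apply: measurable_fun_pair; first exact: measurable_tnth.
  exact: measurable_behead.
exists (fun i => unc @^-1` F i).
  by rewrite -preimage_bigcup -TF preimage_setT.
move=> i; have [mFi Fioo] := Foo i; split.
  by rewrite -[X in measurable X]setTI; exact: munc.
rewrite /cons_measure /pushforward -comp_preimage.
by rewrite (_ : unc \o _ = id) //; apply/funext => p /=; rewrite uncK.
Qed.

HB.instance Definition _ := Measure_isSigmaFinite.Build _ _ _ cons_measure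
  cons_measure_sigma_finite.

End cons_measure.

(* The product of n copies of mu. *)
Fixpoint power_measure (mu : {sigma_finite_measure set X -> \bar R}) n :
    {sigma_finite_measure set (n.-tuple X) -> \bar R} :=
  match n with
  | 0 => dirac [tuple]
  | n'.+1 => cons_measure mu (power_measure mu n')
  end.

End power_measure.

(* The notations of mpoly clash with those of MathComp-Analysis, and its
   isMeasure would hide the one used above. *)
Import -(notations) mpoly.

Section complex_space.
Context {R : realType} {d : nat}.
Local Notation C := R[i].

(* The point of C^d with real coordinates (x_j, y_j) = tnth t j; through this
   map, Lebesgue measure on C^d is that of (R^2)^d. *)
Definition cpoint (t : d.-tuple (measurableTypeR R * measurableTypeR R)) :
    'I_d -> C :=
  fun j => (tnth t j).1 +i* (tnth t j).2.

Definition lebesgue_C :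
    {measure set (d.-tuple (measurableTypeR R * measurableTypeR R)) -> \bar R} :=
  power_measure (sf_product (@lebesgue_measure R) (@lebesgue_measure R)) d.

Definition gauss_weight (z : 'I_d -> C) : R :=
  pi ^- d * expR (- \sum_j normc (z j) ^+ 2).

Definition monomial (m : multinom d) (z : 'I_d -> C) : C := \prod_j z j ^+ m j.

(* Convergence along the finite sets of multi-indices, that is, unconditional
   (equivalently, absolute) convergence. *)
Definition power_series_of (f : ('I_d -> C) -> C) (a : multinom d -> C) :=
  forall z, partial_sum (fun m => a m * monomial m z : C^o) @ totally
            --> (f z : C^o).

Definition entire (f : ('I_d -> C) -> C) := exists a, power_series_of f a.

Definition taylor_coef (f : ('I_d -> C) -> C) : multinom d -> C :=
  xget (fun=> 0) [set a | power_series_of f a].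

Definition fock_sqnorm (f : ('I_d -> C) -> C) : \bar R :=
  (\int[lebesgue_C]_t
     (normc (f (cpoint t)) ^+ 2 * gauss_weight (cpoint t))%:E)%E.

Definition fock : set (('I_d -> C) -> C) :=
  [set f | entire f /\ (fock_sqnorm f < +oo)%E].

Definition fock_ip (f g : ('I_d -> C) -> C) : C :=
  let fg t := f (cpoint t) * (g (cpoint t))^* in
  (\int[lebesgue_C]_t (complex.Re (fg t) * gauss_weight (cpoint t))) +i*
  (\int[lebesgue_C]_t (complex.Im (fg t) * gauss_weight (cpoint t))).

Definition rank_one (f g r : ('I_d -> C) -> C) : ('I_d -> C) -> C :=
  fun z => fock_ip r g * f z.

Definition zero_set (I : set (('I_d -> C) -> C)) : set ('I_d -> C) :=
  [set z | forall f, I f -> f z = 0].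

End complex_space.

(* [adjoint D ipU ipV A v] is the u in D such that <A w, v> = <w, u> for all w
   in D, where D, with the form ipU, is the Hilbert space on which A acts. *)
Definition adjoint (R : realType) (U V : zmodType) (D : set U)
    (ipU : U -> U -> R[i]) (ipV : V -> V -> R[i]) (A : U -> V) (v : V) : U :=
  xget 0 [set u | D u /\ forall w, D w -> ipV (A w) v = ipU w u].

Section operators.
Context {R : realType} {H : completeNormedModType R[i]}.
Local Notation C := R[i].

Definition bounded_operator (A : {linear H -> H}) :=
  exists M : C, forall x, `|A x| <= M * `|x|.

Context {d : nat}.
Implicit Types (T : 'I_d -> {linear H -> H}) (h x : H).

Definition op_monomial T (m : multinom d) : H -> H :=
  \big[(fun A B => A \o B)/idfun]_(j < d) iter (m j) (T j).

Definition op_poly T (p : mpoly d C) : H -> H :=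
  fun x => \sum_(m <- msupp p) mcoeff m p *: op_monomial T m x.

(* f(T) = \sum_m a_m T^m for f entire with Taylor coefficients a_m; this series
   of operators converges absolutely in operator norm, so that its sum may be
   taken at each vector. *)
Definition op_entire T (f : ('I_d -> C) -> C) : H -> H :=
  fun x => summability.sum (fun m => taylor_coef f m *: op_monomial T m x).

Definition cyclic_commuting_tuple T h :=
  [/\ forall j, bounded_operator (T j),
      forall j k x, T j (T k x) = T k (T j x) &
      dense [set op_poly T p h | p in [set: mpoly d C]]].

Definition iota_op T h (f : ('I_d -> C) -> C) : H := op_entire T f h.

Definition annihilator T : set (('I_d -> C) -> C) :=
  [set f | fock f /\ forall x, op_entire T f x = 0].

Definition joint_eigenvalues (S : 'I_d -> H -> H) : set ('I_d -> C) :=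
  [set l | exists2 v : H, v != 0 & forall j, S j v = l j *: v].

Variable ip : {dot H for @conjc R}.

Definition L_op T h (f : ('I_d -> C) -> C) : ('I_d -> C) -> C :=
  adjoint fock fock_ip ip (iota_op T h) (iota_op T h f).

(* K is the index set, {0, .., N-1} or the whole of nat. The last clause says
   that L = \sum_(k in K) lam_k f_k (x) f_k on the Fock space, and it forces
   every nonzero eigenvalue to be listed with its multiplicity. *)
Definition spectral_decomposition T h (K : set nat) (lam : nat -> R)
    (f : nat -> ('I_d -> C) -> C) :=
  [/\ forall j k, K k -> (j <= k)%N -> K j,
      forall k, K k -> lam k != 0,
      forall j k, K k -> (j <= k)%N -> lam k <= lam j,
      (forall k, K k -> fock (f k)) /\
      (forall j k, K j -> K k -> fock_ip (f j) (f k) = (j == k)%:R) &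
      (forall k, K k -> forall z, L_op T h (f k) z = (lam k)%:C * f k z) /\
      (forall g, fock g ->
         fock_sqnorm (fun z => L_op T h g z -
           \sum_(0 <= k < n | k \in K) (lam k)%:C * rank_one (f k) (f k) g z)
         @[n --> \oo] --> 0%E)].

End operators.

(* Main.v *)
(* Parseval: rotating one coordinate preserves Lebesgue measure (a rotation is a
   product of three shears), so distinct monomials are orthogonal on polydiscs,
   and letting the radius grow |f|^2 = sum_m w_m |a_m|^2 for f = sum_m a_m z^m
   entire, where w_m = |z^m|^2.  Only two facts about w_m are used: it is finite,
   and it outgrows every geometric sequence.  The Fock space thus becomes a
   weighted l^2 space of Taylor coefficients.

   If T_j^* v = conj(z_j) v for all j and v is nonzero, then <f(T) h, v> =
   f(z) <h, v>, where <h, v> is nonzero by cyclicity; hence z is a common zero of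
   the annihilator, and Bessel's inequality for the orthonormal family
   iota f_k / sqrt(lam_k) bounds the series.

   Conversely, v = sum_k lam_k^-1 conj(f_k(z)) iota f_k satisfies
   <iota f_k, v> = f_k(z).  A monomial g is sum_k <g, f_k> f_k + p with
   iota p = 0, hence p(T) = 0 by cyclicity, so p(z) = 0 and
   <iota g, v> = g(z).  In particular <h, v> = 1, and by density
   T_j^* v = conj(z_j) v. *)

Require Import Defs.
From HB Require Import structures.
From mathcomp Require Import all_boot all_order all_algebra.
From mathcomp Require Import all_classical all_reals all_analysis.
From mathcomp Require Import measurable_realfun finmap summability.
From mathcomp Require Import complex sesquilinear ring lra.
From mathcomp Require mpoly.
Import Order.TTheory GRing.Theory Num.Theory numFieldNormedType.Exports.
Local Open Scope classical_set_scope.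
Local Open Scope ring_scope.
Import Normc.
Local Open Scope complex_scope.

Set Implicit Arguments.
Unset Strict Implicit.
Unset Printing Implicit Defensive.
Import -(notations) mpoly.

(** * Invariance of the measure of C^d under coordinatewise rotations *)

(** The closed span of the f_k is only the orthogonal complement of the kernel of iota. The part p
    of a monomial that the f_k miss lies in that kernel, and the condition that z be a common zero
    of the annihilator is exactly what controls p at z. Cyclicity turns iota p = 0, a statement
    about the single vector h, into p(T) = 0, because p(T) commutes with all polynomials in T.

    The spectral hypothesis only speaks of L g. It reaches the residue r_n of g after n terms
    through |iota r_n|^2 = <r_n, L g>, where L g may be replaced by its spectral remainder, r_n
    being orthogonal to f_k for k < n.

    Since w_m outgrows geometric sequences, the sum of |z^m|^2 / w_m is finite. Cauchy-Schwarz then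
    bounds evaluation at z, and likewise f(T) and the adjoint of iota, so that limits in the Fock
    space can be read both at z and in H. *)

Section plane_measure.
Context {R : realType}.
Local Notation mu := (@lebesgue_measure R).
Local Notation Rm := (measurableTypeR R).
Local Notation mu2 := (sf_product mu mu).

(** Translating a half-open interval keeps its length, and Lebesgue measure is determined by its
    values on half-open intervals. *)
Lemma ge0_integral_lebesgue_translation (c : R) (F : Rm -> \bar R) :
  measurable_fun setT F -> (forall x, 0 <= F x)%E ->
  (\int[mu]_x F (x + c)%R = \int[mu]_x F x)%E.
Proof.
move=> mF F0.
pose t : Rm -> Rm := fun x => x + c.
have mt : measurable_fun setT t by exact: measurable_funD.
have E (A : set Rm) : measurable A ->
    mu A = pushforward mu t A.
  apply: (@lebesgue_measure_unique _ (pushforward mu _)) => _ [[a b]] _ <-.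
  transitivity (mu `]a - c, b - c]%classic).
    rewrite !lebesgue_measure_itv/= !lte_fin ltrD2r.
    by case: ifP => // _; rewrite -!EFinD; congr (_%:E); ring.
  congr (mu _); apply/seteqP.
  by split => x /=; rewrite !in_itv/= lerBrDr ltrBlDr.
transitivity (\int[pushforward mu t]_x F x)%E.
  by rewrite ge0_integral_pushforward// preimage_setT.
by apply/esym/eq_measure_integral => A mA _; exact: E.
Qed.

(** By Tonelli: on each horizontal line the shear is a translation by [c * y]. *)
Lemma ge0_integral_shear1 (c : R) (F : Rm * Rm -> \bar R) :
  measurable_fun setT F -> (forall x, 0 <= F x)%E ->
  (\int[mu2]_x F (x.1 + c * x.2, x.2)%R = \int[mu2]_x F x)%E.
Proof.
move=> mF F0.
have ms : measurable_fun setT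
    ((fun x => (x.1 + c * x.2, x.2)) : Rm * Rm -> Rm * Rm).
  apply: measurable_fun_pair => //=; apply: measurable_funD => //.
  exact: measurable_funM.
rewrite (@fubini_tonelli2 _ _ _ _ _ mu mu)//=; last exact: measurableT_comp.
rewrite (@fubini_tonelli2 _ _ _ _ _ mu mu)//=.
apply: eq_integral => y _; rewrite /fubini_G/=.
rewrite (@ge0_integral_lebesgue_translation (c * y) (fun x => F (x, y)))//.
exact: measurableT_comp.
Qed.

Lemma ge0_integral_shear2 (c : R) (F : Rm * Rm -> \bar R) :
  measurable_fun setT F -> (forall x, 0 <= F x)%E ->
  (\int[mu2]_x F (x.1, x.2 + c * x.1)%R = \int[mu2]_x F x)%E.
Proof.
move=> mF F0.
have ms : measurable_fun setT
    ((fun x => (x.1, x.2 + c * x.1)) : Rm * Rm -> Rm * Rm).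
  apply: measurable_fun_pair => //=; apply: measurable_funD => //.
  exact: measurable_funM.
rewrite (@fubini_tonelli1 _ _ _ _ _ mu mu)//=; last exact: measurableT_comp.
rewrite (@fubini_tonelli1 _ _ _ _ _ mu mu)//=.
apply: eq_integral => x _; rewrite /fubini_F/=.
rewrite (@ge0_integral_lebesgue_translation (c * x) (fun y => F (x, y)))//.
exact: measurableT_comp.
Qed.

(** Multiplication by [w] in real coordinates, a rotation only when [w] has modulus 1. *)
Definition rotation (w : R[i]) (x : Rm * Rm) : Rm * Rm :=
  (complex.Re w * x.1 - complex.Im w * x.2,
   complex.Im w * x.1 + complex.Re w * x.2).

Lemma measurable_rotation w : measurable_fun setT (rotation w).
Proof.
apply: measurable_fun_pair => /=.
- by apply: measurable_funB; apply: measurable_funM.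
- by apply: measurable_funD; apply: measurable_funM.
Qed.

(* With t = (1 - Re w) / Im w, the rotation by w is the product of the shears
   x := x - t y, y := y + (Im w) x and x := x - t y. *)
Lemma ge0_integral_rotation (w : R[i]) (F : Rm * Rm -> \bar R) :
  normc w = 1 -> complex.Im w != 0 ->
  measurable_fun setT F -> (forall x, 0 <= F x)%E ->
  (\int[mu2]_x F (rotation w x) = \int[mu2]_x F x)%E.
Proof.
case: w => c s /= /(congr1 (fun x => x ^+ 2)).
rewrite sqr_sqrtr ?addr_ge0 ?sqr_ge0// expr1n => cs1 s0 mF F0.
pose t := (1 - c) / s.
pose S1 (x : Rm * Rm) : Rm * Rm := (x.1 + (- t) * x.2, x.2).
pose S2 (x : Rm * Rm) : Rm * Rm := (x.1, x.2 + s * x.1).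
have mS1 : measurable_fun setT S1.
  apply: measurable_fun_pair => //=; apply: measurable_funD => //.
  exact: measurable_funM.
have mS2 : measurable_fun setT S2.
  apply: measurable_fun_pair => //=; apply: measurable_funD => //.
  exact: measurable_funM.
have mF1 := measurableT_comp mF mS1; have mF2 := measurableT_comp mF1 mS2.
rewrite -(@ge0_integral_shear1 (- t) F)// -(@ge0_integral_shear2 s (F \o S1))//;
  last by move=> x; exact: F0.
rewrite -(@ge0_integral_shear1 (- t) (F \o S1 \o S2))//; last first.
  by move=> x; exact: F0.
apply: eq_integral => -[x y] _; rewrite /rotation /S1 /S2 /=; congr F.
have c2 : c ^+ 2 = 1 - s ^+ 2 by rewrite -cs1; ring.
congr pair; last by rewrite /t; field.
have -> : c * x - s * y = (1 - t * s) * x - t * ((1 - t * s) * y + y).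
  by rewrite /t; field: c2.
ring.
Qed.

End plane_measure.

Section power_measure_theory.
Context {disp : measure_display} {X : measurableType disp} {R : realType}.
Variable mu : {sigma_finite_measure set X -> \bar R}.

Lemma ge0_integral_power_measureS n (F : n.+1.-tuple X -> \bar R) :
  measurable_fun setT F -> (forall x, 0 <= F x)%E ->
  (\int[power_measure mu n.+1]_t F t =
   \int[mu]_x \int[power_measure mu n]_t F (cons_pair (x, t)))%E.
Proof.
move=> mF F0.
have mc : measurable_fun setT (@cons_pair _ X n) by exact: measurable_cons_pair.
rewrite [LHS](ge0_integral_pushforward mc)//.
rewrite preimage_setT.
rewrite (@fubini_tonelli1 _ _ _ _ _ mu (power_measure mu n) (F \o @cons_pair _ X n))//.
  exact: measurableT_comp.
by move=> x; exact: F0.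
Qed.

Definition tuple_map n (phi : 'I_n -> X -> X) (t : n.-tuple X) : n.-tuple X :=
  [tuple phi i (tnth t i) | i < n].

Lemma measurable_tuple_map n (phi : 'I_n -> X -> X) :
  (forall i, measurable_fun setT (phi i)) ->
  measurable_fun setT (tuple_map phi).
Proof.
move=> mphi; apply/measurable_fun_tnthP => i.
rewrite (_ : _ \o _ = phi i \o (@tnth n X)^~ i); last first.
  by apply/funext => t /=; rewrite tnth_mktuple.
by apply: measurableT_comp => //; exact: measurable_tnth.
Qed.

Lemma tuple_map_cons n (phi : 'I_n.+1 -> X -> X) x (t : n.-tuple X) :
  tuple_map phi (cons_pair (x, t)) =
  cons_pair (phi ord0 x, tuple_map (fun i => phi (lift ord0 i)) t).
Proof.
apply: eq_from_tnth => i; rewrite tnth_mktuple.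
by have [j ->|->] := unliftP ord0 i; rewrite ?tnth0 ?tnthS ?tnth_mktuple.
Qed.

(** Induction on [n]: the induction hypothesis treats the tail under the outer integral, and
    invariance under [phi ord0] then treats the inner integral as a function of the head. *)
Lemma ge0_integral_tuple_map n (phi : 'I_n -> X -> X) (F : n.-tuple X -> \bar R) :
  (forall i, measurable_fun setT (phi i)) ->
  (forall i (G : X -> \bar R), measurable_fun setT G -> (forall x, 0 <= G x)%E ->
     (\int[mu]_x G (phi i x) = \int[mu]_x G x)%E) ->
  measurable_fun setT F -> (forall x, 0 <= F x)%E ->
  (\int[power_measure mu n]_t F (tuple_map phi t) =
   \int[power_measure mu n]_t F t)%E.
Proof.
elim: n phi F => [|n IH] phi F mphi iphi mF F0.
  apply: eq_integral => t _; congr F; apply: eq_from_tnth => -[]//.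
have mFc x : measurable_fun setT (fun t : n.-tuple X => F (cons_pair (x, t))).
  apply: measurableT_comp => //; apply: measurableT_comp => //.
  exact: measurable_cons_pair.
rewrite !ge0_integral_power_measureS//; last first.
  by apply: measurableT_comp => //; exact: measurable_tuple_map.
under eq_integral => x _.
  under eq_integral do rewrite tuple_map_cons.
  rewrite (IH (fun i => phi (lift ord0 i))
    (fun t => F (cons_pair (phi ord0 x, t))))//.
  over.
  by move=> i; exact: iphi.
rewrite -[RHS](iphi ord0)//.
  apply: (@measurable_fun_fubini_tonelli_F _ _ _ _ _ (power_measure mu n)
    (F \o @cons_pair _ X n)) => //.
  by apply: measurableT_comp => //; exact: measurable_cons_pair.
  by move=> x; exact: F0.
by move=> x; apply: integral_ge0 => t _; exact: F0.
Qed.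

Lemma ge0_integral_prod_tnth n (g : 'I_n -> X -> R) (G : 'I_n -> R) :
  (forall i, measurable_fun setT (g i)) -> (forall i x, 0 <= g i x) ->
  (forall i, \int[mu]_x (g i x)%:E = (G i)%:E)%E ->
  (\int[power_measure mu n]_t (\prod_i g i (tnth t i))%:E = (\prod_i G i)%:E)%E.
Proof.
have mprod m (q : 'I_m -> X -> R) : (forall i, measurable_fun setT (q i)) ->
    measurable_fun setT (fun t : m.-tuple X => \prod_i q i (tnth t i)).
  move=> mq; apply: measurable_prod => i _; apply: measurableT_comp => //.
  exact: measurable_tnth.
elim: n g G => [|n IH] g G mg g0 gG.
  under eq_integral do rewrite big_ord0.
  by rewrite integral_dirac// diracT mul1e big_ord0.
rewrite ge0_integral_power_measureS//; last 2 first.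
- by apply/measurable_EFinP; exact: mprod.
- by move=> t; rewrite lee_fin prodr_ge0.
transitivity (\int[mu]_x ((\prod_(i < n) G (lift ord0 i))%:E * (g ord0 x)%:E))%E.
  apply: eq_integral => x _.
  rewrite -(IH (fun i => g (lift ord0 i)))// muleC -ge0_integralZl//.
  - apply: eq_integral => t _; rewrite -EFinM big_ord_recl tnth0.
    by under [in RHS]eq_bigr do rewrite -(tnthS (x, t).1).
  - by apply/measurable_EFinP; exact: (mprod n (fun i => g (lift ord0 i))).
  - by move=> t _; rewrite lee_fin; apply: prodr_ge0 => i _; exact: g0.
  - by rewrite lee_fin.
have G0 i : 0 <= G i.
  by rewrite -lee_fin -gG integral_ge0// => x _; rewrite lee_fin.
rewrite ge0_integralZl//; last 3 first.
- exact/measurable_EFinP.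
- by move=> x _; rewrite lee_fin.
- by rewrite lee_fin prodr_ge0.
by rewrite gG -EFinM mulrC big_ord_recl.
Qed.

End power_measure_theory.

(** * Norms of monomials *)

Section gaussian_moments.
Context {R : realType}.
Local Notation mu := (@lebesgue_measure R).
Local Notation Rm := (measurableTypeR R).
Local Notation mu2 := (sf_product mu mu).

Definition sqnorm2 (x : Rm * Rm) : R := x.1 ^+ 2 + x.2 ^+ 2.

Definition gauss_density (x : Rm * Rm) : R := pi^-1 * expR (- sqnorm2 x).

Definition gauss_moment_fun k (x : Rm * Rm) : R := sqnorm2 x ^+ k * gauss_density x.

Lemma sqnorm2_ge0 x : 0 <= sqnorm2 x.
Proof. by rewrite addr_ge0 ?sqr_ge0. Qed.

Lemma measurable_sqnorm2 : measurable_fun setT sqnorm2.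
Proof. by apply: measurable_funD; apply: measurable_funX. Qed.

Lemma gauss_density_gt0 x : 0 < gauss_density x.
Proof. by rewrite mulr_gt0 ?invr_gt0 ?pi_gt0 ?expR_gt0. Qed.

Lemma measurable_gauss_density : measurable_fun setT gauss_density.
Proof.
apply: measurable_funM => //; apply: measurableT_comp => //.
exact: measurableT_comp measurable_sqnorm2.
Qed.

Lemma gauss_moment_fun_ge0 k x : 0 <= gauss_moment_fun k x.
Proof. by rewrite mulr_ge0 ?exprn_ge0 ?sqnorm2_ge0 ?ltW ?gauss_density_gt0. Qed.

Lemma measurable_gauss_moment_fun k : measurable_fun setT (gauss_moment_fun k).
Proof.
apply: measurable_funM; last exact: measurable_gauss_density.
exact: measurable_funX measurable_sqnorm2.
Qed.

(** Raise s/k <= exp(s/k) to the power k. *)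
Lemma exprn_le_expR k (s : R) : 0 <= s -> s ^+ k <= k%:R ^+ k * expR s.
Proof.
case: k => [|k] s0; first by rewrite !expr0 mul1r (le_trans _ (expR_ge1Dx s))// lerDl.
have k0 : 0 < k.+1%:R :> R by rewrite ltr0n.
rewrite -[s in expR s](@divfK _ k.+1%:R) ?gt_eqF// expRM_natr -exprMn.
rewrite lerXn2r ?nnegrE ?mulr_ge0 ?expR_ge0//.
rewrite -ler_pdivrMl// mulrC (le_trans _ (expR_ge1Dx _))// lerDr.
by rewrite ler01.
Qed.

Lemma ge0_integral_prod2 (f : Rm -> R) (c : R) : measurable_fun setT f ->
  (forall x, 0 <= f x) -> (\int[mu]_x (f x)%:E = c%:E)%E ->
  (\int[mu2]_x (f x.1 * f x.2)%:E = (c * c)%:E)%E.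
Proof.
move=> mf f0 fc.
have c0 : 0 <= c.
  by rewrite -lee_fin -fc; apply: integral_ge0 => x _; rewrite lee_fin.
rewrite (@fubini_tonelli1 _ _ _ _ _ mu mu)//=; last 2 first.
- apply/measurable_EFinP/measurable_funM; exact: measurableT_comp.
- by move=> x; rewrite lee_fin mulr_ge0.
transitivity (\int[mu]_x (c%:E * (f x)%:E))%E.
  apply: eq_integral => x _; rewrite /fubini_F/= -fc muleC -ge0_integralZl//.
  - exact/measurable_EFinP.
  - by move=> y _; rewrite lee_fin.
  - by rewrite lee_fin.
rewrite ge0_integralZl ?fc//.
- exact/measurable_EFinP.
- by move=> y _; rewrite lee_fin.
Qed.

(** Half of the exponential absorbs the power: with s = |x|^2, s^k exp(-s) <= 2^k k^k exp(-s/2), and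
    the right-hand side is a multiple of a product of two standard normal densities. *)
Lemma gauss_moment_lty k : (\int[mu2]_x (gauss_moment_fun k x)%:E < +oo)%E.
Proof.
pose p := @normal_pdf R 0 1.
have mp : measurable_fun setT p by exact: measurable_normal_pdf.
have p0 x : 0 <= p x by exact: normal_pdf_ge0.
have I1 : (\int[mu2]_x (p x.1 * p x.2)%:E = (1 * 1)%:E)%E.
  by apply: ge0_integral_prod2 => //; apply: integral_normal_pdf; rewrite oner_eq0.
pose q := @normal_peak R 1.
have q0 : 0 < q by apply: normal_peak_gt0; rewrite oner_eq0.
(* The factor [2 ^+ k * k%:R ^+ k] comes from [exprn_le_expR] at s/2; dividing by [q * q] undoes the
   normalisation of the two normal densities. *)
pose C := pi^-1 * (2 ^+ k * k%:R ^+ k) / (q * q).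
have C0 : 0 <= C.
  by rewrite !mulr_ge0 ?invr_ge0 ?pi_ge0 ?exprn_ge0 ?ler0n ?mulr_ge0 ?(ltW q0). 
have mpp : measurable_fun setT (fun x : Rm * Rm => p x.1 * p x.2).
  by apply/measurable_funM; exact: measurableT_comp.
apply: (@le_lt_trans _ _ (\int[mu2]_x (C%:E * (p x.1 * p x.2)%:E))%E); last first.
  rewrite ge0_integralZl ?I1//.
  - by rewrite -EFinM ltry.
  - exact/measurable_EFinP.
  - by move=> x _; rewrite lee_fin mulr_ge0.
apply: ge0_le_integral => //.
- by move=> x _; rewrite lee_fin gauss_moment_fun_ge0.
- by apply/measurable_EFinP; exact: measurable_gauss_moment_fun.
- by apply/measurable_EFinP/measurable_funM.
move=> x _; rewrite -EFinM lee_fin /p !normal_pdfE ?oner_eq0// -/q.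
have -> : C * (q * normal_fun 0 1 x.1 * (q * normal_fun 0 1 x.2)) =
    pi^-1 * ((2 ^+ k * k%:R ^+ k) * (normal_fun 0 1 x.1 * normal_fun 0 1 x.2)).
  have qn0 : q != 0 by rewrite gt_eqF.
  rewrite /C; move: (pi^-1 : R) => P; by field.
rewrite /gauss_moment_fun /gauss_density mulrCA.
rewrite ler_wpM2l ?invr_ge0 ?pi_ge0//.
have -> : normal_fun 0 1 x.1 * normal_fun 0 1 x.2 = expR (sqnorm2 x / 2) * expR (- sqnorm2 x).
  by rewrite /normal_fun -!expRD; congr expR; rewrite /sqnorm2; field.
rewrite mulrA ler_wpM2r ?expR_ge0//.
rewrite -{1}[sqnorm2 x](@divfK _ 2)// exprMn mulrC -mulrA ler_wpM2l ?exprn_ge0//.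
by rewrite exprn_le_expR// divr_ge0 ?sqnorm2_ge0.
Qed.

(** The integral of |z|^(2k) against the Gaussian measure of the plane, that is, k!. *)
Definition gauss_moment k : R := fine (\int[mu2]_x (gauss_moment_fun k x)%:E).

Lemma gauss_momentE k :
  (\int[mu2]_x (gauss_moment_fun k x)%:E = (gauss_moment k)%:E)%E.
Proof.
rewrite fineK// ge0_fin_numE ?gauss_moment_lty//.
by apply: integral_ge0 => x _; rewrite lee_fin gauss_moment_fun_ge0.
Qed.

(* On the unit square at (b + 1, b + 1), |z|^2 is at least b. *)
Lemma gauss_moment_lower (b : R) : 0 <= b ->
  exists2 kap : R, 0 < kap & forall k, kap * b ^+ k <= gauss_moment k.
Proof.
move=> b0; pose J : set Rm := `[b + 1, b + 2]%classic.
have mJ : measurable J by exact: measurable_itv.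
have muJ : mu J = 1%E.
  rewrite /J lebesgue_measure_itv/= lte_fin ltrD2l ltr1n -EFinD.
  by congr (_%:E); ring.
exists (pi^-1 * expR (- ((b + 2) ^+ 2 + (b + 2) ^+ 2))).
  by rewrite mulr_gt0 ?invr_gt0 ?pi_gt0 ?expR_gt0.
move=> k; rewrite -lee_fin -gauss_momentE.
set c := _ * _.
have c0 : 0 <= c by rewrite !mulr_ge0 ?invr_ge0 ?pi_ge0 ?expR_ge0 ?exprn_ge0.
apply: (@le_trans _ _ (\int[mu2]_(x in J `*` J) c%:E)%E).
  rewrite integral_cst//; last exact: measurableX.
  by rewrite /= /sf_product product_measure1E//= muJ !mule1.
apply: (@le_trans _ _ (\int[mu2]_(x in J `*` J) (gauss_moment_fun k x)%:E)%E).
  apply: ge0_le_integral => //.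
  - exact: measurableX.
  - apply/measurable_EFinP; apply: measurable_funTS.
    exact: measurable_gauss_moment_fun.
  move=> [x y] [/= ]; rewrite /J /= !in_itv/= => /andP[x1 x2] /andP[y1 y2].
  rewrite lee_fin /c /gauss_moment_fun /gauss_density mulrC.
  have x0 : 0 <= x by apply: le_trans x1; rewrite addr_ge0.
  have y0 : 0 <= y by apply: le_trans y1; rewrite addr_ge0.
  rewrite ler_pM ?mulr_ge0 ?exprn_ge0 ?invr_ge0 ?pi_ge0 ?expR_ge0//.
    rewrite lerXn2r ?nnegrE ?sqnorm2_ge0// /sqnorm2/=; nra.
  rewrite ler_wpM2l ?invr_ge0 ?pi_ge0// ler_expR lerN2 /sqnorm2/=.
  by rewrite lerD// lerXn2r ?nnegrE ?addr_ge0.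
apply: ge0_subset_integral => //.
- exact: measurableX.
- by apply/measurable_EFinP; exact: measurable_gauss_moment_fun.
- by move=> x _; rewrite lee_fin gauss_moment_fun_ge0.
Qed.

Lemma gauss_moment_gt0 k : 0 < gauss_moment k.
Proof.
have [kap kap0 /(_ k)] := gauss_moment_lower ler01.
by rewrite expr1n mulr1; exact: lt_le_trans.
Qed.

End gaussian_moments.

(** * The real-valued modulus of complex numbers *)

Section complex_modulus.
Context {R : realType}.
Implicit Types (z w : R[i]) (x : R).

Lemma normc_ge0 z : 0 <= normc z.
Proof. by case: z => a b; exact: sqrtr_ge0. Qed.

Lemma sqr_normcE z : normc z ^+ 2 = complex.Re z ^+ 2 + complex.Im z ^+ 2.
Proof. by case: z => a b; rewrite /= sqr_sqrtr// addr_ge0 ?sqr_ge0. Qed.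

Lemma normcX z k : normc (z ^+ k) = normc z ^+ k.
Proof. by elim: k => [|k IH]; rewrite ?expr0 ?normc1// !exprS normcM IH. Qed.

Lemma normc_prod (I : Type) (r : seq I) (P : pred I) (F : I -> R[i]) :
  normc (\prod_(i <- r | P i) F i) = \prod_(i <- r | P i) normc (F i).
Proof.
by elim/big_rec2 : _ => [|i y x _ <-]; rewrite ?normc1 ?normcM.
Qed.

Lemma normc_real x : normc x%:C = `|x|.
Proof. by rewrite /= expr0n/= addr0 sqrtr_sqr. Qed.

Lemma normc_conj z : normc z^* = normc z.
Proof. by case: z => a b /=; rewrite sqrrN. Qed.

Lemma normcE_norm z : (normc z)%:C = `|z|.
Proof. by rewrite normc_def; case: z. Qed.

Lemma normc_eq0 z : (normc z == 0) = (z == 0).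
Proof. by apply/eqP/eqP => [/eq0_normc|->]; last exact: normc0. Qed.

Lemma mulC_conj z : z * z^* = (normc z ^+ 2)%:C.
Proof.
rewrite sqr_normcE; case: z => a b; apply/eqP; rewrite eq_complex/=.
by apply/andP; split; apply/eqP; ring.
Qed.

Lemma Re_le_normc z : `|complex.Re z| <= normc z.
Proof. by rewrite -lecR normcE_norm; exact: complex.normc_ge_Re. Qed.

Lemma Im_le_normc z : `|complex.Im z| <= normc z.
Proof.
case: z => a b /=.
by rewrite -(@ler_pXn2r _ 2)// ?nnegrE ?sqrtr_ge0// real_normK ?num_real// sqr_sqrtr
  ?addr_ge0 ?sqr_ge0// lerDr sqr_ge0.
Qed.

Lemma complex_ReM z w : complex.Re (z * w) =
  complex.Re z * complex.Re w - complex.Im z * complex.Im w.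
Proof. by case: z w => a b [x y]. Qed.

Lemma complex_ImM z w : complex.Im (z * w) =
  complex.Re z * complex.Im w + complex.Im z * complex.Re w.
Proof. by case: z w => a b [x y]. Qed.

Lemma normc_sum (I : Type) (r : seq I) (P : pred I) (F : I -> R[i]) :
  normc (\sum_(i <- r | P i) F i) <= \sum_(i <- r | P i) normc (F i).
Proof.
elim/big_rec2 : _ => [|i y x _ le]; first by rewrite normc0.
by rewrite (le_trans (le_normcD _ _))// lerD2l.
Qed.

End complex_modulus.

(** * Weights of monomials and their growth *)

Section monomial_weights.
Context {R : realType} {d : nat}.
Local Notation mu := (@lebesgue_measure R).
Local Notation Rm := (measurableTypeR R).
Local Notation cpoint := Defs.cpoint.
Implicit Types (m : multinom d) (t : d.-tuple (Rm * Rm)).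

(** The squared Fock norm of z^m, equal to the product of the factorials of the m_j. *)
Definition weight m : R := \prod_j gauss_moment (m j).

Lemma weight_gt0 m : 0 < weight m.
Proof. by apply: prodr_gt0 => j _; exact: gauss_moment_gt0. Qed.

Lemma weight_ge0 m : 0 <= weight m.
Proof. exact/ltW/weight_gt0. Qed.

Lemma normc_cpoint t j : normc (cpoint t j) ^+ 2 = sqnorm2 (tnth t j).
Proof. by rewrite sqr_normcE. Qed.

Lemma gauss_weight_cpoint t :
  gauss_weight (cpoint t) = \prod_j gauss_density (tnth t j).
Proof.
rewrite /gauss_weight big_split/= prodr_const card_ord -expR_sum -exprVn.
congr (_ * expR _); rewrite sumrN; congr (- _).
by apply: eq_bigr => j _; rewrite normc_cpoint.
Qed.

Lemma normc_monomial m (z : 'I_d -> R[i]) :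
  normc (monomial m z) = \prod_j normc (z j) ^+ m j.
Proof. by rewrite normc_prod; apply: eq_bigr => j _; rewrite normcX. Qed.

Lemma fock_sqnorm_monomial m :
  fock_sqnorm (@monomial R d m) = (weight m)%:E.
Proof.
rewrite -(@ge0_integral_prod_tnth _ _ _ (sf_product mu mu) _
  (fun j => gauss_moment_fun (m j))).
- apply: eq_integral => t _; congr (_%:E).
  rewrite gauss_weight_cpoint normc_monomial -prodrXl -big_split/=.
  by apply: eq_bigr => j _; rewrite exprAC normc_cpoint.
- by move=> j; exact: measurable_gauss_moment_fun.
- by move=> j x; exact: gauss_moment_fun_ge0.
- by move=> j; exact: gauss_momentE.
Qed.

Lemma geometric_half_le2 N : \sum_(k < N) (2^-1 : R) ^+ k <= 2.
Proof.
suff : \sum_(k < N) (2^-1 : R) ^+ k = 2 - 2 * 2^-1 ^+ N.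
  by move=> ->; rewrite gerBl mulr_ge0 ?exprn_ge0.
elim: N => [|N IH]; first by rewrite big_ord0 expr0; ring.
by rewrite big_ord_recr/= IH exprS; field.
Qed.

(** A finite set of multi-indices fits in a box, over which the sum factors into [d] geometric sums,
    each at most 2. *)
Lemma sum_half_multinom_le (A : {fset multinom d}) :
  \sum_(m <- A) \prod_j (2^-1 : R) ^+ m j <= 2 ^+ d.
Proof.
pose N := (\max_(m <- A) mdeg m).+1.
(* [inord] loses nothing on [A]: each [m j] is at most the degree of [m], hence less than [N]. *)
pose phi m : {ffun 'I_d -> 'I_N} := [ffun j => inord (m j)].
pose F (g : {ffun 'I_d -> 'I_N}) : R := \prod_j (2^-1 : R) ^+ g j.
have phiE m : m \in (A : seq _) -> forall j, phi m j = m j :> nat.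
  move=> mA j; rewrite ffunE inordK// ltnS.
  apply: leq_trans (leq_bigmax_seq _ mA isT).
  by rewrite mdegE (bigD1 j)//= leq_addr.
have -> : \sum_(m <- A) \prod_j (2^-1 : R) ^+ m j = \sum_(g <- map phi A) F g.
  rewrite big_map big_seq [RHS]big_seq; apply: eq_bigr => m mA.
  by apply: eq_bigr => j _; rewrite phiE.
rewrite big_uniq/=; last first.
  rewrite map_inj_in_uniq ?fset_uniq// => m1 m2 A1 A2 e.
  by apply/mnmP => j; rewrite -phiE// -(phiE m2)// e.
apply: (@le_trans _ _ (\sum_g F g)).
  rewrite big_mkcond/=; apply: ler_sum => g _; case: ifP => // _.
  by apply: prodr_ge0 => j _; rewrite exprn_ge0.
rewrite -(bigA_distr_bigA (fun _ (k : 'I_N) => (2^-1 : R) ^+ k)) prodr_const card_ord.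
by rewrite lerXn2r ?nnegrE ?sumr_ge0 ?geometric_half_le2// => k _; rewrite exprn_ge0.
Qed.

(** The moments dominate [kap * (2 * B) ^+ k], so each quotient is at most kap^-d 2^-|m|. Point
    evaluations, f(T) and the adjoint of iota are all bounded by means of such sums. *)
Lemma weight_summable (B : R) : 0 <= B ->
  exists C, forall A : {fset multinom d},
    \sum_(m <- A) (\prod_j B ^+ m j) / weight m <= C.
Proof.
move=> B0; have [|kap kap0 lower] := @gauss_moment_lower R (2 * B).
  by rewrite mulr_ge0.
exists (kap^-1 ^+ d * 2 ^+ d) => A.
apply: (@le_trans _ _ (kap^-1 ^+ d * \sum_(m <- A) \prod_j (2^-1 : R) ^+ m j));
  last by rewrite ler_wpM2l ?sum_half_multinom_le// exprn_ge0// invr_ge0 ltW.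
rewrite mulr_sumr; apply: ler_sum => m _.
have -> : kap^-1 ^+ d = \prod_(j < d) kap^-1 by rewrite prodr_const card_ord.
rewrite ler_pdivrMr ?weight_gt0// -!big_split/=; apply: ler_prod => j _.
rewrite exprn_ge0//=.
apply: (@le_trans _ _ (kap^-1 * 2^-1 ^+ m j * (kap * (2 * B) ^+ m j))).
  rewrite [leRHS](_ : _ = (kap^-1 * kap) * ((2^-1 * 2) * B) ^+ m j).
    by rewrite !mulVf ?mul1r ?gt_eqF.
  by rewrite !exprMn; ring.
by rewrite ler_wpM2l ?lower// mulr_ge0 ?exprn_ge0// ?invr_ge0 ltW.
Qed.

End monomial_weights.

(** * Unconditional sums *)

#[global] Existing Instance totally_filter.

Section finite_subsets.
Context {I : choiceType} {R : realType}.
Implicit Types (A B : {fset I}) (b : I -> R).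

Lemma partial_sumE (V : zmodType) (x : I -> V) A :
  partial_sum x A = \sum_(i <- A) x i.
Proof. by rewrite /partial_sum big_seq_fsetE. Qed.

Lemma sum_fsetU (V : zmodType) (x : I -> V) A B : [disjoint A & B]%fset ->
  \sum_(i <- (A `|` B)%fset) x i = \sum_(i <- A) x i + \sum_(i <- B) x i.
Proof.
move=> dAB; rewrite (big_fsetID _ (mem A)) /=; congr (_ + _); apply: eq_fbigl => i.
  by rewrite !inE/=; case: (i \in A); rewrite ?andbF ?andbT ?orbT.
rewrite !inE/=; have := fdisjointP dAB i.
by case: (i \in A); case: (i \in B) => //= /(_ isT).
Qed.

Lemma fdisjointXDr A B : [disjoint A & B `\` A]%fset.
Proof. by apply/fdisjointP => i iA; rewrite !inE iA. Qed.

Lemma sum_fsetDl (V : zmodType) (x : I -> V) A B : (A `<=` B)%fset ->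
  \sum_(i <- B) x i = \sum_(i <- A) x i + \sum_(i <- (B `\` A)%fset) x i.
Proof.
move=> AB; rewrite -sum_fsetU; last by rewrite fdisjointXDr.
by congr (\sum_(i <- (_ : {fset I})) x i); apply/fsetP => i;
  rewrite !inE; case: (boolP (i \in A)) => //= /(fsubsetP AB).
Qed.

Lemma le_sum_fset b A B : (forall i, 0 <= b i) -> (A `<=` B)%fset ->
  \sum_(i <- A) b i <= \sum_(i <- B) b i.
Proof. by move=> b0 AB; rewrite (sum_fsetDl _ AB) lerDl sumr_ge0. Qed.

Definition bounded_sums b := exists C, forall A, \sum_(i <- A) b i <= C.

(** Take [A] with a sum within [e] of the supremum: a sum of [e] or more over a set disjoint from
    [A] would push past that supremum. *)
Lemma bounded_sums_tail b : (forall i, 0 <= b i) -> bounded_sums b ->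
  forall e, 0 < e -> exists A, forall B, [disjoint A & B]%fset ->
    \sum_(i <- B) b i < e.
Proof.
move=> b0 [C bC] e e0.
pose S := [set \sum_(i <- A) b i | A in [set: {fset I}]].
have supS : has_sup S.
  by split; [exists (\sum_(i <- fset0) b i), fset0|exists C => _ [A _ <-]].
have [_ [A _ <-] lt] := sup_adherent e0 supS.
exists A => B dAB; rewrite -(ltrD2l (\sum_(i <- A) b i)) -sum_fsetU//.
rewrite (@le_lt_trans _ _ (sup S))// -?ltrBlDr//.
by apply: ub_le_sup; [exact: supS.2|exists (A `|` B)%fset].
Qed.

Lemma sub_bounded_sums b b' : (forall i, b i <= b' i) ->
  bounded_sums b' -> bounded_sums b.
Proof.
move=> bb' [C b'C]; exists C => A; apply: le_trans (b'C A).
exact: ler_sum.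
Qed.

(** The partial sum over [A] is the centre required by the Cauchy criterion: for [B] containing [A],
    the difference is a sum over a set disjoint from [A]. *)
Lemma cvg_partial_sum (K : numFieldType) (V : completeNormedModType K) (x : I -> V) :
  (forall e : K, 0 < e -> exists A, forall B, [disjoint A & B]%fset ->
    `|\sum_(i <- B) x i| < e) ->
  partial_sum x @ totally --> sum x.
Proof.
move=> tl; apply/cauchy_cvgP.
apply: cauchy_exP => e e0; have [A Ae] := tl _ e0.
exists (\sum_(i <- A) x i); exists A => // B /= AB.
rewrite -ball_normE /= partial_sumE (sum_fsetDl _ AB) opprD addrA subrr add0r normrN.
by apply: Ae; rewrite fdisjointXDr.
Qed.

End finite_subsets.

(** * Norms and limits over the complex field *)

Section complex_limits.
Context {R : realType}.

Lemma gt0_complexE (e : R[i]) : 0 < e -> e = (complex.Re e)%:C /\ 0 < complex.Re e.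
Proof. by case: e => a b; rewrite ltcE/= => /andP[/eqP->]. Qed.

Context {V : normedModType R[i]}.

(** The norm of [V] takes its values in [R[i]]; this is the same number in [R], where the order is
    total and [lra] applies. *)
Definition rnorm (x : V) : R := complex.Re `|x|.

Lemma rnormE x : (rnorm x)%:C = `|x|.
Proof. by rewrite RRe_real// ger0_real. Qed.

Lemma rnorm_ge0 x : 0 <= rnorm x.
Proof. by rewrite -ler0c rnormE. Qed.

Lemma cvg_rnormP {T} {F : set_system T} {FF : Filter F} (u : T -> V) (l : V) :
  u @ F --> l <-> forall e : R, 0 < e -> \forall t \near F, rnorm (l - u t) < e.
Proof.
split=> [/cvgrPdist_lt h e e0|h].
  have := h e%:C; rewrite ltcR => /(_ e0); apply: filterS => t.
  by rewrite -rnormE ltcR.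
apply/cvgrPdist_lt => e /gt0_complexE[-> e0]; apply: filterS (h _ e0) => t.
by rewrite -rnormE ltcR.
Qed.

Lemma rnormD x y : rnorm (x + y) <= rnorm x + rnorm y.
Proof. by rewrite -lecR rmorphD/= !rnormE ler_normD. Qed.

Lemma rnormN x : rnorm (- x) = rnorm x.
Proof. by rewrite /rnorm normrN. Qed.

Lemma rnormZ (a : R[i]) x : rnorm (a *: x) = normc a * rnorm x.
Proof. by apply: complexI; rewrite rmorphM/= !rnormE normrZ normcE_norm. Qed.

Lemma rnorm0 : rnorm 0 = 0. Proof. by rewrite /rnorm normr0. Qed.

Lemma rnorm0_eq0 x : rnorm x = 0 -> x = 0.
Proof. by move=> x0; apply/normr0_eq0; rewrite -rnormE x0. Qed.

Lemma rnorm_sum (I : Type) (r : seq I) (P : pred I) (F : I -> V) :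
  rnorm (\sum_(i <- r | P i) F i) <= \sum_(i <- r | P i) rnorm (F i).
Proof.
elim/big_rec2 : _ => [|i y x _ le]; first by rewrite rnorm0.
by rewrite (le_trans (rnormD _ _))// lerD2l.
Qed.

Lemma rnorm_lim_le {T} {F : set_system T} {FF : ProperFilter F} (u : T -> V)
    (l : V) (C : R) :
  u @ F --> l -> (\forall t \near F, rnorm (u t) <= C) -> rnorm l <= C.
Proof.
move=> /cvg_rnormP ul uC; apply/ler_addgt0Pr => e e0.
have [t [lt Ct]] := filter_ex (filterI (ul _ e0) uC).
rewrite -(subrK (u t) l) addrC (le_trans (rnormD _ _))// lerD// ltW//.
Qed.

End complex_limits.

Section unconditional_sums.
Context {R : realType} {I : choiceType}.

Lemma rnorm_complex (z : R[i]) : rnorm (z : R[i]^o) = normc z.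
Proof. by apply: complexI; rewrite rnormE; exact/esym/normcE_norm. Qed.

Lemma normcB_le (x y : R[i]) : `|normc x - normc y| <= normc (x - y).
Proof.
have := le_normcD (x - y) y; have := le_normcD (y - x) x.
rewrite !subrK -[y - x]opprB normcN => h1 h2.
by rewrite ler_norml; apply/andP; split; lra.
Qed.

Lemma cvg_normc {T} {F : set_system T} {FF : Filter F} (u : T -> R[i]) (l : R[i]) :
  (u t : R[i]^o) @[t --> F] --> (l : R[i]^o) -> normc (u t) @[t --> F] --> normc l.
Proof.
move=> /cvg_rnormP ul; apply/cvgrPdist_lt => e /ul; apply: filterS => t.
by rewrite rnorm_complex; apply: le_lt_trans; exact: normcB_le.
Qed.

Lemma cvg_sum_rnorm (V : completeNormedModType R[i]) (x : I -> V) :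
  bounded_sums (fun i => rnorm (x i)) -> partial_sum x @ totally --> sum x.
Proof.
move=> bx; apply: cvg_partial_sum => e /gt0_complexE[-> e0].
have [A Ae] := bounded_sums_tail (fun i => rnorm_ge0 (x i)) bx e0.
exists A => B AB; rewrite -rnormE ltcR (le_lt_trans (rnorm_sum _ _ _))//.
exact: Ae.
Qed.

Lemma cvg_sum_real (x : I -> R) :
  bounded_sums (fun i => `|x i|) ->
  partial_sum x @ totally --> (sum (x : I -> R^o) : R).
Proof.
move=> bx; apply: (@cvg_partial_sum I R R^o) => e e0.
have [A Ae] := bounded_sums_tail (fun i => normr_ge0 (x i)) bx e0.
exists A => B AB; rewrite (le_lt_trans (ler_norm_sum _ _ _))//.
exact: Ae.
Qed.

Lemma Re_sum (T : Type) (r : seq T) (P : pred T) (F : T -> R[i]) :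
  complex.Re (\sum_(i <- r | P i) F i) = \sum_(i <- r | P i) complex.Re (F i).
Proof. by apply: (big_morph (@complex.Re R)) => // -[a b] [a' b']. Qed.

Lemma Im_sum (T : Type) (r : seq T) (P : pred T) (F : T -> R[i]) :
  complex.Im (\sum_(i <- r | P i) F i) = \sum_(i <- r | P i) complex.Im (F i).
Proof. by apply: (big_morph (@complex.Im R)) => // -[a b] [a' b']. Qed.

Lemma normc_le_Re_Im (z : R[i]) : normc z <= `|complex.Re z| + `|complex.Im z|.
Proof.
rewrite -(@ler_pXn2r _ 2)// ?nnegrE ?normc_ge0 ?addr_ge0// sqr_normcE.
by rewrite sqrrD !real_normK ?num_real// lerD2r lerDl mulrn_wge0// mulr_ge0.
Qed.

(** Real and imaginary parts are summed separately, which reduces convergence to the real case. *)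
Definition csum (x : I -> R[i]) : R[i] :=
  (sum (fun i => complex.Re (x i) : R^o) : R) +i*
  (sum (fun i => complex.Im (x i) : R^o) : R).

Lemma cvg_csum (x : I -> R[i]) : bounded_sums (fun i => normc (x i)) ->
  partial_sum (x : I -> R[i]^o) @ totally --> (csum x : R[i]^o).
Proof.
move=> bx; apply/cvg_rnormP => e e0.
have e20 : 0 < e / 2 by rewrite divr_gt0.
have /cvgrPdist_lt/(_ _ e20) hRe := cvg_sum_real
  (sub_bounded_sums (fun i => Re_le_normc (x i)) bx).
have /cvgrPdist_lt/(_ _ e20) hIm := cvg_sum_real
  (sub_bounded_sums (fun i => Im_le_normc (x i)) bx).
near=> A; rewrite rnorm_complex (le_lt_trans (normc_le_Re_Im _))//.
rewrite [ltRHS]splitr ltrD//.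
- rewrite partial_sumE raddfB/= Re_sum -partial_sumE; near: A; exact: hRe.
- rewrite partial_sumE raddfB/= Im_sum -partial_sumE; near: A; exact: hIm.
Unshelve. all: by end_near. Qed.

(** The terms of each sign form a finite subfamily, whose sum is bounded by hypothesis; hence the
    factor 2. *)
Lemma bounded_sums_real (x : I -> R) (C : R) :
  (forall A : {fset I}, `|\sum_(i <- A) x i| <= C) ->
  forall A : {fset I}, \sum_(i <- A) `|x i| <= 2 * C.
Proof.
move=> xC A; rewrite (big_fsetID _ (fun i => 0 <= x i)) /= mulr_natl mulr2n lerD//.
- apply: le_trans (xC _); apply: le_trans (ler_norm _).
  rewrite big_seq [leRHS]big_seq; apply: ler_sum => i.
  by rewrite !inE => /andP[_ ?]; rewrite ger0_norm.
- apply: le_trans (xC _); rewrite -normrN; apply: le_trans (ler_norm _).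
  rewrite -sumrN big_seq [leRHS]big_seq; apply: ler_sum => i.
  by rewrite !inE -ltNge => /andP[_ ?]; rewrite ltr0_norm.
Qed.

(** Past some [A] all sums lie within 1 of [l]. A sum over any [B] is one over the union of [B] and
    [A] minus one over a subset of [A], so all finite sums are bounded, and [bounded_sums_real]
    applies to real and imaginary parts. *)
Lemma bounded_sums_cvg (x : I -> R[i]) (l : R[i]) :
  partial_sum (x : I -> R[i]^o) @ totally --> (l : R[i]^o) ->
  bounded_sums (fun i => normc (x i)).
Proof.
move=> /cvg_rnormP/(_ _ ltr01)[A _ hA].
pose D := \sum_(i <- A) normc (x i).
have bnd (B : {fset I}) : normc (\sum_(i <- B) x i) <= 1 + normc l + D.
  have -> : \sum_(i <- B) x i =
      \sum_(i <- (B `|` A)%fset) x i - \sum_(i <- (A `\` B)%fset) x i.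
    rewrite (@sum_fsetDl I _ x B (B `|` A)%fset) ?fsubsetUl//.
    by rewrite fsetDUl fsetDv fset0U addrK.
  rewrite (le_trans (le_normcD _ _))// normcN lerD//.
    have := hA (B `|` A)%fset; rewrite /= fsubsetUr => /(_ isT).
    rewrite rnorm_complex partial_sumE; move: (\sum_(i <- _) _) => s ls.
    rewrite -[s in normc s](subKr l) (le_trans (le_normcD _ _))// normcN.
    by rewrite addrC lerD2r ltW.
  rewrite (le_trans (normc_sum _ _ _))// le_sum_fset// ?fsubsetDl//.
  by move=> i; exact: normc_ge0.
exists (2 * (1 + normc l + D) + 2 * (1 + normc l + D)) => B.
apply: (@le_trans _ _ (\sum_(i <- B) (`|complex.Re (x i)| + `|complex.Im (x i)|))).
  by apply: ler_sum => i _; exact: normc_le_Re_Im.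
rewrite big_split/= lerD//; apply: bounded_sums_real => B'.
- by rewrite -Re_sum (le_trans (Re_le_normc _)).
- by rewrite -Im_sum (le_trans (Im_le_normc _)).
Qed.

End unconditional_sums.

Section exhaustion.
Context {I : countType}.

(* A sequence of finite sets that is cofinal among all finite sets. *)
Definition initial (n : nat) : {fset I} :=
  seq_fset tt (pmap choice.unpickle (iota 0 n)).

Lemma cvg_initial : initial n @[n --> \oo] --> (@totally I).
Proof.
move=> P [A _ AP].
(* Past the codes of all elements of [A], [initial n] contains [A]. *)
exists (\max_(i <- A) choice.pickle i).+1 => // n /= An; apply: AP => /=.
apply/fsubsetP => i iA; rewrite seq_fsetE mem_pmap; apply/mapP.
exists (choice.pickle i); last by rewrite choice.pickleK.
rewrite mem_iota add0n/= (leq_trans _ An)// ltnS.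
exact: (leq_bigmax_seq (F := choice.pickle) i iA).
Qed.

Lemma cvg_initial_comp (V : topologicalType) (u : {fset I} -> V) (l : V) :
  u @ totally --> l -> u (initial n) @[n --> \oo] --> l.
Proof. by move=> ul; apply: cvg_comp ul; exact: cvg_initial. Qed.

End exhaustion.

(** * Parseval's identity *)

Section complex_measurable.
Context {disp : measure_display} {X : measurableType disp} {R : realType}.
Implicit Types (g : X -> R[i]).

Definition cmeasurable g :=
  measurable_fun setT (fun x => complex.Re (g x)) /\
  measurable_fun setT (fun x => complex.Im (g x)).

Lemma cmeasurable_cst c : cmeasurable (fun=> c).
Proof. by split; exact: measurable_cst. Qed.

Lemma cmeasurableD g1 g2 : cmeasurable g1 -> cmeasurable g2 ->
  cmeasurable (fun x => g1 x + g2 x).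
Proof.
move=> [r1 i1] [r2 i2]; split.
- under eq_fun do rewrite raddfD/=.
  exact: measurable_funD.
- under eq_fun do rewrite raddfD/=.
  exact: measurable_funD.
Qed.

Lemma cmeasurableM g1 g2 : cmeasurable g1 -> cmeasurable g2 ->
  cmeasurable (fun x => g1 x * g2 x).
Proof.
move=> [r1 i1] [r2 i2]; split.
- under eq_fun do rewrite complex_ReM.
  by apply: measurable_funB; exact: measurable_funM.
- under eq_fun do rewrite complex_ImM.
  by apply: measurable_funD; exact: measurable_funM.
Qed.

Lemma cmeasurable_conj g : cmeasurable g -> cmeasurable (fun x => (g x)^*).
Proof.
move=> [r1 i1]; split.
- by rewrite (_ : (fun _ => _) = fun x => complex.Re (g x))//;
    apply/funext => x; case: (g x).
- rewrite (_ : (fun _ => _) = fun x => - complex.Im (g x)).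
    exact: measurable_funN.
  by apply/funext => x; case: (g x).
Qed.

Lemma cmeasurable_sum (I : Type) (r : seq I) (P : pred I) (F : I -> X -> R[i]) :
  (forall i, cmeasurable (F i)) ->
  cmeasurable (fun x => \sum_(i <- r | P i) F i x).
Proof.
move=> mF; elim: r => [|i r IH].
  by under eq_fun do rewrite big_nil; exact: cmeasurable_cst.
under eq_fun do rewrite big_cons.
case: (P i) => //; exact: cmeasurableD.
Qed.

Lemma cmeasurable_prod (I : Type) (r : seq I) (P : pred I) (F : I -> X -> R[i]) :
  (forall i, cmeasurable (F i)) ->
  cmeasurable (fun x => \prod_(i <- r | P i) F i x).
Proof.
move=> mF; elim: r => [|i r IH].
  by under eq_fun do rewrite big_nil; exact: cmeasurable_cst.
under eq_fun do rewrite big_cons.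
case: (P i) => //; exact: cmeasurableM.
Qed.

Lemma cmeasurableX g n : cmeasurable g -> cmeasurable (fun x => g x ^+ n).
Proof.
move=> mg; elim: n => [|n IH]; first exact: cmeasurable_cst.
under eq_fun do rewrite exprS.
exact: cmeasurableM.
Qed.

Lemma cmeasurable_cvg (u : nat -> X -> R[i]) g :
  (forall n, cmeasurable (u n)) ->
  (forall x, (u n x : R[i]^o) @[n --> \oo] --> (g x : R[i]^o)) ->
  cmeasurable g.
Proof.
move=> mu ug; split.
- apply: (measurable_fun_cvg (fun n => (mu n).1)) => x _.
  apply/cvgrPdist_lt => e e0; have /cvg_rnormP/(_ _ e0) := ug x.
  apply: filterS => n; rewrite rnorm_complex; apply: le_lt_trans.
  by rewrite -raddfB Re_le_normc.
- apply: (measurable_fun_cvg (fun n => (mu n).2)) => x _.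
  apply/cvgrPdist_lt => e e0; have /cvg_rnormP/(_ _ e0) := ug x.
  apply: filterS => n; rewrite rnorm_complex; apply: le_lt_trans.
  by rewrite -raddfB Im_le_normc.
Qed.

Lemma cmeasurable_sqnorm g : cmeasurable g ->
  measurable_fun setT (fun x => normc (g x) ^+ 2).
Proof.
move=> [r1 i1]; under eq_fun do rewrite sqr_normcE.
by apply: measurable_funD; exact: measurable_funX.
Qed.

End complex_measurable.

(** * Integration over polydiscs *)

Section polydisc.
Context {R : realType} {d : nat}.
Local Notation C := R[i].
Local Notation Rm := (measurableTypeR R).
Local Notation T := (d.-tuple (Rm * Rm)).
Local Notation cpoint := Defs.cpoint.
Local Notation nu := (@lebesgue_C R d).
Implicit Types (m : multinom d) (t : T).

Definition gweight t : R := gauss_weight (cpoint t).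

(** Polydiscs are invariant under coordinatewise rotations, and every monomial is bounded on them,
    so products of monomials can be integrated there term by term. *)
Definition polydisc (r : R) : set T :=
  [set t | forall j, normc (cpoint t j) ^+ 2 <= r].

Lemma gweight_ge0 t : 0 <= gweight t.
Proof.
rewrite /gweight gauss_weight_cpoint; apply: prodr_ge0 => j _.
exact/ltW/gauss_density_gt0.
Qed.

Lemma cmeasurable_cpoint j : cmeasurable (fun t => cpoint t j).
Proof.
split; apply: measurableT_comp => //; exact: measurable_tnth.
Qed.

Lemma cmeasurable_monomial m : cmeasurable (fun t => @monomial R d m (cpoint t)).
Proof.
by apply: cmeasurable_prod => j; apply: cmeasurableX; exact: cmeasurable_cpoint.
Qed.

Lemma measurable_gweight : measurable_fun setT gweight.
Proof.
rewrite (_ : gweight = fun t => \prod_j gauss_density (tnth t j)); last first.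
  by apply/funext => t; exact: gauss_weight_cpoint.
apply: measurable_prod => j _; apply: measurableT_comp.
- exact: measurable_gauss_density.
- exact: measurable_tnth.
Qed.

Lemma measurable_polydisc r : measurable (polydisc r).
Proof.
rewrite (_ : polydisc r = \bigcap_(j in [set: 'I_d])
    ((fun t => normc (cpoint t j) ^+ 2) @^-1` `]-oo, r]%classic)); last first.
  apply/seteqP; split => t /= h j.
    by move=> _; rewrite /= in_itv/=; exact: h.
  by have := h j I; rewrite /= in_itv.
apply: fin_bigcap_measurable => // j _.
rewrite -[X in measurable X]setTI; apply: cmeasurable_sqnorm => //.
exact: cmeasurable_cpoint.
Qed.

Lemma measurable_sqnorm_gweight (g : T -> C) : cmeasurable g ->
  measurable_fun setT (fun t => (normc (g t) ^+ 2 * gweight t)%:E).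
Proof.
move=> mg; apply/measurable_EFinP/measurable_funM.
  exact: cmeasurable_sqnorm.
exact: measurable_gweight.
Qed.

Lemma integrable_gweight (D : set T) : measurable D ->
  nu.-integrable D (EFin \o gweight).
Proof.
move=> mD; apply: (@integrableS _ _ _ nu setT) => //.
have mw : measurable_fun setT (EFin \o gweight).
  by apply/measurable_EFinP; exact: measurable_gweight.
apply/integrableP; split => //.
(* The monomial of exponent 0 is the constant 1, so its squared norm is the total mass of the
   weight. *)
have := @fock_sqnorm_monomial R d mnm0.
rewrite /fock_sqnorm => h; apply: (@le_lt_trans _ _ (weight (R:=R) (@mnm0 d))%:E); last exact: ltry.
rewrite -h; apply: ge0_le_integral => //.
- exact: measurableT_comp.
- by apply: measurable_sqnorm_gweight; exact: cmeasurable_monomial.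
move=> t _ /=; rewrite lee_fin ger0_norm ?gweight_ge0// /monomial big1 ?normc1 ?expr1n ?mul1r//.
by move=> j _; rewrite mnm0E.
Qed.

Lemma integrable_polydisc (g : T -> C) (r B : R) : cmeasurable g ->
  (forall t, polydisc r t -> normc (g t) <= B) ->
  nu.-integrable (polydisc r) (fun t => (complex.Re (g t) * gweight t)%:E).
Proof.
move=> mg gB; have mD := measurable_polydisc r.
apply: (@le_integrable _ _ _ nu _ mD _ (fun t => (B * gweight t)%:E)).
- apply/measurable_EFinP; apply: measurable_funTS; apply: measurable_funM.
    exact: mg.1.
  exact: measurable_gweight.
- move=> t Dt; rewrite /= lee_fin !normrM ler_wpM2r//.
  by rewrite (le_trans (Re_le_normc _))// (le_trans (gB _ Dt))// ler_norm.
- under eq_fun do rewrite EFinM.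
  by apply: integrableZl => //; exact: integrable_gweight.
Qed.

(** As r <= (1 + r)^2, [1 + r] can replace the square root of [r]; the bound is then the value of
    the monomial at the point with all coordinates [1 + r]. *)
Lemma monomial_polydisc_le r t m : 0 <= r -> polydisc r t ->
  normc (monomial m (cpoint t)) <= \prod_(j < d) (1 + r) ^+ m j.
Proof.
move=> r0 Dt; rewrite normc_monomial; apply: ler_prod => j _.
rewrite exprn_ge0 ?normc_ge0//= lerXn2r ?nnegrE ?normc_ge0 ?addr_ge0//.
rewrite -(@ler_pXn2r _ 2)// ?nnegrE ?normc_ge0 ?addr_ge0//.
apply: (le_trans (Dt j)).
rewrite sqrrD expr1n mul1r; nra.
Qed.

(** Any k-th root of i will do: its modulus is 1 since its k-th power has modulus 1, and it is not
    real since i is not. The factorisation of a rotation into shears divides by the imaginary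
    part. *)
Lemma unimodular_root k : (0 < k)%N ->
  exists w : C, [/\ normc w = 1, complex.Im w != 0 & w ^+ k = 'i%C].
Proof.
move=> k0; pose w : C := k.-root ('i%C : C).
have wk : w ^+ k = 'i%C by exact: rootCK.
exists w; split=> //.
- apply/eqP; rewrite -(@pexpr_eq1 _ _ k) ?normc_ge0//.
  by rewrite -normcX wk /= expr0n/= add0r expr1n sqrtr1.
- apply/eqP => w0; have we : w = (complex.Re w)%:C.
    by move: w0; case: (w) => a b /= ->.
  move: wk; rewrite we -rmorphXn/= => /(congr1 (@complex.Im R))/= /esym/eqP.
  by rewrite oner_eq0.
Qed.

Definition rotate (j : 'I_d) (w : C) : T -> T :=
  tuple_map (fun i => if i == j then rotation w else id).

Lemma cpoint_rotate j w t i :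
  cpoint (rotate j w t) i = (if i == j then w else 1) * cpoint t i.
Proof.
rewrite /cpoint tnth_mktuple; case: eqP => [_|_]; last by rewrite mul1r.
rewrite /rotation/=; case: w => a b; case: (tnth t i) => x y /=.
by rewrite [b * x + _]addrC.
Qed.

Lemma normc_cpoint_rotate j w t i : normc w = 1 ->
  normc (cpoint (rotate j w t) i) = normc (cpoint t i).
Proof.
by move=> w1; rewrite cpoint_rotate normcM; case: eqP;
  rewrite ?w1 ?normc1 mul1r.
Qed.

Lemma monomial_rotate j w t m :
  monomial m (cpoint (rotate j w t)) = w ^+ m j * monomial m (cpoint t).
Proof.
rewrite /monomial; under eq_bigr do rewrite cpoint_rotate exprMn.
rewrite big_split/=; congr (_ * _); rewrite (bigD1 j)//= eqxx big1 ?mulr1//.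
by move=> i /negbTE ->; rewrite expr1n.
Qed.

Lemma integral_rotate j w (F : T -> \bar R) : normc w = 1 -> complex.Im w != 0 ->
  measurable_fun setT F ->
  (\int[nu]_t F (rotate j w t) = \int[nu]_t F t)%E.
Proof.
move=> w1 w0 mF.
have mphi i : measurable_fun setT (if i == j then rotation w else id).
  by case: ifP => _; [exact: measurable_rotation|exact: measurable_id].
have key (G : T -> \bar R) : measurable_fun setT G -> (forall t, 0 <= G t)%E ->
    (\int[nu]_t G (rotate j w t) = \int[nu]_t G t)%E.
  move=> mG G0; apply: ge0_integral_tuple_map => // i H mH H0.
  by case: ifP => // _; exact: ge0_integral_rotation.
rewrite integralE [RHS]integralE -(key F^\+)%E// -?(key F^\-)%E//.
- by congr (_ - _)%E; apply: eq_integral => t _; rewrite ?funeposE ?funenegE.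
- exact: measurable_funeneg.
- exact: measurable_funepos.
Qed.

(* If m_j and n_j differ, rotating the j-th coordinate by an |m_j - n_j|-th root
   of 'i multiplies the integrand by +-'i, without changing the integral. *)
Lemma integral_monomial_orthogonal m n (c : C) (r : R) : 0 <= r -> m != n ->
  \int[nu]_(t in polydisc r) (complex.Re
     (c * (monomial m (cpoint t) * (monomial n (cpoint t))^*)) * gweight t) = 0.
Proof.
move=> r0 mn; have mD := measurable_polydisc r.
pose g c t : C := c * (monomial m (cpoint t) * (monomial n (cpoint t))^*).
pose J c := \int[nu]_(t in polydisc r) (complex.Re (g c t) * gweight t).
have mg e : cmeasurable (g e).
  apply: cmeasurableM; first exact: cmeasurable_cst.
  apply: cmeasurableM; first exact: cmeasurable_monomial.
  exact/cmeasurable_conj/cmeasurable_monomial.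
have mF e : measurable_fun setT
    (fun t => (complex.Re (g e t) * gweight t)%:E).
  apply/measurable_EFinP; apply: measurable_funM; first exact: (mg e).1.
  exact: measurable_gweight.
have [j mj] : exists j, m j != n j.
  apply/existsP; rewrite -negb_forall; apply: contra mn => /forallP h.
  by apply/eqP/mnmP => j; apply/eqP.
(* Only real parts are integrated, so the factor [u] cannot be pulled out of [J]. Using the
   invariance twice gives [J (- c) = J c], whereas [J] is odd. *)
have [u [u2 Ju]] : exists u : C, u ^+ 2 = -1 /\ forall e, J (e * u) = J e.
  have rot (w e : C) : normc w = 1 -> complex.Im w != 0 ->
      J (e * (w ^+ m j * (w^*) ^+ n j)) = J e.
    move=> w1 w0; rewrite /J /Rintegral; congr fine.
    rewrite [RHS]integral_mkcond -(integral_rotate j w1 w0); last first.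
      by apply/(measurable_restrictT _ mD)/measurable_funTS.
    rewrite integral_mkcond; apply: eq_integral => t _.
    rewrite /patch (_ : (rotate j w t \in polydisc r) = (t \in polydisc r)); last first.
      by apply/idP/idP => /set_mem h; apply/mem_set => i; have := h i;
        rewrite normc_cpoint_rotate.
    case: ifP => // _; congr (_%:E).
    rewrite /gweight /gauss_weight.
    under [in RHS]eq_bigr do rewrite normc_cpoint_rotate//.
    congr (complex.Re _ * _); rewrite /g !monomial_rotate rmorphM rmorphXn/=.
    ring.
  have wJ (w : C) : normc w = 1 -> w * w^* = 1.
    by move=> w1; rewrite mulC_conj w1 expr1n.
  have i2 : ('i%C : C) ^+ 2 = -1 by exact: sqr_i.
  have [lt|lt|e] := ltngtP (m j) (n j); last by rewrite e eqxx in mj.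
  - have [|w [w1 w0 wk]] := @unimodular_root (n j - m j); first by rewrite subn_gt0.
    have iJ : ('i%C : C)^* = - 'i%C by apply/eqP; rewrite eq_complex/= oppr0 !eqxx.
    exists ('i%C : C)^*; split; first by rewrite iJ sqrrN.
    move=> e; rewrite -[RHS](rot w)//; congr (J (e * _)).
    by rewrite -(subnKC (ltnW lt)) exprD mulrA -exprMn wJ// expr1n mul1r -wk rmorphXn.
  - have [|w [w1 w0 wk]] := @unimodular_root (m j - n j); first by rewrite subn_gt0.
    exists ('i%C : C); split => // e; rewrite -[RHS](rot w)//; congr (J (e * _)).
    by rewrite -(subnK (ltnW lt)) exprD -mulrA -exprMn wJ// expr1n mulr1 wk.
have JN : J (- c) = - J c.
  rewrite /J -[RHS]mulN1r -RintegralZl//; last first.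
    apply: (@integrable_polydisc _ _ (normc c *
      (\prod_(i < d) (1 + r) ^+ m i * \prod_(i < d) (1 + r) ^+ n i))) => // t Dt.
    rewrite !normcM ler_wpM2l ?normc_ge0// normc_conj.
    by rewrite ler_pM ?normc_ge0// monomial_polydisc_le.
  by apply: eq_Rintegral => t _; rewrite /g mulNr raddfN/= mulN1r mulNr.
have : J c = - J c by rewrite -JN -mulrN1 -u2 expr2 mulrA !Ju.
by move=> h; rewrite -/(J c); lra.
Qed.

End polydisc.

Lemma cvg_bigsum (K : numFieldType) (V : normedModType K) (I S : Type) (r : seq I)
    (F : set_system S) {FF : Filter F} (u : I -> S -> V) (l : I -> V) :
  (forall i, u i @ F --> l i) ->
  \sum_(i <- r) u i s @[s --> F] --> \sum_(i <- r) l i.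
Proof.
move=> ul; elim: r => [|i r IH].
  rewrite big_nil; under eq_fun do rewrite big_nil.
  exact: cvg_cst.
rewrite big_cons; under eq_fun do rewrite big_cons.
exact: cvgD.
Qed.

Section parseval.
Context {R : realType} {d : nat}.
Local Notation C := R[i].
Local Notation Rm := (measurableTypeR R).
Local Notation T := (d.-tuple (Rm * Rm)).
Local Notation cpoint := Defs.cpoint.
Local Notation nu := (@lebesgue_C R d).
Implicit Types (m : multinom d) (t : T) (a : multinom d -> C) (f : ('I_d -> C) -> C).
Implicit Types (A : {fset multinom d}).

Lemma Rintegral_sum (I : Type) (s : seq I) (F : I -> T -> R) (D : set T) :
  measurable D -> (forall i, nu.-integrable D (fun t => (F i t)%:E)) ->
  nu.-integrable D (fun t => (\sum_(i <- s) F i t)%:E) /\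
  \int[nu]_(t in D) (\sum_(i <- s) F i t) = \sum_(i <- s) \int[nu]_(t in D) F i t.
Proof.
move=> mD iF; elim: s => [|i s [IHi IH]].
  rewrite big_nil; split.
    under eq_fun do rewrite big_nil.
    exact: integrable0.
  rewrite /Rintegral (_ : (fun _ => _) = cst 0%E) ?integral0//.
  by apply/funext => t; rewrite big_nil.
have E : (fun t => \sum_(j <- i :: s) F j t) = fun t => F i t + \sum_(j <- s) F j t.
  by apply/funext => t; rewrite big_cons.
rewrite E big_cons -IH; split; last exact: (RintegralD mD (iF i) IHi).
under eq_fun do rewrite big_cons EFinD.
exact: (integrableD mD (iF i) IHi).
Qed.

Lemma integrable_sqnorm_polydisc (g : T -> C) (r B : R) : cmeasurable g ->
  (forall t, polydisc r t -> normc (g t) <= B) ->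
  nu.-integrable (polydisc r) (fun t => (normc (g t) ^+ 2 * gweight t)%:E).
Proof.
move=> mg gB.
rewrite (_ : (fun _ => _) = fun t => (complex.Re (g t * (g t)^*) * gweight t)%:E).
  apply: (@integrable_polydisc _ _ _ _ (B * B)).
    exact: (cmeasurableM mg (cmeasurable_conj mg)).
  by move=> t Dt; rewrite normcM normc_conj ler_pM ?normc_ge0// gB.
by apply/funext => t; rewrite mulC_conj.
Qed.

Definition partial_series a A (z : 'I_d -> C) : C :=
  \sum_(m <- A) a m * monomial m z.

Lemma cmeasurable_partial_series a A :
  cmeasurable (fun t => partial_series a A (cpoint t)).
Proof.
apply: cmeasurable_sum => m; apply: cmeasurableM; first exact: cmeasurable_cst.
exact: cmeasurable_monomial.
Qed.

Lemma power_series_cvg_initial f a z : power_series_of f a ->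
  (partial_series a (initial n) z : R[i]^o) @[n --> \oo] --> (f z : R[i]^o).
Proof.
move=> fa; have := cvg_initial_comp (fa z).
by under eq_fun do rewrite partial_sumE.
Qed.

Lemma cmeasurable_entire f : entire f -> cmeasurable (fun t => f (cpoint t)).
Proof.
move=> [a fa]; apply: (@cmeasurable_cvg _ _ _
  (fun n t => partial_series a (initial n) (cpoint t))).
- by move=> n; exact: cmeasurable_partial_series.
- by move=> t; exact: power_series_cvg_initial.
Qed.

Definition polydisc_weight (r : R) m : R :=
  \int[nu]_(t in polydisc r) (normc (@monomial R d m (cpoint t)) ^+ 2 * gweight t).

(** Expanding the square gives a double sum whose off-diagonal terms vanish by orthogonality on the
    polydisc. *)
Lemma integral_partial_series a A (r : R) : 0 <= r ->
  \int[nu]_(t in polydisc r)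
     (normc (partial_series a A (cpoint t)) ^+ 2 * gweight t) =
  \sum_(m <- A) normc (a m) ^+ 2 * polydisc_weight r m.
Proof.
move=> r0; have mD := @measurable_polydisc R d r.
pose F (m n : multinom d) t : R := complex.Re
  (a m * (a n)^* * (monomial m (cpoint t) * (monomial n (cpoint t))^*)) * gweight t.
have iF m n : nu.-integrable (polydisc r) (fun t => (F m n t)%:E).
  apply: (@integrable_polydisc _ _ _ _ (normc (a m * (a n)^*) *
      (\prod_(i < d) (1 + r) ^+ m i * \prod_(i < d) (1 + r) ^+ n i))).
    apply: cmeasurableM; first exact: cmeasurable_cst.
    apply: cmeasurableM; first exact: cmeasurable_monomial.
    exact/cmeasurable_conj/cmeasurable_monomial.
  move=> t Dt; rewrite normcM ler_wpM2l ?normc_ge0// normcM normc_conj.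
  by rewrite ler_pM ?normc_ge0// monomial_polydisc_le.
transitivity (\int[nu]_(t in polydisc r) (\sum_(m <- A) \sum_(n <- A) F m n t)).
  apply: eq_Rintegral => t _.
  rewrite -[normc _ ^+ 2]/(complex.Re ((normc _ ^+ 2)%:C)) -mulC_conj rmorph_sum/=.
  rewrite mulr_suml Re_sum mulr_suml; apply: eq_bigr => m _.
  rewrite mulr_sumr Re_sum mulr_suml; apply: eq_bigr => n _.
  by rewrite /F rmorphM/=; congr (complex.Re _ * _); ring.
have iFm m := Rintegral_sum A mD (iF m).
rewrite (Rintegral_sum A mD (fun m => (iFm m).1)).2.
rewrite big_seq [RHS]big_seq; apply: eq_bigr => m mA.
rewrite (iFm m).2 (big_fsetD1 m)//= big1_fset ?addr0; last first.
  move=> n; rewrite !inE => /andP[nm _] _.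
  by rewrite integral_monomial_orthogonal// eq_sym.
rewrite /polydisc_weight -RintegralZl//; last first.
  apply: (@integrable_sqnorm_polydisc _ _ (\prod_(i < d) (1 + r) ^+ m i)).
    exact: cmeasurable_monomial.
  by move=> t Dt; exact: monomial_polydisc_le.
by apply: eq_Rintegral => t _; rewrite /F !mulC_conj -rmorphM/= [RHS]mulrA.
Qed.

Lemma integrable_partial_series a A (r : R) : 0 <= r ->
  nu.-integrable (polydisc r) (fun t =>
     (normc (partial_series a A (cpoint t)) ^+ 2 * gweight t)%:E).
Proof.
move=> r0.
pose B := \sum_(m <- A) normc (a m) * \prod_(i < d) (1 + r) ^+ m i.
apply: (@integrable_sqnorm_polydisc _ _ B).
  exact: cmeasurable_partial_series.
move=> t Dt; rewrite (le_trans (normc_sum _ _ _))//; apply: ler_sum => m _.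
by rewrite normcM ler_wpM2l ?normc_ge0// monomial_polydisc_le.
Qed.

(* Dominated convergence: on the polydisc the partial sums are dominated by the
   absolute series at the point (1 + r, ..., 1 + r). *)
Lemma cvg_integral_partial_series f a (r : R) : 0 <= r -> power_series_of f a ->
  (\int[nu]_(t in polydisc r)
     (normc (partial_series a (initial n) (cpoint t)) ^+ 2 * gweight t)%:E
     @[n --> \oo] -->
  \int[nu]_(t in polydisc r) (normc (f (cpoint t)) ^+ 2 * gweight t)%:E)%E.
Proof.
move=> r0 fa; have mD := @measurable_polydisc R d r.
have [B hB] := bounded_sums_cvg (fa (fun=> (1 + r)%:C)).
have B0 : 0 <= B by apply: le_trans (hB fset0); rewrite big_seq_fset0.
have SB t A : polydisc r t -> normc (partial_series a A (cpoint t)) <= B.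
  move=> Dt; apply: le_trans (hB A); rewrite (le_trans (normc_sum _ _ _))//.
  apply: ler_sum => m _; rewrite !normcM ler_wpM2l ?normc_ge0//.
  rewrite (le_trans (monomial_polydisc_le m r0 Dt))// normc_monomial.
  by under [leRHS]eq_bigr do rewrite normc_real ger0_norm ?addr_ge0//.
apply: (@dominated_cvg _ _ _ nu _ mD _ _ (fun t => (B ^+ 2 * gweight t)%:E)).
- move=> n; apply: measurable_funTS; apply: measurable_sqnorm_gweight.
  exact: cmeasurable_partial_series.
- move=> t Dt; apply/cvg_EFin; first exact: nearW.
  apply: cvgMl; rewrite expr2.
  have cf : normc (partial_series a (initial n) (cpoint t)) @[n --> \oo] --> normc (f (cpoint t)).
    apply: cvg_normc; exact: power_series_cvg_initial.
  under eq_fun do rewrite expr2.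
  exact: cvgM.
- by [].
- under eq_fun do rewrite EFinM.
  apply: integrableZl => //.
  exact: integrable_gweight.
- move=> n t Dt; rewrite /= lee_fin ger0_norm; last first.
    by apply: mulr_ge0; [exact: sqr_ge0|exact: gweight_ge0].
  apply: ler_wpM2r; first exact: gweight_ge0.
  by rewrite lerXn2r ?nnegrE ?normc_ge0//; exact: SB.
Qed.

Definition sqsum a : \bar R :=
  ereal_sup [set (\sum_(m <- A) normc (a m) ^+ 2 * weight m)%:E | A in
    [set: {fset multinom d}]].

Lemma sqsum_ge a A :
  ((\sum_(m <- A) normc (a m) ^+ 2 * weight m)%:E <= sqsum a)%E.
Proof. by apply: ereal_sup_ubound; exists A. Qed.

Lemma cvg_integral_polydisc (g : T -> \bar R) : measurable_fun setT g ->
  (forall t, 0 <= g t)%E ->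
  (\int[nu]_(t in polydisc N%:R) g t @[N --> \oo] --> \int[nu]_t g t)%E.
Proof.
move=> mg g0.
have -> : (\int[nu]_t g t = \int[nu]_(t in \bigcup_N polydisc N%:R) g t)%E.
  congr (integral nu _ g); apply/seteqP; split => // t _.
  pose s := \sum_(j < d) normc (cpoint t j) ^+ 2.
  have [N Ns] : exists N : nat, s <= N%:R.
    exists (Num.bound s); apply/ltW/archi_boundP.
    by apply: sumr_ge0 => j _; exact: sqr_ge0.
  exists N => // j; rewrite (le_trans _ Ns)// /s (bigD1 j)//= lerDl.
  by apply: sumr_ge0 => i _; exact: sqr_ge0.
apply: ge0_nondecreasing_set_cvg_integral.
- move=> m n mn; apply/subsetPset => t Dt j.
  by rewrite (le_trans (Dt j))// ler_nat.
- by move=> N; exact: measurable_polydisc.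
- by move=> N; exact: measurable_funTS.
- by [].
Qed.

Lemma polydisc_weight_ge0 r m : 0 <= polydisc_weight r m.
Proof.
by apply: Rintegral_ge0 => t _; rewrite mulr_ge0 ?sqr_ge0 ?gweight_ge0.
Qed.

Lemma polydisc_weightE (r : R) m : 0 <= r ->
  (\int[nu]_(t in polydisc r)
     (normc (@monomial R d m (cpoint t)) ^+ 2 * gweight t)%:E =
   (polydisc_weight r m)%:E)%E.
Proof.
move=> r0; rewrite fineK//; apply: integrable_fin_num.
  exact: measurable_polydisc.
have := integrable_partial_series (fun=> 1) [fset m]%fset r0.
by under eq_fun do rewrite /partial_series big_seq_fset1 mul1r.
Qed.

Lemma polydisc_weight_le (r : R) m : 0 <= r -> polydisc_weight r m <= weight m.
Proof.
move=> r0; rewrite -lee_fin -polydisc_weightE// -fock_sqnorm_monomial.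
apply: ge0_subset_integral => //.
- exact: measurable_polydisc.
- by apply: measurable_sqnorm_gweight; exact: cmeasurable_monomial.
- by move=> t _; rewrite lee_fin mulr_ge0 ?sqr_ge0 ?gweight_ge0.
Qed.

Lemma cvg_polydisc_weight m : polydisc_weight N%:R m @[N --> \oo] --> weight m.
Proof.
apply: fine_cvg; rewrite -fock_sqnorm_monomial.
have := @cvg_integral_polydisc
  (fun t => (normc (@monomial R d m (cpoint t)) ^+ 2 * gweight t)%:E).
apply.
- by apply: measurable_sqnorm_gweight; exact: cmeasurable_monomial.
- by move=> t; rewrite lee_fin mulr_ge0 ?sqr_ge0 ?gweight_ge0.
Qed.

(** Two limits are involved: in [n] for the partial sums on a fixed polydisc, then in [N] for the
    polydiscs. *)
Lemma parseval f a : power_series_of f a -> fock_sqnorm f = sqsum a.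
Proof.
move=> fa.
have mf : measurable_fun setT (fun t => (normc (f (cpoint t)) ^+ 2 * gweight t)%:E).
  by apply: measurable_sqnorm_gweight; apply: cmeasurable_entire; exists a.
have f0 t : (0 <= (normc (f (cpoint t)) ^+ 2 * gweight t)%:E)%E.
  by rewrite lee_fin mulr_ge0 ?sqr_ge0 ?gweight_ge0.
have ES (N : nat) n : (\int[nu]_(t in polydisc N%:R)
     (normc (partial_series a (initial n) (cpoint t)) ^+ 2 * gweight t)%:E =
     (\sum_(m <- initial n) normc (a m) ^+ 2 * polydisc_weight N%:R m)%:E)%E.
  rewrite -integral_partial_series// fineK//; apply: integrable_fin_num.
    exact: measurable_polydisc.
  exact: integrable_partial_series.
have fN := cvg_integral_polydisc mf f0.
apply/eqP; rewrite eq_le; apply/andP; split.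
(* On each polydisc the weights are at most [weight m], so every partial sum contributes at most
   [sqsum a]. *)
- apply: (cvge_le _ fN); near=> N.
  have := cvg_integral_partial_series (ler0n R N) fa.
  under eq_fun do rewrite ES.
  move=> h; apply: (cvge_le _ h); near=> n.
  apply: le_trans (sqsum_ge a (initial n)); rewrite lee_fin.
  apply: ler_sum => m _; rewrite ler_wpM2l ?sqr_ge0// polydisc_weight_le//.
(* For fixed [A] the radius may grow term by term. On each polydisc the sum over [A] is below those
   over the sets [initial n] that contain it, hence below the integral of |f|^2. *)
- apply: ge_ereal_sup => _ [A _ <-].
  have cA : (\sum_(m <- A) normc (a m) ^+ 2 * polydisc_weight N%:R m)%:E
      @[N --> \oo] --> (\sum_(m <- A) normc (a m) ^+ 2 * weight m)%:E.
    apply: cvg_EFin; first exact: nearW.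
    apply: (@cvg_bigsum R R^o) => m; apply: cvgMr; exact: cvg_polydisc_weight.
  apply: (cvge_le _ cA); near=> N.
  apply: (@le_trans _ _ (\int[nu]_(t in polydisc N%:R)
      (normc (f (cpoint t)) ^+ 2 * gweight t)%:E)%E).
    have := cvg_integral_partial_series (ler0n R N) fa.
    under eq_fun do rewrite ES.
    move=> h; apply: (cvge_ge _ h).
    have [n0 _ hn0] := @cvg_initial (multinom d) [set B | (A `<=` B)%fset]
      (ex_intro2 _ _ A I (fun B h => h)).
    exists n0 => // n /hn0 An; rewrite lee_fin.
    apply: le_sum_fset => // m; by rewrite mulr_ge0 ?sqr_ge0 ?polydisc_weight_ge0.
  apply: ge0_subset_integral => //; exact: measurable_polydisc.
Unshelve. all: by end_near. Qed.

End parseval.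

(** * The Fock space as a weighted l^2 space *)

Section real_inequalities.
Context {R : realType}.

(** For [B] positive the minimum is at - P / B. The Cauchy-Schwarz inequalities and the Riesz
    theorem below all reduce to such a quadratic in a real variable. *)
Lemma discriminant_le0 (A B P : R) : 0 <= B ->
  (forall s : R, 0 <= A + 2 * s * P + s ^+ 2 * B) -> P ^+ 2 <= A * B.
Proof.
rewrite le_eqVlt => /predU1P[<-|B0] h.
  rewrite mulr0; have [->|P0] := eqVneq P 0; first by rewrite expr0n.
  (* With [B = 0] the expression is affine in [s]; this [s] gives it the value -1. *)
  have := h (- (A + 1) / (2 * P)).
  rewrite mulr0 addr0.
  have -> : A + 2 * (- (A + 1) / (2 * P)) * P = -1 by field.
  by rewrite lerNr oppr0 ler10.
have := h (- P / B).
have -> : A + 2 * (- P / B) * P + (- P / B) ^+ 2 * B = A - P ^+ 2 / B.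
  by field; rewrite gt_eqF.
by rewrite subr_ge0 ler_pdivrMr.
Qed.

Lemma cauchy_schwarz_sum (I : Type) (r : seq I) (x y : I -> R) :
  (\sum_(i <- r) x i * y i) ^+ 2 <=
  (\sum_(i <- r) x i ^+ 2) * (\sum_(i <- r) y i ^+ 2).
Proof.
apply: discriminant_le0; first by apply: sumr_ge0 => i _; exact: sqr_ge0.
move=> s.
have -> : \sum_(i <- r) x i ^+ 2 + 2 * s * \sum_(i <- r) x i * y i +
    s ^+ 2 * \sum_(i <- r) y i ^+ 2 = \sum_(i <- r) (x i + s * y i) ^+ 2.
  rewrite !mulr_sumr -!big_split/=; apply: eq_bigr => i _; ring.
by apply: sumr_ge0 => i _; exact: sqr_ge0.
Qed.

(** The passage to the limit made twice in [expansion_value]: there [s1] is the distance from a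
    residue to its limit and [s2] the norm of its image under iota. *)
Lemma le0_of_small (X A B : R) (s1 s2 : nat -> R) : 0 <= A -> 0 <= B ->
  (forall e, 0 < e -> exists N, forall n, (N <= n)%N -> s1 n <= e) ->
  (forall e, 0 < e -> exists N, forall n, (N <= n)%N -> s2 n <= e) ->
  (forall n, X <= A * s1 n + B * s2 n) -> X <= 0.
Proof.
move=> A0 B0 h1 h2 hX; apply/ler_addgt0Pr => e e0; rewrite add0r.
have D0 : 0 < A + B + 1 by rewrite ltr_wpDl ?addr_ge0.
have d0 : 0 < e / (A + B + 1) by rewrite divr_gt0.
have [N1 hN1] := h1 _ d0; have [N2 hN2] := h2 _ d0.
have le1 := hN1 _ (leq_maxl N1 N2); have le2 := hN2 _ (leq_maxr N1 N2).
apply: le_trans (hX (maxn N1 N2)) _.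
apply: (@le_trans _ _ ((A + B + 1) * (e / (A + B + 1)))); last first.
  by rewrite mulrC divfK// gt_eqF.
move: le1 le2 (ltW d0); move: (s1 _) (s2 _) (e / _) => x y t xt yt t0.
have := ler_wpM2l A0 xt; have := ler_wpM2l B0 yt; lra.
Qed.

End real_inequalities.

Section fock_coefficients.
Context {R : realType} {d : nat}.
Local Notation C := R[i].
Implicit Types (m : multinom d) (a b : multinom d -> C) (f g : ('I_d -> C) -> C).
Implicit Types (A : {fset multinom d}) (c : C).

Definition coef_sqsum a A : R := \sum_(m <- A) normc (a m) ^+ 2 * weight m.

Lemma coef_sqsum_ge0 a A : 0 <= coef_sqsum a A.
Proof. by apply: sumr_ge0 => m _; rewrite mulr_ge0 ?sqr_ge0 ?weight_ge0. Qed.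

Lemma power_seriesD f g a b c : power_series_of f a -> power_series_of g b ->
  power_series_of (fun z => c * f z + g z) (fun m => c * a m + b m).
Proof.
move=> fa gb z.
rewrite (_ : partial_sum _ = fun A =>
    c *: (partial_sum (fun m => a m * monomial m z) A : R[i]^o) +
    (partial_sum (fun m => b m * monomial m z) A : R[i]^o)).
  exact: cvgD (cvgZl_tmp (k := c) (fa z)) (gb z).
apply/funext => A; rewrite !partial_sumE scaler_sumr -big_split/=.
by apply: eq_bigr => m _; rewrite /GRing.scale/= mulrDl mulrA.
Qed.

Lemma fock_sqnorm_ge0 f : (0 <= fock_sqnorm f)%E.
Proof.
apply: integral_ge0 => t _; rewrite lee_fin mulr_ge0 ?sqr_ge0//.
exact: gweight_ge0.
Qed.

(** By Parseval the difference of the two series has norm 0, so each of its coefficients vanishes.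
    This determines [taylor_coef], which is defined by choice. *)
Lemma power_series_unique f a b :
  power_series_of f a -> power_series_of f b -> a = b.
Proof.
move=> fa fb; have h := power_seriesD (c := -1) fa fb.
have f0 : (fun z => -1 * f z + f z) = (fun=> 0) by apply/funext => z; ring.
have := parseval h; rewrite f0 /fock_sqnorm.
under eq_integral do rewrite normc0 expr0n/= mul0r.
rewrite integral0 => /esym s0; apply/funext => m.
have := sqsum_ge (fun m => -1 * a m + b m) [fset m]%fset.
rewrite s0 big_seq_fset1 lee_fin pmulr_lle0 ?weight_gt0// => le0.
have /eqP := le_anti (introT andP (conj le0 (sqr_ge0 _))).
rewrite sqrf_eq0 normc_eq0 mulN1r addrC subr_eq0 => /eqP.
by move=> ->.
Qed.

Lemma taylor_coefP f : entire f -> power_series_of f (taylor_coef f).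
Proof. by move=> [a fa]; exact: (xgetPex (fun=> 0) (ex_intro _ a fa)). Qed.

Lemma taylor_coefE f a : power_series_of f a -> taylor_coef f = a.
Proof.
by move=> fa; apply: (power_series_unique _ fa); apply: taylor_coefP; exists a.
Qed.

Definition fock_sq f : R := fine (fock_sqnorm f).

Lemma fock_sqE f : fock f -> fock_sqnorm f = (fock_sq f)%:E.
Proof. by move=> [_ foo]; rewrite fineK// ge0_fin_numE// fock_sqnorm_ge0. Qed.

Lemma fock_sq_ge0 f : 0 <= fock_sq f.
Proof. by rewrite fine_ge0 ?fock_sqnorm_ge0. Qed.

Lemma coef_sqsum_le f A : fock f -> coef_sqsum (taylor_coef f) A <= fock_sq f.
Proof.
move=> ff; rewrite -lee_fin -fock_sqE// (parseval (taylor_coefP ff.1)).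
exact: sqsum_ge.
Qed.

Lemma sqsum_le a (B : R) : (forall A, coef_sqsum a A <= B) -> (sqsum a <= B%:E)%E.
Proof. by move=> aB; apply: ge_ereal_sup => _ [A _ <-]; rewrite lee_fin; exact: aB. Qed.

(** Through Parseval, membership in the Fock space and norm bounds are read off finite sums of
    coefficients. *)
Lemma fock_power_series f a (B : R) : power_series_of f a ->
  (forall A, coef_sqsum a A <= B) -> fock f /\ fock_sq f <= B.
Proof.
move=> fa aB; have le : (fock_sqnorm f <= B%:E)%E by rewrite (parseval fa) sqsum_le.
have ff : fock f by split; [exists a|apply: le_lt_trans le _; exact: ltry].
by split => //; rewrite -lee_fin -fock_sqE//.
Qed.

Lemma fock_lin f g c : fock f -> fock g -> fock (fun z => c * f z + g z).
Proof.
move=> ff fg.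
have [|//] := fock_power_series (B := 2 * normc c ^+ 2 * fock_sq f + 2 * fock_sq g)
  (power_seriesD (c := c) (taylor_coefP ff.1) (taylor_coefP fg.1)).
move=> A; apply: (@le_trans _ _ (2 * normc c ^+ 2 * coef_sqsum (taylor_coef f) A +
    2 * coef_sqsum (taylor_coef g) A)); last first.
  by rewrite lerD// ler_wpM2l ?coef_sqsum_le// mulr_ge0 ?sqr_ge0.
rewrite /coef_sqsum !mulr_sumr -big_split/=; apply: ler_sum => m _.
rewrite !mulrA -mulrDl ler_wpM2r ?weight_ge0//.
have := le_normcD (c * taylor_coef f m) (taylor_coef g m); rewrite normcM => le.
apply: (@le_trans _ _ ((normc c * normc (taylor_coef f m) + normc (taylor_coef g m)) ^+ 2)).
  by rewrite lerXn2r ?nnegrE ?addr_ge0 ?mulr_ge0 ?normc_ge0.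
(* This is (u + v)^2 <= 2 u^2 + 2 v^2, the source of the constants 2 above. *)
have key (x y z : R) : (x * y + z) ^+ 2 <= 2 * x * x * y * y + 2 * z * z.
  have E : 2 * x * x * y * y + 2 * z * z = (x * y + z) ^+ 2 + (x * y - z) ^+ 2 by ring.
  by rewrite E lerDl sqr_ge0.
exact: key.
Qed.

Lemma power_series_monomial m :
  power_series_of (@monomial R d m) (fun n => (n == m)%:R).
Proof.
move=> z; apply: cvg_near_cst; exists [fset m]%fset => // A /= mA.
rewrite partial_sumE (big_fsetD1 m)/=; last by rewrite (fsubsetP mA)// inE.
rewrite eqxx mul1r big1_fset ?addr0// => n; rewrite !inE => /andP[/negbTE -> _] _.
by rewrite mul0r.
Qed.

Lemma fock_monomial m : fock (@monomial R d m).
Proof.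
split; first by exists (fun n => (n == m)%:R); exact: power_series_monomial.
by rewrite fock_sqnorm_monomial ltry.
Qed.

Lemma fock_sq_monomial m : fock_sq (@monomial R d m) = weight m.
Proof. by rewrite /fock_sq fock_sqnorm_monomial. Qed.

Lemma fock0 : fock ((fun=> 0) : ('I_d -> C) -> C).
Proof.
have := fock_lin (-1) (fock_monomial mnm0) (fock_monomial mnm0).
by under eq_fun do rewrite mulN1r addNr.
Qed.

Lemma fockZ f c : fock f -> fock (fun z => c * f z).
Proof.
by move=> ff; have := fock_lin (c) ff fock0; under eq_fun do rewrite addr0.
Qed.

Lemma fock_sum (I : eqType) (r : seq I) (F : I -> ('I_d -> C) -> C) (cc : I -> C) :
  (forall i, i \in r -> fock (F i)) -> fock (fun z => \sum_(i <- r) cc i * F i z).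
Proof.
elim: r => [|i r IH] fF.
  under eq_fun do rewrite big_nil.
  exact: fock0.
under eq_fun do rewrite big_cons.
apply: fock_lin; first by apply: fF; rewrite inE eqxx.
by apply: IH => j jr; apply: fF; rewrite inE jr orbT.
Qed.

Lemma taylor_coef_lin f g c m : fock f -> fock g ->
  taylor_coef (fun z => c * f z + g z) m = c * taylor_coef f m + taylor_coef g m.
Proof.
move=> ff fg; rewrite (taylor_coefE (a := fun m => c * taylor_coef f m + taylor_coef g m))//.
by apply: power_seriesD; [exact: taylor_coefP ff.1|exact: taylor_coefP fg.1].
Qed.

(* Cauchy-Schwarz in the weighted l^2 space of Taylor coefficients. *)
Lemma coef_dual_le a (b : multinom d -> R) A :
  \sum_(m <- A) normc (a m) * b m <=
  Num.sqrt (coef_sqsum a A) * Num.sqrt (\sum_(m <- A) b m ^+ 2 / weight m).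
Proof.
have w0 m : Num.sqrt (weight (R := R) m) != 0 by rewrite sqrtr_eq0 -ltNge weight_gt0.
rewrite -sqrtrM ?coef_sqsum_ge0// (le_trans (ler_norm _))// -sqrtr_sqr ler_wsqrtr//.
have -> : \sum_(m <- A) normc (a m) * b m = \sum_(m <- A)
    (normc (a m) * Num.sqrt (weight m)) * (b m / Num.sqrt (weight m)).
  by apply: eq_bigr => m _; field.
apply: le_trans (cauchy_schwarz_sum _ _ _) _.
rewrite /coef_sqsum; under eq_bigr do rewrite exprMn sqr_sqrtr ?weight_ge0//.
under [X in _ * X]eq_bigr do rewrite exprMn exprVn sqr_sqrtr ?weight_ge0//.
by [].
Qed.

(** These are the finite sums of the reproducing kernel at (z, z), that is, of exp |z|^2. *)
Lemma monomial_weight_summable (z : 'I_d -> C) :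
  exists K : R, forall A, \sum_(m <- A) normc (monomial m z) ^+ 2 / weight m <= K.
Proof.
(* One number bounding all the squared moduli, since [weight_summable] takes a single base. *)
pose B : R := \sum_j normc (z j) ^+ 2.
have [|K hK] := @weight_summable R d B.
  by apply: sumr_ge0 => j _; exact: sqr_ge0.
exists K => A; apply: le_trans (hK A); apply: ler_sum => m _.
rewrite ler_wpM2r ?invr_ge0 ?weight_ge0// normc_monomial -prodrXl.
apply: ler_prod => j _; rewrite exprn_ge0 ?exprn_ge0 ?normc_ge0//= exprAC.
rewrite lerXn2r ?nnegrE ?sqr_ge0 ?sumr_ge0// => [i _|]; first exact: sqr_ge0.
by rewrite /B (bigD1 j)//= lerDl sumr_ge0// => i _; exact: sqr_ge0.
Qed.

(** By Cauchy-Schwarz, finiteness of the weighted square sum and of the sum of |z^m|^2 / w_m gives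
    absolute convergence at every z. *)
Lemma fock_of_coefs a (B : R) : (forall A, coef_sqsum a A <= B) ->
  exists f, [/\ fock f, taylor_coef f = a & fock_sq f <= B].
Proof.
move=> aB; pose f z := csum (fun m => a m * monomial m z).
have fa : power_series_of f a.
  move=> z; apply: cvg_csum; have [K hK] := monomial_weight_summable z.
  exists (Num.sqrt B * Num.sqrt K) => A.
  under eq_bigr do rewrite normcM.
  apply: le_trans (coef_dual_le _ _ _) _.
  by rewrite ler_pM ?sqrtr_ge0// ler_wsqrtr.
have [ff fB] := fock_power_series fa aB.
by exists f; split => //; exact: taylor_coefE.
Qed.

(** Cauchy-Schwarz against |z^m|^2 / w_m. It lets limits in the Fock norm be evaluated at [z]. *)
Lemma fock_eval_le (z : 'I_d -> C) : exists K : R, forall f, fock f ->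
  normc (f z) <= K * Num.sqrt (fock_sq f).
Proof.
have [K hK] := monomial_weight_summable z.
exists (Num.sqrt K) => f ff; rewrite -rnorm_complex.
have fa : power_series_of f _ := taylor_coefP ff.1.
apply: (@rnorm_lim_le _ R[i]^o _ totally _ _ _ _ (fa z)).
apply: nearW => A.
rewrite partial_sumE rnorm_complex (le_trans (normc_sum _ _ _))//.
under eq_bigr do rewrite normcM.
apply: le_trans (coef_dual_le _ _ _) _.
by rewrite mulrC ler_pM ?sqrtr_ge0// ler_wsqrtr// coef_sqsum_le.
Qed.

(** The coefficients of [g] are those of [f] outside [A], so its squared norm is a tail of a
    convergent sum; this is the density of polynomials. *)
Lemma fock_truncation f (e : R) : fock f -> 0 < e ->
  exists A0, forall A, (A0 `<=` A)%fset ->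
    let g := fun z => f z - partial_series (taylor_coef f) A z in
    fock g /\ fock_sq g <= e.
Proof.
move=> ff e0.
have b0 m : 0 <= normc (taylor_coef f m) ^+ 2 * weight m.
  by rewrite mulr_ge0 ?sqr_ge0 ?weight_ge0.
have [|A0 hA0] := bounded_sums_tail b0 _ e0.
  by exists (fock_sq f) => A; exact: coef_sqsum_le.
exists A0 => A A0A g; have fa : power_series_of f _ := taylor_coefP ff.1.
pose a m := if m \in A then 0 else taylor_coef f m.
have ga : power_series_of g a.
  move=> z; apply/cvg_rnormP => r r0; have /cvg_rnormP/(_ _ r0) := fa z.
  have nA : \forall B \near totally, (A `<=` B)%fset by exists A.
  apply: filterS2 nA => B AB; rewrite !partial_sumE => lt.
  suff -> : g z - \sum_(m <- B) a m * monomial m z =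
      f z - \sum_(m <- B) taylor_coef f m * monomial m z by [].
  rewrite /g -addrA -opprD; congr (_ - _).
  rewrite [in RHS](sum_fsetDl _ AB) [in LHS](sum_fsetDl _ AB); congr (_ + _).
  rewrite big_seq big1 ?add0r; last by move=> m mA; rewrite /a mA mul0r.
  rewrite big_seq [RHS]big_seq; apply: eq_bigr => m; rewrite inE /a.
  by move=> /andP[/negbTE -> _].
apply: fock_power_series ga _ => B.
rewrite /coef_sqsum (big_fsetID _ (mem A))/= big_seq big1 ?add0r.
  apply/ltW; apply: le_lt_trans (hA0 [fset x in B | x \notin A]%fset _).
    rewrite big_seq [leRHS]big_seq; apply: ler_sum => m; rewrite !inE /a.
    by move=> /andP[_ /negbTE ->].
  apply/fdisjointP => m mA0; rewrite !inE negb_and negbK.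
  by rewrite (fsubsetP A0A)// orbT.
by move=> m; rewrite !inE /a => /andP[_ ->]; rewrite normc0 expr0n/= mul0r.
Qed.

End fock_coefficients.

(** * The inner product of the Fock space *)

Section fock_inner_product.
Context {R : realType} {d : nat}.
Local Notation C := R[i].
Local Notation Rm := (measurableTypeR R).
Local Notation T := (d.-tuple (Rm * Rm)).
Local Notation cpoint := Defs.cpoint.
Local Notation nu := (@lebesgue_C R d).
Implicit Types (m : multinom d) (f g h : ('I_d -> C) -> C) (u v : T -> C) (c : C).

Definition gint u : C :=
  (\int[nu]_t (complex.Re (u t) * gweight t)) +i*
  (\int[nu]_t (complex.Im (u t) * gweight t)).

Definition gintegrable u :=
  nu.-integrable setT (fun t => (complex.Re (u t) * gweight t)%:E) /\
  nu.-integrable setT (fun t => (complex.Im (u t) * gweight t)%:E).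

Lemma gintegrableZ c u : gintegrable u -> gintegrable (fun t => c * u t).
Proof.
move=> [ru iu]; split.
- rewrite (_ : (fun _ => _) = fun t =>
      ((complex.Re c)%:E * (complex.Re (u t) * gweight t)%:E -
       (complex.Im c)%:E * (complex.Im (u t) * gweight t)%:E)%E).
    by apply: integrableB => //; exact: integrableZl.
  by apply/funext => t; rewrite complex_ReM -!EFinM -EFinB; congr (_%:E); ring.
- rewrite (_ : (fun _ => _) = fun t =>
      ((complex.Re c)%:E * (complex.Im (u t) * gweight t)%:E +
       (complex.Im c)%:E * (complex.Re (u t) * gweight t)%:E)%E).
    by apply: integrableD => //; exact: integrableZl.
  by apply/funext => t; rewrite complex_ImM -!EFinM -EFinD; congr (_%:E); ring.
Qed.

Lemma RintegralDT (F G : T -> R) : nu.-integrable setT (EFin \o F) ->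
  nu.-integrable setT (EFin \o G) ->
  \int[nu]_t (F t + G t) = \int[nu]_t F t + \int[nu]_t G t.
Proof. by move=> iF iG; exact: RintegralD. Qed.

Lemma gintD u v : gintegrable u -> gintegrable v ->
  gint (fun t => u t + v t) = gint u + gint v.
Proof.
move=> [ru iu] [rv iv]; rewrite /gint.
apply/eqP; rewrite eq_complex/=; apply/andP; split; apply/eqP.
- rewrite -RintegralDT//; apply: eq_Rintegral => t _.
  by rewrite raddfD/= mulrDl.
- rewrite -RintegralDT//; apply: eq_Rintegral => t _.
  by rewrite raddfD/= mulrDl.
Qed.

Lemma integrableZR (x : R) (F : T -> R) :
  nu.-integrable setT (fun t => (F t)%:E) ->
  nu.-integrable setT (fun t => (x * F t)%:E).
Proof.
move=> iF; rewrite (_ : (fun _ => _) = fun t => (x%:E * (F t)%:E)%E).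
  exact: integrableZl.
by apply/funext => t; rewrite EFinM.
Qed.

Lemma RintegralZT (x : R) (F : T -> R) :
  nu.-integrable setT (fun t => (F t)%:E) ->
  \int[nu]_t (x * F t) = x * \int[nu]_t F t.
Proof. by move=> iF; exact: RintegralZl. Qed.

Lemma gintZ c u : gintegrable u -> gint (fun t => c * u t) = c * gint u.
Proof.
move=> [ru iu]; apply/eqP; rewrite eq_complex/= complex_ReM complex_ImM /=.
apply/andP; split; apply/eqP.
- rewrite -(RintegralZT _ ru) -mulNr -(RintegralZT _ iu).
  rewrite -(RintegralDT (integrableZR _ ru) (integrableZR _ iu)).
  by apply: eq_Rintegral => t _; rewrite complex_ReM; ring.
- rewrite -(RintegralZT _ ru) -(RintegralZT _ iu).
  rewrite -(RintegralDT (integrableZR _ iu) (integrableZR _ ru)).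
  by apply: eq_Rintegral => t _; rewrite complex_ImM; ring.
Qed.

Lemma gint_conj u : gintegrable u -> gint (fun t => (u t)^*) = (gint u)^*.
Proof.
move=> [ru iu]; apply/eqP; rewrite eq_complex/=; apply/andP; split; apply/eqP.
- by apply: eq_Rintegral => t _; case: (u t).
- rewrite -mulN1r -RintegralZl//.
  by apply: eq_Rintegral => t _; case: (u t) => a b /=; rewrite mulN1r mulNr.
Qed.

Lemma fock_ipE f g : fock_ip f g = gint (fun t => f (cpoint t) * (g (cpoint t))^*).
Proof. by []. Qed.

(** Real and imaginary parts of the product are at most |f|^2 + |g|^2 in absolute value, which is
    integrable against the weight. *)
Lemma fock_gintegrable f g : fock f -> fock g ->
  gintegrable (fun t => f (cpoint t) * (g (cpoint t))^*).
Proof.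
move=> ff fg.
have mf := cmeasurable_entire ff.1; have mg := cmeasurable_entire fg.1.
have mfg := cmeasurableM mf (cmeasurable_conj mg).
have isq h : fock h -> nu.-integrable setT
    (fun t => (normc (h (cpoint t)) ^+ 2 * gweight t)%:E).
  move=> fh; apply/integrableP; split.
    by apply: measurable_sqnorm_gweight; exact: cmeasurable_entire fh.1.
  apply: le_lt_trans fh.2; rewrite le_eqVlt; apply/orP; left; apply/eqP.
  apply: eq_integral => t _; rewrite gee0_abs// lee_fin mulr_ge0 ?sqr_ge0//.
  exact: gweight_ge0.
have ig : nu.-integrable setT (fun t =>
    ((normc (f (cpoint t)) ^+ 2 * gweight t)%:E + (normc (g (cpoint t)) ^+ 2 * gweight t)%:E)%E).
  by apply: integrableD => //; exact: isq.
have bnd (x : R) t : `|x| <= normc (f (cpoint t) * (g (cpoint t))^*) ->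
   (`| (x * gweight t)%:E | <= `| (normc (f (cpoint t)) ^+ 2 * gweight t)%:E +
      (normc (g (cpoint t)) ^+ 2 * gweight t)%:E |)%E.
  rewrite normcM normc_conj => le.
  rewrite -EFinD /= lee_fin -mulrDl !normrM ler_wpM2r// (le_trans le)//.
  rewrite ger0_norm ?addr_ge0 ?sqr_ge0//.
  move: (normc_ge0 (f (cpoint t))) (normc_ge0 (g (cpoint t))).
  move: (normc _) (normc _) => a b a0 b0.
  have := sqr_ge0 (a - b); nra.
split.
- apply: (@le_integrable _ _ _ nu _ _ _ _ _ _ ig) => //.
    apply/measurable_EFinP; apply: measurable_funM; first exact: mfg.1.
    exact: measurable_gweight.
  by move=> t _; apply: bnd; exact: Re_le_normc.
- apply: (@le_integrable _ _ _ nu _ _ _ _ _ _ ig) => //.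
    apply/measurable_EFinP; apply: measurable_funM; first exact: mfg.2.
    exact: measurable_gweight.
  by move=> t _; apply: bnd; exact: Im_le_normc.
Qed.

Lemma fock_ip_linl c f g h : fock f -> fock g -> fock h ->
  fock_ip (fun z => c * f z + g z) h = c * fock_ip f h + fock_ip g h.
Proof.
move=> ff fg fh; have ifh := fock_gintegrable ff fh.
rewrite !fock_ipE -(gintZ _ ifh).
rewrite -(gintD (gintegrableZ _ ifh) (fock_gintegrable fg fh)).
by congr gint; apply/funext => t; rewrite mulrDl mulrA.
Qed.

Lemma fock_ipC f g : fock f -> fock g -> fock_ip g f = (fock_ip f g)^*.
Proof.
move=> ff fg; rewrite !fock_ipE -gint_conj; last exact: fock_gintegrable.
by congr gint; apply/funext => t; rewrite rmorphM/= conjcK mulrC.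
Qed.

Lemma fock_ip_linr c f g h : fock f -> fock g -> fock h ->
  fock_ip h (fun z => c * f z + g z) = conjc c * fock_ip h f + fock_ip h g.
Proof.
move=> ff fg fh; rewrite fock_ipC//; last exact: fock_lin.
by rewrite fock_ip_linl// (fock_ipC ff fh) (fock_ipC fg fh) rmorphD rmorphM.
Qed.

Lemma fock_ip0l h : fock h -> fock_ip (fun=> 0) h = 0.
Proof.
move=> fh; have := fock_ip_linl 1 (@fock0 R d) (@fock0 R d) fh.
rewrite (_ : (fun _ => 1 * 0 + 0) = fun=> 0); last first.
  by apply/funext => z; rewrite mulr0 addr0.
by rewrite mul1r => /eqP; rewrite -subr_eq subrr eq_sym => /eqP.
Qed.

Lemma fock_ipZl c f h : fock f -> fock h ->
  fock_ip (fun z => c * f z) h = c * fock_ip f h.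
Proof.
move=> ff fh; have := fock_ip_linl (c) ff (@fock0 R d) fh.
under eq_fun do rewrite addr0.
by rewrite fock_ip0l// addr0.
Qed.

Lemma fock_ipZr c f h : fock f -> fock h ->
  fock_ip h (fun z => c * f z) = conjc c * fock_ip h f.
Proof.
move=> ff fh; rewrite fock_ipC//; last exact: fockZ.
by rewrite fock_ipZl// (fock_ipC ff fh) rmorphM.
Qed.

Lemma fock_ip_suml (I : eqType) (r : seq I) (F : I -> ('I_d -> C) -> C) (a : I -> C) h :
  (forall i, i \in r -> fock (F i)) -> fock h ->
  fock_ip (fun z => \sum_(i <- r) a i * F i z) h = \sum_(i <- r) a i * fock_ip (F i) h.
Proof.
move=> + fh; elim: r => [|i r IH] fF.
  under eq_fun do rewrite big_nil.
  by rewrite fock_ip0l// big_nil.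
have fr j : j \in r -> fock (F j) by move=> jr; apply: fF; rewrite inE jr orbT.
rewrite big_cons -(IH fr) -fock_ip_linl//.
- by congr fock_ip; apply/funext => z; rewrite big_cons.
- by apply: fF; rewrite inE eqxx.
- exact: fock_sum.
Qed.

Lemma fock_ip_sq f : fock f -> fock_ip f f = (fock_sq f)%:C.
Proof.
move=> ff; rewrite fock_ipE; apply/eqP; rewrite eq_complex/=.
apply/andP; split; apply/eqP.
- by congr fine; apply: eq_integral => t _; rewrite mulC_conj.
- rewrite /Rintegral (_ : (fun _ => _) = cst 0%E) ?integral0//.
  by apply/funext => t; rewrite mulC_conj/= mul0r.
Qed.

Lemma fock_sqD f g c : fock f -> fock g ->
  fock_sq (fun z => c * f z + g z) =
  normc c ^+ 2 * fock_sq f + 2 * complex.Re (c * fock_ip f g) + fock_sq g.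
Proof.
move=> ff fg; have fl := fock_lin (c) ff fg.
apply: complexI; rewrite -fock_ip_sq// fock_ip_linl// !fock_ip_linr//.
rewrite !fock_ip_sq// (fock_ipC ff fg); move: (fock_ip f g) => p.
rewrite sqr_normcE; case: c p {fl} => x y [u v].
by apply/eqP; rewrite eq_complex/=; apply/andP; split; apply/eqP; ring.
Qed.

(** Moving [g] by s conj(p) [f], with [s] real, makes the cross term 2 s |p|^2. The discriminant
    gives P^2 <= |g|^2 P |f|^2, and [P] is divided out. *)
Lemma fock_cauchy_schwarz f g : fock f -> fock g ->
  normc (fock_ip f g) ^+ 2 <= fock_sq f * fock_sq g.
Proof.
move=> ff fg; set p := fock_ip f g; set P := normc p ^+ 2.
have P0 : 0 <= P by exact: sqr_ge0.
have h : P ^+ 2 <= fock_sq g * (P * fock_sq f).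
  apply: discriminant_le0; first by rewrite mulr_ge0 ?fock_sq_ge0.
  move=> s; have := fock_sq_ge0 (fun z => (s%:C * p^*) * f z + g z).
  rewrite fock_sqD// -/p -mulrA (mulrC p^*) mulC_conj -/P normcM normc_conj normc_real.
  rewrite exprMn real_normK ?num_real// -/P -rmorphM/= => h.
  by apply: le_trans h _; rewrite le_eqVlt; apply/orP; left; apply/eqP; ring.
have [P1|P1] := eqVneq P 0; first by rewrite P1 mulr_ge0 ?fock_sq_ge0.
have Pgt : 0 < P by rewrite lt0r P1.
by rewrite -(ler_pM2l Pgt) -expr2 (le_trans h)// mulrCA [fock_sq f * _]mulrC.
Qed.

Lemma fock_ip_le f g : fock f -> fock g ->
  normc (fock_ip f g) <= Num.sqrt (fock_sq f) * Num.sqrt (fock_sq g).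
Proof.
move=> ff fg; rewrite -sqrtrM ?fock_sq_ge0//.
by rewrite -[leLHS](ger0_norm (normc_ge0 _)) -sqrtr_sqr ler_wsqrtr// fock_cauchy_schwarz.
Qed.

(** Parseval bounds |c z^m + z^n|^2 by |c|^2 w_m + w_n, so the real part of c <z^m, z^n> is never
    positive; take for [c] the conjugate of that inner product. *)
Lemma fock_ip_monomial_orthogonal m n : m != n ->
  fock_ip (@monomial R d m) (monomial n) = 0.
Proof.
move=> mn; set p := fock_ip _ _.
have fm := @fock_monomial R d.
have le c : normc c ^+ 2 * weight m + 2 * complex.Re (c * p) + weight n <=
    normc c ^+ 2 * weight m + weight n.
  rewrite -!fock_sq_monomial -fock_sqD//.
  have pm k : power_series_of (@monomial R d k) (fun n => (n == k)%:R).
    exact: power_series_monomial.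
  have pa : power_series_of (fun z => c * monomial m z + monomial n z)
      (fun k => c * (k == m)%:R + (k == n)%:R) by exact: power_seriesD.
  apply: (fock_power_series pa _).2 => A.
  apply: (@le_trans _ _ (\sum_(k <- A) (if k == m then normc c ^+ 2 * weight k else 0) +
     \sum_(k <- A) (if k == n then weight k else 0))).
    rewrite -big_split/=; apply: ler_sum => k _.
    have [->|km] := eqVneq k m.
      by rewrite (negbTE mn) mulr1 !addr0.
    case: eqP => _; rewrite mulr0 !add0r ?normc1 ?expr1n ?mul1r//.
    by rewrite normc0 expr0n/= mul0r.
  have one k (F : multinom d -> R) : (forall i, 0 <= F i) ->
      \sum_(i <- A) (if i == k then F i else 0) <= F k.
    move=> F0; have [kA|kA] := boolP (k \in A).
      rewrite (big_fsetD1 k)//= eqxx big1_fset ?addr0// => i.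
      by rewrite !inE => /andP[/negbTE ->].
    rewrite big_seq big1 ?F0// => i iA; case: eqP => // ik.
    by rewrite -ik iA in kA.
  rewrite !fock_sq_monomial lerD// one// => i; last exact: weight_ge0.
  by rewrite mulr_ge0 ?sqr_ge0 ?weight_ge0.
move: p le => p le; have := le p^*; rewrite (mulrC p^*) mulC_conj /= => {}le.
apply/eqP; rewrite -normc_eq0 -sqrf_eq0 eq_le sqr_ge0 andbT.
lra.
Qed.

(** Once a truncation of [f] contains [n], orthogonality makes its inner product with z^n exact; the
    remainder contributes little, by Cauchy-Schwarz. *)
Lemma fock_ip_monomial f n : fock f ->
  fock_ip f (monomial n) = taylor_coef f n * (weight n)%:C.
Proof.
move=> ff; have fm := @fock_monomial R d.
apply/eqP; rewrite -subr_eq0 -normc_eq0 -sqrf_eq0 eq_le sqr_ge0 andbT.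
apply/ler_addgt0Pr => e e0; rewrite add0r.
(* Cauchy-Schwarz will multiply the squared error by [weight n]. *)
have e1 : 0 < e / weight (R := R) n by rewrite divr_gt0 ?weight_gt0.
have [A0 /(_ (n |` A0)%fset (fsubsetU1 _ _))] := fock_truncation ff e1.
set g := fun z => _ => -[fg ge].
suff -> : fock_ip f (monomial n) - taylor_coef f n * (weight n)%:C = fock_ip g (monomial n).
  apply: le_trans (fock_cauchy_schwarz fg (fm n)) _.
  by rewrite fock_sq_monomial -ler_pdivlMr ?weight_gt0.
have fp := @fock_sum R d _ (n |` A0)%fset _ (taylor_coef f) (fun i _ => fm i).
rewrite [g](_ : _ = fun z =>
    -1 * partial_series (taylor_coef f) (n |` A0)%fset z + f z); last first.
  by apply/funext => z; rewrite /g mulN1r addrC.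
rewrite fock_ip_linl// fock_ip_suml// mulN1r addrC; congr (- _ + _).
rewrite (big_fsetD1 n)/=; last by rewrite !inE eqxx.
rewrite fock_ip_sq// fock_sq_monomial big1_fset ?addr0// => m.
by rewrite !inE => /andP[mn _] _; rewrite fock_ip_monomial_orthogonal// mulr0.
Qed.

End fock_inner_product.

(** * Functional calculus on the Hilbert space *)

Section hilbert_space.
Context {R : realType} {H : completeNormedModType R[i]}.
Variable ip : {dot H for @conjc R}.
Hypothesis ip_norm : forall x : H, `|x| ^+ 2 = ip x x.
Local Notation C := R[i].
Implicit Types (x y : H) (c : C).

Lemma ipDl x y z : ip (x + y) z = ip x z + ip y z.
Proof. exact: linearDl. Qed.

Lemma ipZl c x y : ip (c *: x) y = c * ip x y.
Proof. exact: linearZl_LR. Qed.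

Lemma ipC x y : ip x y = conjc (ip y x).
Proof. by rewrite hermC expr0 mul1r. Qed.

Lemma ipDr x y z : ip z (x + y) = ip z x + ip z y.
Proof. by rewrite ipC ipDl rmorphD (ipC z x) (ipC z y). Qed.

Lemma ipZr c x y : ip x (c *: y) = conjc c * ip x y.
Proof. by rewrite ipC ipZl rmorphM (ipC x y). Qed.

Lemma ip0l y : ip 0 y = 0.
Proof. by rewrite -(scale0r 0) ipZl mul0r. Qed.

Lemma ipNl x y : ip (- x) y = - ip x y.
Proof. by rewrite -scaleN1r ipZl mulN1r. Qed.

Lemma ipBl x y z : ip (x - y) z = ip x z - ip y z.
Proof. by rewrite ipDl ipNl. Qed.

Lemma ip_suml (I : Type) (r : seq I) (F : I -> H) y :
  ip (\sum_(i <- r) F i) y = \sum_(i <- r) ip (F i) y.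
Proof. by apply: (big_morph (fun x => ip x y)) => [x x'|]; rewrite ?ipDl ?ip0l. Qed.

Lemma ip_sq x : ip x x = (rnorm x ^+ 2)%:C.
Proof. by rewrite -ip_norm -rnormE rmorphXn. Qed.

Lemma rnormD_sq c x y : rnorm (c *: x + y) ^+ 2 =
  normc c ^+ 2 * rnorm x ^+ 2 + 2 * complex.Re (c * ip x y) + rnorm y ^+ 2.
Proof.
apply: complexI; rewrite -ip_sq ipDl ipZl !ipDr !ipZr !ip_sq (ipC y x).
move: (ip x y) => p; rewrite sqr_normcE; case: c p => u v [s t].
by apply/eqP; rewrite eq_complex/=; apply/andP; split; apply/eqP; ring.
Qed.

Lemma ip_le x y : normc (ip x y) <= rnorm x * rnorm y.
Proof.
set p := ip x y; set P := normc p ^+ 2.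
have P0 : 0 <= P by exact: sqr_ge0.
have h : P ^+ 2 <= rnorm y ^+ 2 * (P * rnorm x ^+ 2).
  apply: discriminant_le0; first by rewrite mulr_ge0 ?sqr_ge0.
  move=> s; have := sqr_ge0 (rnorm ((s%:C * p^*) *: x + y)).
  rewrite rnormD_sq -/p -mulrA (mulrC p^*) mulC_conj -/P normcM normc_conj normc_real.
  rewrite exprMn real_normK ?num_real// -/P -rmorphM/= => h.
  by apply: le_trans h _; rewrite le_eqVlt; apply/orP; left; apply/eqP; ring.
rewrite -(@ler_pXn2r _ 2)// ?nnegrE ?normc_ge0 ?mulr_ge0 ?rnorm_ge0// -/P.
have [P1|P1] := eqVneq P 0; first by rewrite P1 sqr_ge0.
have Pgt : 0 < P by rewrite lt0r P1.
by rewrite -(ler_pM2l Pgt) -expr2 (le_trans h)// mulrCA exprMn [rnorm x ^+ 2 * _]mulrC.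
Qed.

Lemma cvg_ipl {T} {F : set_system T} {FF : Filter F} (u : T -> H) x y :
  u @ F --> x -> (ip (u t) y : R[i]^o) @[t --> F] --> (ip x y : R[i]^o).
Proof.
move=> /cvg_rnormP ux; apply/cvg_rnormP => e e0.
have y1 : 0 < rnorm y + 1 by rewrite ltr_wpDl ?rnorm_ge0.
have := ux (e / (rnorm y + 1)); rewrite divr_gt0// => /(_ isT).
apply: filterS => t lt; rewrite rnorm_complex -ipBl (le_lt_trans (ip_le _ _))//.
apply: (@le_lt_trans _ _ (rnorm (x - u t) * (rnorm y + 1))).
  by rewrite ler_wpM2l ?rnorm_ge0// lerDl.
by rewrite -ltr_pdivlMr.
Qed.

Lemma cvg_ipr {T} {F : set_system T} {FF : Filter F} (u : T -> H) x y :
  u @ F --> x -> (ip y (u t) : R[i]^o) @[t --> F] --> (ip y x : R[i]^o).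
Proof.
move=> /(@cvg_ipl _ _ _ _ _ y)/cvg_rnormP ux; apply/cvg_rnormP => e /ux.
apply: filterS => t; rewrite !rnorm_complex (ipC y x) (ipC y (u t)).
by rewrite -rmorphB normc_conj.
Qed.

(** Otherwise some [x] in [S] is closer to [y] than 0 is, and |y|^2 = <y - x, y> <= |y - x| |y| <
    |y|^2. *)
Lemma dense_ip_eq0 (S : set H) y : dense S -> (forall x, S x -> ip x y = 0) ->
  y = 0.
Proof.
move=> dS S0; apply/eqP/negPn/negP => y0.
have ry : 0 < rnorm y.
  rewrite lt0r rnorm_ge0 andbT; apply: contra y0 => /eqP /rnorm0_eq0 ->.
  by [].
have [||x [/= bx Sx]] := dS (ball y (rnorm y)%:C).
- by exists y; apply: ballxx; rewrite ltcR.
- by apply: ball_open; rewrite ltcR.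
move: bx; rewrite -ball_normE/= -rnormE ltcR => lt.
have := ip_le (y - x) y; rewrite ipBl (S0 _ Sx) subr0 ip_sq normc_real.
rewrite ger0_norm ?sqr_ge0// expr2 ler_pM2r// => /(lt_le_trans lt).
by rewrite ltxx.
Qed.

Lemma ip_inj y y' : (forall x, ip x y = ip x y') -> y = y'.
Proof.
move=> yy'; apply/eqP; rewrite -subr_eq0; apply/eqP/rnorm0_eq0/eqP.
rewrite -sqrf_eq0 -(inj_eq (@complexI R)) -ip_sq ipBl.
by rewrite [ip y _]ipC [ip y' _]ipC yy' subrr.
Qed.

Lemma cauchy_rnorm (u : nat -> H) :
  (forall e : R, 0 < e -> exists N, forall n, (N <= n)%N -> rnorm (u N - u n) < e) ->
  exists l : H, u @ \oo --> l.
Proof.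
move=> cu; suff h : cvgn u by exists (limn u).
apply/cauchy_cvgP/cauchy_exP => e /gt0_complexE[-> e0].
have [N hN] := cu _ e0; exists (u N); exists N => // n /= Nn.
by rewrite -ball_normE/= -rnormE ltcR hN.
Qed.

(* The minimizing sequences of |x|^2 - 2 Re (phi x) are Cauchy, and their limit
   represents phi. *)
Lemma riesz (phi : H -> C) (M : R) :
  (forall c x y, phi (c *: x + y) = c * phi x + phi y) ->
  (forall x, normc (phi x) <= M * rnorm x) ->
  exists u, forall x, phi x = ip x u.
Proof.
move=> phil phiM.
pose q x := rnorm x ^+ 2 - 2 * complex.Re (phi x).
pose Q := range q.
have Qinf : has_inf Q.
  split; first by exists (q 0), 0.
  (* The value is at least t^2 - 2 M t with t = [rnorm x], hence at least - M^2. *)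
  exists (- M ^+ 2) => _ [x _ <-]; rewrite /q.
  have := le_trans (ler_norm _) (le_trans (Re_le_normc (phi x)) (phiM x)).
  have := sqr_ge0 (rnorm x - M); nra.
pose m := inf Q.
have mq x : m <= q x by apply: ge_inf; [exact: Qinf.2|exists x].
have qD c x y : q (c *: x + y) = q y + normc c ^+ 2 * rnorm x ^+ 2 +
    2 * complex.Re (c * (ip x y - phi x)).
  by rewrite /q rnormD_sq phil raddfD/= mulrBr raddfB/=; ring.
have near_min (e : R) : 0 < e -> exists x, q x < m + e.
  by move=> e0; have [_ [x _ <-] lt] := inf_adherent e0 Qinf; exists x.
have par x y e : q x < m + e -> q y < m + e -> rnorm (x - y) ^+ 2 <= 4 * e.
  move=> qx qy; pose z := x - y.
  (* The infimum is compared with the value at the midpoint of [x] and [y], as in the parallelogram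
     law. *)
  have h1 := mq (2^-1%:C *: z + y).
  have xe : x = 1 *: z + y by rewrite scale1r subrK.
  rewrite qD in h1; rewrite xe qD normc1 expr1n !mul1r in qx.
  move: h1; rewrite normc_real ger0_norm// -/z.
  have -> : complex.Re (2^-1%:C * (ip z y - phi z)) = 2^-1 * complex.Re (ip z y - phi z).
    by rewrite complex_ReM/= mul0r subr0.
  lra.
have e0 n : 0 < n.+1%:R^-1 :> R by rewrite invr_gt0.
pose x n := projT1 (cid (near_min _ (e0 n))).
have qx n : q (x n) < m + n.+1%:R^-1 by exact: (projT2 (cid (near_min _ (e0 n)))).
have inv_small (e : R) : 0 < e -> exists N, forall n, (N <= n)%N -> n.+1%:R^-1 < e :> R.
  move=> ee; have /cvgrPdist_lt/(_ _ ee)[N _ hN] := @cvg_harmonic R.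
  by exists N => n /hN/=; rewrite sub0r normrN ger0_norm.
have [u xu] : exists u : H, x @ \oo --> u.
  apply: cauchy_rnorm => e ee.
  (* The bound [4 * _] of [par] then stays strictly below e^2. *)
  have [|N hN] := inv_small (e ^+ 2 / 5); first by rewrite divr_gt0 ?exprn_gt0.
  exists N => n Nn; rewrite -(@ltr_pXn2r _ 2)// ?nnegrE ?rnorm_ge0 ?ltW//.
  have le : n.+1%:R^-1 <= N.+1%:R^-1 :> R by rewrite lef_pV2 ?posrE// ler_nat ltnS.
  have := par _ _ N.+1%:R^-1 (qx N) (lt_le_trans (qx n) _).
  rewrite lerD2l => /(_ le) h; apply: le_lt_trans h _.
  move: (hN N (leqnn N)) (exprn_gt0 2 ee); move: (e ^+ 2) (N.+1%:R^-1) => a b; lra.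
exists u => y.
(* Moving [x n] along [y] lowers [q] by less than 1/(n+1), so the derivative of [q] at [x n] is
   small. *)
have bound n : normc (ip y (x n) - phi y) ^+ 2 <= n.+1%:R^-1 * rnorm y ^+ 2.
  set p := _ - _; set P := normc p ^+ 2.
  have P0 : 0 <= P by exact: sqr_ge0.
  have h : P ^+ 2 <= n.+1%:R^-1 * (P * rnorm y ^+ 2).
    apply: discriminant_le0; first by rewrite mulr_ge0 ?sqr_ge0.
    move=> s.
    have := mq ((s%:C * p^*) *: y + x n).
    rewrite qD -/p -mulrA (mulrC p^*) mulC_conj -/P normcM normc_conj normc_real.
    rewrite exprMn real_normK ?num_real// -/P -rmorphM/= => h1.
    move: h1 (qx n); move: (n.+1%:R^-1) => a; lra.
  have [P1|P1] := eqVneq P 0; first by rewrite P1 mulr_ge0 ?sqr_ge0 ?ltW.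
  have Pgt : 0 < P by rewrite lt0r P1.
  by rewrite -(ler_pM2l Pgt) -expr2 (le_trans h)// mulrCA.
apply/esym.
apply: (@cvg_unique _ (@norm_hausdorff _ R[i]^o) ((fun n => ip y (x n) : R[i]^o) @ \oo)).
  exact: cvg_ipr.
apply/cvg_rnormP => e ee.
have y1 : 0 < rnorm y ^+ 2 + 1 by rewrite ltr_wpDl ?sqr_ge0.
have [|N hN] := inv_small (e ^+ 2 / (rnorm y ^+ 2 + 1)).
  by rewrite divr_gt0 ?exprn_gt0.
exists N => // n /= /hN; rewrite ltr_pdivlMr// => lt.
rewrite rnorm_complex -normcN opprB -(@ltr_pXn2r _ 2)// ?nnegrE ?normc_ge0 ?ltW//.
apply: le_lt_trans (bound n) _; apply: le_lt_trans lt.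
by apply: ler_wpM2l; [exact/ltW/e0|rewrite lerDl].
Qed.

End hilbert_space.

Lemma partial_sum_lin (I : choiceType) (K : pzRingType) (V : lmodType K) (c : K)
    (x y z : I -> V) (A : {fset I}) : (forall i, z i = c *: x i + y i) ->
  partial_sum z A = c *: partial_sum x A + partial_sum y A.
Proof.
move=> zE; rewrite !partial_sumE scaler_sumr -big_split/=.
by apply: eq_bigr => i _.
Qed.

(** * Monomials and entire functions of the tuple *)

Section operator_tuple.
Context {R : realType} {H : completeNormedModType R[i]} {d : nat}.
Variable ip : {dot H for @conjc R}.
Hypothesis ip_norm : forall x : H, `|x| ^+ 2 = ip x x.
Local Notation C := R[i].
Variable T : 'I_d -> {linear H -> H}.
Hypothesis bT : forall j, bounded_operator (T j).
Hypothesis cT : forall j k x, T j (T k x) = T k (T j x).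
Implicit Types (m n : multinom d) (x y : H) (c : C) (f g : ('I_d -> C) -> C).

(** [bounded_operator] provides complex constants; the sum of their moduli is a real bound common to
    all [j]. *)
Lemma tuple_bound : exists2 M : R, 0 <= M &
  forall j x, rnorm (T j x) <= M * rnorm x.
Proof.
pose M j := projT1 (cid (bT j)).
have hM j x : `|T j x| <= M j * `|x| by exact: (projT2 (cid (bT j))).
exists (\sum_j normc (M j)); first by apply: sumr_ge0 => j _; exact: normc_ge0.
move=> j x; have := hM j x; rewrite -!rnormE lecE => /andP[_].
rewrite complex_ReM/= mulr0 subr0 => /le_trans; apply.
rewrite ler_wpM2r ?rnorm_ge0// (le_trans (ler_norm _))// (le_trans (Re_le_normc _))//.
by rewrite (bigD1 j)//= lerDl sumr_ge0// => i _; exact: normc_ge0.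
Qed.

Lemma op_monomial_le m x (M : R) : 0 <= M ->
  (forall j x, rnorm (T j x) <= M * rnorm x) ->
  rnorm (op_monomial T m x) <= (\prod_j M ^+ m j) * rnorm x.
Proof.
move=> M0 hM; rewrite /op_monomial; elim: (index_enum _) => [|j r IH].
  by rewrite !big_nil mul1r.
rewrite !big_cons/= -mulrA; elim: (m j) => [|k IHk]; first by rewrite expr0 mul1r.
by rewrite iterS exprS -mulrA (le_trans (hM _ _))// ler_wpM2l.
Qed.

Lemma op_monomial_lin m c x y :
  op_monomial T m (c *: x + y) = c *: op_monomial T m x + op_monomial T m y.
Proof.
rewrite /op_monomial; elim: (index_enum _) => [|j r IH]; first by rewrite !big_nil.
rewrite !big_cons/= IH; elim: (m j) => [|k IHk] //.
by rewrite !iterS IHk linearP.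
Qed.

(** For [v] nonzero the hypothesis says, without adjoints, that [v] is a joint eigenvector of the
    adjoints with eigenvalues the conjugates of [z j]; this form is used until the theorem
    itself. *)
Lemma op_monomial_ip (z : 'I_d -> C) (v : H) m x :
  (forall j x, ip (T j x) v = z j * ip x v) ->
  ip (op_monomial T m x) v = monomial m z * ip x v.
Proof.
move=> hz; rewrite /op_monomial /monomial; elim: (index_enum _) => [|j r IH].
  by rewrite !big_nil mul1r.
rewrite !big_cons/= -mulrA -IH; elim: (m j) => [|k IHk]; first by rewrite expr0 mul1r.
by rewrite iterS hz IHk exprS mulrA.
Qed.

Lemma op_monomialT m k x : op_monomial T m (T k x) = T k (op_monomial T m x).
Proof.
rewrite /op_monomial; elim: (index_enum _) => [|j r IH]; first by rewrite !big_nil.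
rewrite !big_cons/= IH; elim: (m j) => [|l IHl] //.
by rewrite !iterS IHl cT.
Qed.

(** [T k] has to commute past the factors of other indices to reach its own power. The induction
    runs over the enumeration of the indices, which are distinct, so that [k] is met once. *)
Lemma op_monomialS m k x :
  T k (op_monomial T m x) = op_monomial T (mnm_add m (mnm1 k)) x.
Proof.
pose op (r : seq 'I_d) n := \big[(fun A B : H -> H => A \o B)/idfun]_(j <- r) iter (n j) (T j).
have opE n : op_monomial T n = op (index_enum _) n by [].
(* Past the position of [k], the two multi-indices have the same exponents. *)
have notin r : k \notin r -> op r (mnm_add m (mnm1 k)) =1 op r m.
  elim: r => [|j r IH]; first by rewrite /op !big_nil.
  rewrite inE negb_or => /andP[kj kr] y; rewrite /op !big_cons/= -/(op _ _) -/(op _ _) IH//.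
  by rewrite mnmDE mnm1E (negbTE kj) addn0.
have it l j y : T k (iter l (T j) y) = iter l (T j) (T k y).
  by elim: l => //= l IHl; rewrite cT IHl.
rewrite !opE; have := index_enum_uniq 'I_d; have := mem_index_enum k.
elim: (index_enum _) => // j r IH; rewrite inE => kjr /= /andP[jr ur].
rewrite /op !big_cons/= -/(op _ _) -/(op _ _) mnmDE mnm1E.
have [kj|kj] := eqVneq k j.
  by rewrite -kj in jr *; rewrite notin// addn1 iterS.
by move: kjr; rewrite (negbTE kj)/= addn0 => kr; rewrite it IH.
Qed.

Lemma op_monomial0 x : op_monomial T mnm0 x = x.
Proof.
rewrite /op_monomial; elim: (index_enum _) => [|j r IH]; first by rewrite big_nil.
by rewrite big_cons/= mnm0E.
Qed.

(** With |T^m x| <= M^|m| |x|, Cauchy-Schwarz separates the weighted norm of the coefficients from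
    the sum of M^(2|m|) / w_m, so that [K] serves all [f] and [x]. *)
Lemma op_entire_cvg : exists2 K : R, 0 <= K & forall f x, fock f ->
  partial_sum (fun m => taylor_coef f m *: op_monomial T m x) @ totally -->
    op_entire T f x /\
  rnorm (op_entire T f x) <= K * Num.sqrt (fock_sq f) * rnorm x.
Proof.
have [M M0 hM] := tuple_bound.
have [K hK] := @weight_summable R d (M ^+ 2) (sqr_ge0 M).
exists (Num.sqrt K); first exact: sqrtr_ge0.
move=> f x ff.
have bnd (A : {fset multinom d}) : \sum_(m <- A) rnorm (taylor_coef f m *: op_monomial T m x) <=
    Num.sqrt K * Num.sqrt (fock_sq f) * rnorm x.
  apply: (@le_trans _ _ (\sum_(m <- A)
      (normc (taylor_coef f m) * \prod_(j < d) M ^+ m j) * rnorm x)).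
    apply: ler_sum => m _; rewrite rnormZ -mulrA ler_wpM2l ?normc_ge0//.
    exact: op_monomial_le.
  rewrite -mulr_suml ler_wpM2r ?rnorm_ge0//.
  apply: le_trans (coef_dual_le _ _ _) _; rewrite mulrC.
  rewrite ler_pM ?sqrtr_ge0// ler_wsqrtr ?coef_sqsum_le//.
  apply: le_trans (hK A); rewrite le_eqVlt; apply/orP; left; apply/eqP.
  apply: eq_bigr => m _; congr (_ / _); rewrite -prodrXl.
  by apply: eq_bigr => j _; rewrite exprAC.
have cv : partial_sum (fun m => taylor_coef f m *: op_monomial T m x) @ totally -->
    op_entire T f x.
  by apply: cvg_sum_rnorm; exists (Num.sqrt K * Num.sqrt (fock_sq f) * rnorm x).
split => //; apply: (rnorm_lim_le cv); apply: nearW => A.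
by rewrite partial_sumE (le_trans (rnorm_sum _ _ _)).
Qed.

Lemma op_entireE f x y :
  partial_sum (fun m => taylor_coef f m *: op_monomial T m x) @ totally --> y ->
  op_entire T f x = y.
Proof. by move=> h; apply: cvg_lim => //; exact: norm_hausdorff. Qed.

Lemma op_entire_linf c f g x : fock f -> fock g ->
  op_entire T (fun z => c * f z + g z) x = c *: op_entire T f x + op_entire T g x.
Proof.
move=> ff fg; have [K _ hK] := op_entire_cvg; apply: op_entireE.
rewrite (_ : partial_sum _ = fun A =>
    c *: partial_sum (fun m => taylor_coef f m *: op_monomial T m x) A +
    partial_sum (fun m => taylor_coef g m *: op_monomial T m x) A).
  by apply: cvgD; [apply: cvgZl_tmp; exact: (hK f x ff).1|exact: (hK g x fg).1].
apply/funext => A; apply: partial_sum_lin => m.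
by rewrite taylor_coef_lin// scalerDl scalerA.
Qed.

Lemma op_entire_linx c f x y : fock f ->
  op_entire T f (c *: x + y) = c *: op_entire T f x + op_entire T f y.
Proof.
move=> ff; have [K _ hK] := op_entire_cvg; apply: op_entireE.
rewrite (_ : partial_sum _ = fun A =>
    c *: partial_sum (fun m => taylor_coef f m *: op_monomial T m x) A +
    partial_sum (fun m => taylor_coef f m *: op_monomial T m y) A).
  by apply: cvgD; [apply: cvgZl_tmp; exact: (hK f x ff).1|exact: (hK f y ff).1].
apply/funext => A; apply: partial_sum_lin => m.
by rewrite op_monomial_lin scalerDr !scalerA mulrC.
Qed.

Lemma op_entire_monomial m x : op_entire T (monomial m) x = op_monomial T m x.
Proof.
have tm : taylor_coef (@monomial R d m) = fun n => (n == m)%:R.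
  by apply: taylor_coefE; exact: power_series_monomial.
apply: op_entireE; rewrite tm.
apply: cvg_near_cst; exists [fset m]%fset => // A /= mA.
rewrite partial_sumE (big_fsetD1 m)/=; last by rewrite (fsubsetP mA)// inE.
rewrite eqxx scale1r big1_fset ?addr0// => n; rewrite !inE => /andP[/negbTE -> _] _.
by rewrite scale0r.
Qed.

(** [T k] is bounded, hence passes to the limit of the partial sums. *)
Lemma op_entireT f k x : fock f -> op_entire T f (T k x) = T k (op_entire T f x).
Proof.
move=> ff; have [K _ hK] := op_entire_cvg; apply: op_entireE.
have [M M0 hM] := tuple_bound.
have /cvg_rnormP cv := (hK f x ff).1.
apply/cvg_rnormP => e e0.
have M1 : 0 < M + 1 by rewrite ltr_wpDl.
have := cv (e / (M + 1)); rewrite divr_gt0// => /(_ isT); apply: filterS => A lt.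
have -> : partial_sum (fun m => taylor_coef f m *: op_monomial T m (T k x)) A =
    T k (partial_sum (fun m => taylor_coef f m *: op_monomial T m x) A).
  rewrite [LHS]partial_sumE [in RHS]partial_sumE linear_sum; apply: eq_bigr => m _.
  by rewrite op_monomialT linearZ.
rewrite -linearB (le_lt_trans (hM _ _))//.
apply: (@le_lt_trans _ _ ((M + 1) * rnorm (op_entire T f x -
    partial_sum (fun m => taylor_coef f m *: op_monomial T m x) A))).
  by rewrite ler_wpM2r ?rnorm_ge0// lerDl.
by rewrite mulrC -ltr_pdivlMr.
Qed.

Lemma op_entire_op_monomial f m x : fock f ->
  op_entire T f (op_monomial T m x) = op_monomial T m (op_entire T f x).
Proof.
move=> ff; rewrite /op_monomial; elim: (index_enum _) => [|j r IH].
  by rewrite !big_nil.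
by rewrite !big_cons/= -IH; elim: (m j) => [|k IHk] //=; rewrite op_entireT// IHk.
Qed.

Lemma op_entire0x f : fock f -> op_entire T f 0 = 0.
Proof.
move=> ff; have := op_entire_linx 1 0 0 ff.
by rewrite !scale1r addr0 => /eqP; rewrite -subr_eq subrr eq_sym => /eqP.
Qed.

(** Pairing with [v] turns each T^m into the scalar z^m, so both sides are limits of the same
    partial sums. *)
Lemma op_entire_ip (z : 'I_d -> C) (v : H) f x : fock f ->
  (forall j x, ip (T j x) v = z j * ip x v) ->
  ip (op_entire T f x) v = f z * ip x v.
Proof.
move=> ff hz; have [K _ hK] := op_entire_cvg.
have fa : power_series_of f _ := taylor_coefP ff.1.
apply: (@cvg_unique _ (@norm_hausdorff _ R[i]^o) ((fun A =>
   ip (partial_sum (fun m => taylor_coef f m *: op_monomial T m x) A) v : R[i]^o) @ totally)).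
  by apply: cvg_ipl => //; exact: (hK f x ff).1.
rewrite (_ : (fun _ => _) = fun A =>
    (partial_sum (fun m => taylor_coef f m * monomial m z) A : R[i]^o) * (ip x v : R[i]^o)).
  by apply: cvgM; [exact: fa|exact: cvg_cst].
apply/funext => A; rewrite !partial_sumE ip_suml mulr_suml; apply: eq_bigr => m _.
by rewrite ipZl (op_monomial_ip _ _ hz) mulrA.
Qed.

Variable h : H.
Hypothesis dh : dense [set op_poly T p h | p in [set: mpoly d C]].

(** f(T) kills every p(T) h, as f(T) p(T) h = p(T) f(T) h; being bounded, it vanishes on the closure
    of these vectors. *)
Lemma op_entire_annihilator f : fock f -> op_entire T f h = 0 -> annihilator T f.
Proof.
move=> ff fh; split => // x.
have fp p : op_entire T f (op_poly T p h) = 0.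
  rewrite /op_poly; elim: (msupp p) => [|m r IH].
    by rewrite big_nil op_entire0x.
  rewrite big_cons op_entire_linx// IH addr0 op_entire_op_monomial// fh.
  have := op_monomial_lin m (-1) 0 0; rewrite scaleN1r oppr0 addr0 scaleN1r addNr => ->.
  by rewrite scaler0.
have [K K0 hK] := op_entire_cvg.
apply: rnorm0_eq0; apply/eqP; rewrite eq_le rnorm_ge0 andbT; apply/ler_addgt0Pr => e e0.
rewrite add0r; pose S := K * Num.sqrt (fock_sq f) + 1.
have S0 : 0 < S by rewrite ltr_wpDl// mulr_ge0 ?sqrtr_ge0.
have eS : 0 < e / S by rewrite divr_gt0.
have [||y [/= bx [p _ py]]] := @dh (ball x (e / S)%:C).
- by exists x; apply: ballxx; rewrite ltcR.
- by apply: ball_open; rewrite ltcR.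
move: bx; rewrite -ball_normE/= -rnormE ltcR => lt.
have -> : op_entire T f x = op_entire T f (-1 *: y + x).
  by rewrite op_entire_linx// -py fp scaler0 add0r.
rewrite scaleN1r addrC (le_trans (hK f _ ff).2)//.
apply: (@le_trans _ _ (S * rnorm (x - y))).
  by rewrite ler_wpM2r ?rnorm_ge0// lerDl.
by rewrite mulrC -ler_pdivlMr// ltW.
Qed.

(** On vectors p(T) h the claim compares monomials. By Riesz, <T_j x, v> = <x, w> for some [w], and
    w - conj(z_j) v is orthogonal to the dense set of these vectors. *)
Lemma ip_monomials_eq (z : 'I_d -> C) (v : H) :
  (forall m, ip (op_monomial T m h) v = monomial m z) ->
  forall j x, ip (T j x) v = z j * ip x v.
Proof.
move=> hv j x.
have [M M0 hM] := tuple_bound.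
have [w hw] : exists w, forall x, ip (T j x) v = ip x w.
  apply: (riesz ip_norm (M := M * rnorm v)).
    by move=> c y y'; rewrite linearP ipDl ipZl.
  move=> y; rewrite (le_trans (ip_le ip_norm _ _))// mulrAC.
  by rewrite ler_wpM2r ?rnorm_ge0.
have -> : ip (T j x) v = ip x w by [].
have /eqP : w - conjc (z j) *: v = 0; last first.
  by rewrite subr_eq0 => /eqP ->; rewrite ipZr conjcK.
apply: (dense_ip_eq0 ip_norm dh) => _ [p _ <-].
have -> : w - conjc (z j) *: v = (- conjc (z j)) *: v + w by rewrite scaleNr addrC.
have cz : conjc (- conjc (z j)) = - z j by case: (z j) => a b; rewrite /= opprK.
rewrite ipDr ipZr cz -hw /op_poly linear_sum !ip_suml mulr_sumr -big_split/=.
rewrite big1// => m _; rewrite linearZ !ipZl op_monomialS !hv.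
suff -> : monomial (mnm_add m (mnm1 j)) z = z j * monomial m z by ring.
rewrite /monomial [in RHS](bigD1 j)//= (bigD1 j)//= mnmDE mnm1E eqxx addn1 exprS mulrA.
congr (_ * _); apply: eq_bigr => i ij.
by rewrite mnmDE mnm1E eq_sym (negbTE ij) addn0.
Qed.

End operator_tuple.

Section complex_sequences.
Context {R : realType}.
Local Notation C := R[i].

Lemma cauchy_normc (u : nat -> C) :
  (forall e : R, 0 < e -> exists N, forall n, (N <= n)%N -> normc (u N - u n) < e) ->
  exists l : C, (u n : R[i]^o) @[n --> \oo] --> (l : R[i]^o).
Proof.
move=> cu.
have real_cvg (w : nat -> R) : (forall n m, `|w n - w m| <= normc (u n - u m)) ->
    cvgn w.
  move=> wu; apply/cauchy_cvgP/cauchy_exP => e e0; have [N hN] := cu _ e0.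
  exists (w N); exists N => // n /= Nn.
  by rewrite -ball_normE/= (le_lt_trans (wu _ _)) ?hN.
have cRe : cvgn (fun n => complex.Re (u n)).
  by apply: real_cvg => n m; rewrite -raddfB Re_le_normc.
have cIm : cvgn (fun n => complex.Im (u n)).
  by apply: real_cvg => n m; rewrite -raddfB Im_le_normc.
exists (limn (fun n => complex.Re (u n)) +i* limn (fun n => complex.Im (u n))).
apply/cvg_rnormP => e e0; have e20 : 0 < e / 2 by rewrite divr_gt0.
move/cvgrPdist_lt/(_ _ e20) : cRe => hRe; move/cvgrPdist_lt/(_ _ e20) : cIm => hIm.
apply: filterS2 hRe hIm => n lRe lIm.
rewrite rnorm_complex (le_lt_trans (normc_le_Re_Im _))// [ltRHS]splitr.
by rewrite !raddfB/= ltrD.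
Qed.

End complex_sequences.

(** * Completeness of the Fock space *)

Section fock_space_complete.
Context {R : realType} {d : nat}.
Local Notation C := R[i].
Implicit Types (m : multinom d) (f g : ('I_d -> C) -> C) (A : {fset multinom d}).

Lemma fock_sub f g : fock f -> fock g -> fock (fun z => f z - g z).
Proof.
move=> ff fg; rewrite (_ : (fun z => _) = fun z => -1 * g z + f z).
  exact: fock_lin.
by apply/funext => z; rewrite mulN1r addrC.
Qed.

Lemma taylor_coef_sub f g m : fock f -> fock g ->
  taylor_coef (fun z => f z - g z) m = taylor_coef f m - taylor_coef g m.
Proof.
move=> ff fg; rewrite (_ : (fun z => f z - g z) = fun z => -1 * g z + f z).
  by rewrite taylor_coef_lin// mulN1r addrC.
by apply/funext => z; rewrite mulN1r addrC.
Qed.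

Lemma fock_sqN f g : fock_sq (fun z => f z - g z) = fock_sq (fun z => g z - f z).
Proof.
rewrite /fock_sq /fock_sqnorm; congr fine; apply: eq_integral => t _.
by rewrite -normcN opprB.
Qed.

(** [D] vanishes on every truncation of [f], so [D f] is its value on an arbitrarily small
    remainder. *)
Lemma fock_functional_eq0 (D : (('I_d -> C) -> C) -> C) (K : R) :
  (forall c f g, fock f -> fock g -> D (fun z => c * f z + g z) = c * D f + D g) ->
  (forall m, D (monomial m) = 0) ->
  (forall f, fock f -> normc (D f) <= K * Num.sqrt (fock_sq f)) ->
  forall f, fock f -> D f = 0.
Proof.
move=> Dl D0 DK f ff.
have fm := @fock_monomial R d.
have Df0 : D (fun=> 0) = 0.
  have := Dl (-1) _ _ (fm mnm0) (fm mnm0); rewrite D0 mulr0 addr0 => E0.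
  by rewrite -[RHS]E0; congr D; apply/funext => z; rewrite mulN1r addNr.
have Ds A : D (fun z => partial_series (taylor_coef f) A z) = 0.
  rewrite /partial_series; elim: (A : seq _) => [|m r IH].
    by rewrite -[RHS]Df0; congr D; apply/funext => z; rewrite big_nil.
  rewrite (_ : (fun z => _) = fun z => taylor_coef f m * monomial m z +
      \sum_(m <- r) taylor_coef f m * monomial m z); last first.
    by apply/funext => z; rewrite big_cons.
  by rewrite Dl ?D0 ?IH ?mulr0 ?addr0//; apply: fock_sum.
apply/eqP; rewrite -normc_eq0 eq_le normc_ge0 andbT; apply/ler_addgt0Pr => e e0.
(* [K] has no assumed sign; [L] is positive and at least [K]. *)
rewrite add0r; pose L := `|K| + 1.
have L0 : 0 < L by rewrite ltr_wpDl.
have [|A0 /(_ A0 (fsubset_refl _))[fg gle]] := fock_truncation ff (e := (e / L) ^+ 2).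
  by rewrite exprn_gt0// divr_gt0.
set g := (fun z => f z - _) in fg gle.
have -> : D f = D g.
  rewrite -[RHS]addr0 -(Ds A0) -[D g]mul1r -Dl//; last by apply: fock_sum.
  by congr D; apply/funext => z; rewrite mul1r subrK.
rewrite (le_trans (DK _ fg))//.
apply: (@le_trans _ _ (L * (e / L))); last by rewrite mulrC divfK// gt_eqF.
apply: (@le_trans _ _ (L * Num.sqrt (fock_sq g))).
  rewrite ler_wpM2r ?sqrtr_ge0// (le_trans (ler_norm _))// lerDl//.
apply: ler_wpM2l; first exact: ltW.
rewrite -[leRHS](ger0_norm (ltW (divr_gt0 e0 L0))) -sqrtr_sqr.
by rewrite ler_wsqrtr.
Qed.

(** The Taylor coefficients converge one by one. A Fatou-type argument on finite sums bounds the
    distance to the limit, and [fock_of_coefs] builds the limit function. *)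
Lemma fock_complete (g : nat -> ('I_d -> C) -> C) : (forall n, fock (g n)) ->
  (forall e : R, 0 < e -> exists N, forall n k, (N <= n)%N -> (N <= k)%N ->
     fock_sq (fun z => g n z - g k z) <= e) ->
  exists2 p, fock p & forall e : R, 0 < e -> exists N, forall n, (N <= n)%N ->
     fock_sq (fun z => g n z - p z) <= e.
Proof.
move=> fg cg; pose a n m := taylor_coef (g n) m.
have coef_le n k m : normc (a n m - a k m) ^+ 2 * weight m <=
    fock_sq (fun z => g n z - g k z).
  rewrite -taylor_coef_sub//.
  have := coef_sqsum_le [fset m]%fset (fock_sub (fg n) (fg k)).
  by rewrite /coef_sqsum big_seq_fset1.
have /choice[b hb] : forall m, exists l : C,
    (a n m : R[i]^o) @[n --> \oo] --> (l : R[i]^o).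
  move=> m; apply: cauchy_normc => e e0.
  have [|N hN] := cg (e ^+ 2 * weight (R := R) m / 2).
    by rewrite divr_gt0 ?mulr_gt0 ?exprn_gt0 ?weight_gt0.
  exists N => n Nn; rewrite -(@ltr_pXn2r _ 2)// ?nnegrE ?normc_ge0 ?ltW//.
  rewrite -(ltr_pM2r (weight_gt0 (R := R) m)) (le_lt_trans (coef_le _ _ _))//.
  rewrite (le_lt_trans (hN _ _ (leqnn N) Nn))// ltr_pdivrMr// ltr_pMr ?ltr1n//.
  by rewrite mulr_gt0 ?exprn_gt0 ?weight_gt0.
(* Finite sums of squares are continuous in the coefficients, so a bound uniform in [n] survives the
   limit. *)
have lim_le N k e : (forall n, (N <= n)%N -> fock_sq (fun z => g k z - g n z) <= e) ->
    forall A, coef_sqsum (fun m => a k m - b m) A <= e.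
  move=> hN A.
  have cA : coef_sqsum (fun m => a k m - a n m) A @[n --> \oo] -->
      coef_sqsum (fun m => a k m - b m) A.
    apply: (@cvg_bigsum R R^o) => m; apply: cvgMl.
    have cn : normc (a k m - a n m) @[n --> \oo] --> normc (a k m - b m).
      by apply: cvg_normc; apply: (@cvgB _ R[i]^o) => //; exact: cvg_cst.
    by rewrite expr2; under eq_fun do rewrite expr2; apply: cvgM.
  apply: (cvgr_to_le cA).
  exists N => // n /= Nn.
  apply: le_trans (hN n Nn).
  have := coef_sqsum_le A (fock_sub (fg k) (fg n)).
  rewrite /coef_sqsum; under eq_bigr do rewrite taylor_coef_sub//.
  by [].
have [N1 h1] := cg 1 ltr01; have {}h1 := h1 _ _ (leqnn N1).
(* The two terms bound [g N1] and its distance to [b], whose square is at most 1 by the choice of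
   [N1]. *)
have [|p [fp pb _]] := @fock_of_coefs R d b (2 * fock_sq (g N1) + 2 * 1).
  move=> A; apply: (@le_trans _ _ (2 * coef_sqsum (a N1) A +
      2 * coef_sqsum (fun m => a N1 m - b m) A)); last first.
    by rewrite lerD// ler_wpM2l// ?coef_sqsum_le ?(lim_le N1).
  rewrite /coef_sqsum !mulr_sumr -big_split/=; apply: ler_sum => m _.
  rewrite !mulrA -mulrDl ler_wpM2r ?weight_ge0//.
  have := le_normcD (a N1 m) (b m - a N1 m); rewrite addrC subrK -[b m - _]opprB normcN.
  move: (normc_ge0 (b m)).
  move: (normc (a N1 m)) (normc (b m)) (normc (a N1 m - b m)) => x y z y0 le.
  have E : 2 * x * x + 2 * z * z = (x + z) ^+ 2 + (x - z) ^+ 2 by ring.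
  rewrite E (@le_trans _ _ ((x + z) ^+ 2))//; last by rewrite lerDl sqr_ge0.
  by rewrite lerXn2r ?nnegrE// (le_trans y0).
exists p => // e e0; have [N hN] := cg _ e0; exists N => n Nn.
have Np : power_series_of (fun z => g n z - p z) (fun m => a n m - b m).
  have -> : (fun m => a n m - b m) = taylor_coef (fun z => g n z - p z).
    by apply/funext => m; rewrite taylor_coef_sub// pb.
  by apply: taylor_coefP; exact: (fock_sub (fg n) fp).1.
apply: (fock_power_series Np _).2; apply: (lim_le N) => k Nk.
exact: hN.
Qed.

End fock_space_complete.

(** * The joint eigenvalues *)

Section iota_adjoint.
Context {R : realType} {H : completeNormedModType R[i]} {d : nat}.
Variable ip : {dot H for @conjc R}.
Hypothesis ip_norm : forall x : H, `|x| ^+ 2 = ip x x.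
Local Notation C := R[i].
Variable T : 'I_d -> {linear H -> H}.
Hypothesis bT : forall j, bounded_operator (T j).
Variable h : H.
Implicit Types (m n : multinom d) (x y : H) (c : C) (f g w : ('I_d -> C) -> C).

(** [adjoint] is a choice with default 0, meaningful only once a representing vector exists. *)
Lemma adjointP (U V : zmodType) (D : set U) (ipU : U -> U -> C) (ipV : V -> V -> C)
    (A : U -> V) (v : V) :
  (exists u, D u /\ forall x : U, D x -> ipV (A x) v = ipU x u) ->
  D (adjoint D ipU ipV A v) /\
  forall x : U, D x -> ipV (A x) v = ipU x (adjoint D ipU ipV A v).
Proof.
move=> [u hu]; apply: (@xgetPex _ 0 [set y | D y /\ forall x : U, D x -> ipV (A x) v = ipU x y]).
by exists u.
Qed.

Lemma adjoint_bounded (A : {linear H -> H}) v : bounded_operator A ->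
  forall x, ip (A x) v = ip x (adjoint setT ip ip A v).
Proof.
move=> bA x; have [M M0 hM] := @tuple_bound _ _ 1 (fun=> A) (fun=> bA).
apply: (adjointP (D := setT) _).2 => //.
have [u hu] : exists u, forall y, ip (A y) v = ip y u.
  apply: (riesz ip_norm (M := M * rnorm v)).
    by move=> c y y'; rewrite linearP ipDl ipZl.
  move=> y; rewrite (le_trans (ip_le ip_norm _ _))// mulrAC.
  by rewrite ler_wpM2r ?rnorm_ge0// (hM ord0).
by exists u.
Qed.

(* The adjoint of iota maps y to the function with Taylor coefficients
   <y, T^n h> / w_n. *)
Lemma iota_adjoint_exists y : exists u, fock u /\
  forall w, fock w -> ip (iota_op T h w) y = fock_ip w u.
Proof.
have [M M0 hM] := tuple_bound bT.
pose b n : C := conjc (ip (op_monomial T n h) y) / (weight n)%:C.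
have [S hS] := @weight_summable R d (M ^+ 2) (sqr_ge0 M).
have w0 n : weight (R := R) n != 0 by rewrite gt_eqF ?weight_gt0.
have [|u [fu ub _]] := @fock_of_coefs R d b ((rnorm h * rnorm y) ^+ 2 * S).
  move=> A; apply: (@le_trans _ _ ((rnorm h * rnorm y) ^+ 2 *
      \sum_(n <- A) (\prod_j (M ^+ 2) ^+ n j) / weight n)); last first.
    by rewrite ler_wpM2l ?sqr_ge0.
  rewrite mulr_sumr; apply: ler_sum => n _.
  rewrite /b normcM normc_conj normcV normc_real ger0_norm ?weight_ge0//.
  have le : normc (ip (op_monomial T n h) y) <=
      rnorm h * rnorm y * \prod_j M ^+ n j.
    rewrite (le_trans (ip_le ip_norm _ _))// mulrAC ler_wpM2r ?rnorm_ge0//.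
    by rewrite mulrC op_monomial_le.
  have -> : \prod_j (M ^+ 2) ^+ n j = (\prod_j M ^+ n j) ^+ 2.
    by rewrite -prodrXl; apply: eq_bigr => j _; rewrite exprAC.
  rewrite exprMn exprVn mulrA -exprMn.
  have -> : normc (ip (op_monomial T n h) y) ^+ 2 * (weight n) ^- 2 * weight n =
      normc (ip (op_monomial T n h) y) ^+ 2 / weight n by field.
  rewrite ler_wpM2r ?invr_ge0 ?weight_ge0// lerXn2r ?nnegrE ?normc_ge0//.
  by rewrite mulr_ge0 ?mulr_ge0 ?rnorm_ge0// prodr_ge0// => j _; rewrite exprn_ge0.
exists u; split => // w fw; apply/eqP; rewrite -subr_eq0; apply/eqP.
have [K K0 hK] := op_entire_cvg bT.
(* Both sides are linear and bounded in [w], and they agree on monomials by the choice of the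
   coefficients. *)
apply: (@fock_functional_eq0 R d (fun w => ip (iota_op T h w) y - fock_ip w u)
  (K * rnorm h * rnorm y + Num.sqrt (fock_sq u))) => //.
- move=> c f g ff fg; rewrite /iota_op op_entire_linf// ipDl ipZl fock_ip_linl//.
  by rewrite mulrBr opprD addrACA.
- move=> m; rewrite /iota_op op_entire_monomial//.
  rewrite (fock_ipC fu (@fock_monomial R d m)) fock_ip_monomial// ub /b.
  rewrite divfK; last by rewrite (inj_eq (@complexI R) _ 0).
  by rewrite conjcK subrr.
- move=> f ff; rewrite (le_trans (le_normcD _ _))// normcN mulrDl lerD//.
    rewrite (le_trans (ip_le ip_norm _ _))//.
    have := (hK f h ff).2 => le; rewrite /iota_op.
    apply: (le_trans (ler_wpM2r (rnorm_ge0 y) le)).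
    by rewrite (mulrAC K) (mulrAC (K * _)).
  by rewrite (le_trans (fock_ip_le ff fu))// mulrC.
Qed.

Lemma L_opP g : fock (L_op ip T h g) /\
  forall w, fock w -> ip (iota_op T h w) (iota_op T h g) = fock_ip w (L_op ip T h g).
Proof. exact: adjointP (iota_adjoint_exists _). Qed.

End iota_adjoint.

(** * The spectral decomposition and joint eigenvectors *)

Section spectral_decomposition_theory.
Context {R : realType} {H : completeNormedModType R[i]} {d : nat}.
Variable ip : {dot H for @conjc R}.
Hypothesis ip_norm : forall x : H, `|x| ^+ 2 = ip x x.
Local Notation C := R[i].
Variable T : 'I_d -> {linear H -> H}.
Variable h : H.
Hypothesis Th : cyclic_commuting_tuple T h.
Variables (K : set nat) (lam : nat -> R) (f : nat -> ('I_d -> C) -> C).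
Hypothesis Lf : spectral_decomposition ip T h K lam f.
Implicit Types (m : multinom d) (x y v : H) (c : C) (g w : ('I_d -> C) -> C)
  (z : 'I_d -> C).

Let bT : forall j, bounded_operator (T j). Proof. by case: Th. Qed.
Let cT : forall j k x, T j (T k x) = T k (T j x). Proof. by case: Th. Qed.
Let dh : dense [set op_poly T p h | p in [set: mpoly d C]]. Proof. by case: Th. Qed.
Let ff k : K k -> fock (f k). Proof. by case: Lf => _ _ _ [+ _] _; exact. Qed.
Let fo j k : K j -> K k -> fock_ip (f j) (f k) = (j == k)%:R.
Proof. by case: Lf => _ _ _ [_ +] _; exact. Qed.

Local Notation iota := (iota_op T h).

Lemma iota_lin c g w : fock g -> fock w ->
  iota (fun z => c * g z + w z) = c *: iota g + iota w.
Proof. by move=> fg fw; rewrite /iota_op op_entire_linf. Qed.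

Lemma L_eigen k : K k -> L_op ip T h (f k) = fun z => (lam k)%:C * f k z.
Proof. by move=> Kk; apply/funext => z; case: Lf => _ _ _ _ [+ _]; exact. Qed.

(** Both sides equal <w, L f_k>. Hence the vectors iota f_k are orthogonal, of squared norm
    [lam k]. *)
Lemma ip_iota_eigen w k : K k -> fock w ->
  ip (iota w) (iota (f k)) = (lam k)%:C * fock_ip w (f k).
Proof.
move=> Kk fw; have [_ ->//] := L_opP ip_norm bT h (f k).
rewrite (L_eigen Kk) (fock_ipZr _ (ff Kk) fw); congr (_ * _).
exact: conjc_real.
Qed.

(** [lam k] is the squared norm of iota f_k, and it is nonzero by assumption. *)
Lemma lam_gt0 k : K k -> 0 < lam k.
Proof.
move=> Kk; have := ip_iota_eigen Kk (ff Kk).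
rewrite (fo Kk Kk) eqxx mulr1 (ip_sq ip_norm) => /(congr1 (@complex.Re R))/= E.
have l0 : lam k != 0 by case: Lf => _ + _ _ _; apply.
by rewrite lt0r l0 -E sqr_ge0.
Qed.

Lemma iota_orthogonal (s : seq nat) (a : nat -> C) : uniq s ->
  (forall k, k \in s -> K k) ->
  rnorm (\sum_(k <- s) a k *: iota (f k)) ^+ 2 =
  \sum_(k <- s) normc (a k) ^+ 2 * lam k.
Proof.
elim: s => [|k s IH] /=; first by rewrite !big_nil rnorm0 expr0n.
move=> /andP[ks us] Ks; rewrite !big_cons (rnormD_sq ip_norm) IH//; last first.
  by move=> j js; apply: Ks; rewrite inE js orbT.
have Kk : K k by apply: Ks; rewrite inE eqxx.
have -> : ip (iota (f k)) (\sum_(j <- s) a j *: iota (f j)) = 0.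
  rewrite ipC ip_suml big_seq big1 ?conjc0// => j js.
  have Kj : K j by apply: Ks; rewrite inE js orbT.
  rewrite ipZl (ip_iota_eigen Kk (ff Kj)) (fo Kj Kk).
  by case: eqP => [jk|_]; rewrite ?mulr0// -jk js in ks *.
rewrite mulr0/= mulr0 addr0; congr (_ * _ + _).
have := ip_iota_eigen Kk (ff Kk).
by rewrite (fo Kk Kk) eqxx mulr1 (ip_sq ip_norm) => /(congr1 (@complex.Re R)).
Qed.

(* Bessel's inequality for the orthonormal family iota f_k / sqrt lam_k. *)
Lemma iota_bessel (s : seq nat) v : uniq s -> (forall k, k \in s -> K k) ->
  \sum_(k <- s) (lam k)^-1 * normc (ip (iota (f k)) v) ^+ 2 <= rnorm v ^+ 2.
Proof.
move=> us Ks; set S := \sum_(k <- s) _.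
pose a k : C := (lam k)^-1%:C * conjc (ip (iota (f k)) v).
pose w := \sum_(k <- s) a k *: iota (f k).
have lam_neq0 k : k \in s -> lam k != 0 by move=> /Ks/lam_gt0 l0; rewrite gt_eqF.
have wE : rnorm w ^+ 2 = S.
  rewrite /w iota_orthogonal// /S big_seq [RHS]big_seq; apply: eq_bigr => k ks.
  rewrite normcM normc_conj normc_real exprMn real_normK ?num_real//.
  by field; exact: lam_neq0.
have ipE : ip w v = S%:C.
  rewrite ip_suml rmorph_sum; apply: eq_bigr => k _.
  rewrite ipZl /a -mulrA [conjc _ * _]mulrC mulC_conj.
  exact/esym/rmorphM.
have := sqr_ge0 (rnorm (-1 *: w + v)).
rewrite (rnormD_sq ip_norm) ipE wE normcN normc1 expr1n mulN1r/=; lra.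
Qed.

Lemma esum_lty_of_eigen z v : ip h v != 0 ->
  (forall j x, ip (T j x) v = z j * ip x v) ->
  (\esum_(k in K) ((lam k)^-1 * normc (f k z) ^+ 2)%:E < +oo)%E.
Proof.
move=> hv0 hz; set p := ip h v in hv0.
have p0 : 0 < normc p ^+ 2 by rewrite exprn_gt0// lt0r normc_ge0 normc_eq0 hv0.
apply: (@le_lt_trans _ _ ((rnorm v ^+ 2 / normc p ^+ 2)%:E)); last exact: ltry.
apply: ge_ereal_sup => _ [A [fA AK] <-].
rewrite fsbig_finite//= sumEFin lee_fin ler_pdivlMr// mulr_suml.
have Ks k : k \in (fset_set A : seq nat) -> K k.
  by rewrite in_fset_set// => /set_mem/AK.
apply: le_trans (iota_bessel v (fset_uniq _) Ks).
rewrite big_seq [leRHS]big_seq; apply: ler_sum => k /Ks Kk.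
rewrite /iota_op (op_entire_ip ip_norm bT _ (ff Kk) hz) normcM exprMn.
by rewrite [leRHS]mulrA.
Qed.

Lemma eigen_sub z v : v != 0 -> (forall j x, ip (T j x) v = z j * ip x v) ->
  zero_set (annihilator T) z /\
  (\esum_(k in K) ((lam k)^-1 * normc (f k z) ^+ 2)%:E < +oo)%E.
Proof.
move=> v0 hz.
have hv0 : ip h v != 0.
  (* If <h, v> = 0, then <T^m h, v> = z^m <h, v> vanishes for all m, and [v] is orthogonal to a
     dense set. *)
  apply: contra v0 => /eqP hv; apply/eqP/(dense_ip_eq0 ip_norm dh) => _ [p _ <-].
  rewrite /op_poly ip_suml big1// => m _.
  by rewrite ipZl (op_monomial_ip _ _ hz) hv !mulr0.
split; last exact: esum_lty_of_eigen hv0 hz.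
move=> g [fg g0]; have := op_entire_ip ip_norm bT h fg hz.
by rewrite g0 ip0l => /esym/eqP; rewrite mulf_eq0 (negbTE hv0) orbF => /eqP.
Qed.

(** Sums over [K] are cut through such lists, whether [K] is finite or not. *)
Definition segment (N n : nat) : seq nat := [seq k <- index_iota N n | k \in K].

Lemma segment_uniq N n : uniq (segment N n).
Proof. by rewrite filter_uniq ?iota_uniq. Qed.

Lemma segment_in N n k : k \in segment N n -> K k.
Proof. by rewrite mem_filter => /andP[/set_mem]. Qed.

Lemma segment_cat N n : (N <= n)%N -> segment 0 n = segment 0 N ++ segment N n.
Proof.
by move=> Nn; rewrite /segment -filter_cat /index_iota !subn0 -[in LHS](subnKC Nn) iotaD.
Qed.

(** The partial sums are nondecreasing and bounded: past an index where they come within [e] of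
    their supremum, no block reaches [e]. *)
Lemma segment_tail (b : nat -> R) (B : R) : (forall k, K k -> 0 <= b k) ->
  (forall n, \sum_(k <- segment 0 n) b k <= B) ->
  forall e, 0 < e -> exists N, forall n k, (N <= n)%N -> (n <= k)%N ->
    \sum_(j <- segment n k) b j < e.
Proof.
move=> b0 bB e e0; pose S n := \sum_(k <- segment 0 n) b k.
have S_le i n : (i <= n)%N -> S n = S i + \sum_(k <- segment i n) b k.
  by move=> le; rewrite /S (segment_cat le) big_cat.
have seg0 i n : 0 <= \sum_(k <- segment i n) b k.
  by rewrite big_seq sumr_ge0// => k /segment_in/b0.
have supS : has_sup (range S) by split; [exists (S 0%N), 0%N|exists B => _ [n _ <-]; exact: bB].
have [_ [N _ <-] lt] := sup_adherent e0 supS.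
exists N => n k Nn nk; have Sk : S k <= sup (range S).
  by apply: ub_le_sup; [exact: supS.2|exists k].
by have := S_le _ _ nk; have := S_le _ _ Nn; have := seg0 N n; lra.
Qed.

Lemma spectral_sum_bound z (B : R) :
  (\esum_(k in K) ((lam k)^-1 * normc (f k z) ^+ 2)%:E <= B%:E)%E ->
  forall n, \sum_(k <- segment 0 n) (lam k)^-1 * normc (f k z) ^+ 2 <= B.
Proof.
move=> le n; rewrite -lee_fin; apply: le_trans le; rewrite -sumEFin.
apply: ereal_sup_ubound; exists [set` segment 0 n].
  by split; [exact: finite_seq|move=> k /= /segment_in].
by rewrite -fsbig_seq ?segment_uniq.
Qed.

Lemma spectral_vector z :
  (\esum_(k in K) ((lam k)^-1 * normc (f k z) ^+ 2)%:E < +oo)%E ->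
  exists v, forall k, K k -> ip (iota (f k)) v = f k z.
Proof.
set E := esum _ _ => Eoo.
pose b k := (lam k)^-1 * normc (f k z) ^+ 2.
have b0 k : K k -> 0 <= b k.
  by move=> Kk; rewrite mulr_ge0 ?sqr_ge0// invr_ge0 ltW// lam_gt0.
have Efin : (E <= (fine E)%:E)%E.
  rewrite fineK// ge0_fin_numE//; apply: esum_ge0 => k Kk; rewrite lee_fin; exact: b0.
have tail := segment_tail b0 (spectral_sum_bound Efin).
(* Since |iota f_k|^2 = [lam k], the k-th term of the sum for [v] has squared norm [b k]: the
   hypothesis on [z] is the convergence of |v|^2. *)
pose a k : C := (lam k)^-1%:C * conjc (f k z).
pose u n := \sum_(k <- segment 0 n) a k *: iota (f k).
have aE k : K k -> normc (a k) ^+ 2 * lam k = b k.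
  move=> Kk; rewrite /a /b normcM normc_conj normc_real exprMn real_normK ?num_real//.
  by field; rewrite gt_eqF ?lam_gt0.
have [v uv] : exists v : H, u @ \oo --> v.
  apply: cauchy_rnorm => e e0; have [|N hN] := tail (e ^+ 2); first by rewrite exprn_gt0.
  exists N => n Nn; rewrite -(@ltr_pXn2r _ 2)// ?nnegrE ?rnorm_ge0 ?ltW//.
  apply: le_lt_trans (hN N n (leqnn N) Nn).
  rewrite -rnormN opprB /u (segment_cat Nn) big_cat/= addrAC subrr add0r.
  rewrite iota_orthogonal ?segment_uniq//; last by move=> k /segment_in.
  rewrite big_seq [leRHS]big_seq; apply: ler_sum => k /segment_in Kk.
  by rewrite aE.
exists v => k Kk.
apply: (@cvg_unique _ (@norm_hausdorff _ R[i]^o)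
    ((fun n => ip (iota (f k)) (u n) : R[i]^o) @ \oo)).
  exact: (cvg_ipr ip_norm).
(* From k + 1 on, the k-th term is present, and all other terms are orthogonal to iota f_k. *)
apply: cvg_near_cst; exists k.+1 => // n /= kn.
have kn' : k \in segment 0 n by rewrite mem_filter mem_index_iota leq0n kn !andbT; apply: mem_set.
rewrite ipC ip_suml (bigD1_seq k)//= ?segment_uniq// big_seq_cond big1 ?addr0.
  rewrite ipZl (ip_iota_eigen Kk (ff Kk)) (fo Kk Kk) eqxx mulr1 /a mulrAC -rmorphM/=.
  by rewrite mulVf ?gt_eqF ?lam_gt0// mul1r conjcK.
move=> j /andP[/segment_in Kj jk].
by rewrite ipZl (ip_iota_eigen Kk (ff Kj)) (fo Kj Kk) (negbTE jk) !mulr0.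
Qed.

Lemma iota_sum (s : seq nat) (a : nat -> C) : (forall k, k \in s -> K k) ->
  iota (fun z => \sum_(k <- s) a k * f k z) = \sum_(k <- s) a k *: iota (f k).
Proof.
elim: s => [|k s IH] Ks.
  rewrite big_nil; have f0 := @fock0 R d.
  have := iota_lin (-1) f0 f0.
  rewrite scaleN1r addNr => <-; congr iota; apply/funext => z.
  by rewrite big_nil mulr0 addr0.
have Kk : K k by apply: Ks; rewrite inE eqxx.
have Ks' j : j \in s -> K j by move=> js; apply: Ks; rewrite inE js orbT.
rewrite big_cons -(IH Ks') -iota_lin.
- by congr iota; apply/funext => z; rewrite big_cons.
- exact: ff.
- by apply: fock_sum => j /Ks'; exact: ff.
Qed.

(** * Expansion of a Fock function along the eigenvectors *)

Section expansion.
Variable g : ('I_d -> C) -> C.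
Hypothesis fg : fock g.

Definition coord k : C := fock_ip g (f k).

Definition expansion s : ('I_d -> C) -> C := fun z => \sum_(k <- s) coord k * f k z.

(** The component of [g] orthogonal to the first eigenvectors, in the shape expected by the
    linearity lemmas. *)
Definition residue n : ('I_d -> C) -> C := fun z => -1 * expansion (segment 0 n) z + g z.

Lemma fock_expansion s : (forall k, k \in s -> K k) -> fock (expansion s).
Proof. by move=> Ks; apply: fock_sum => k /Ks; exact: ff. Qed.

Lemma fock_residue n : fock (residue n).
Proof. by apply: fock_lin => //; apply: fock_expansion => k /segment_in. Qed.

Lemma fock_ip_expansion s k : uniq s -> (forall j, j \in s -> K j) -> k \in s ->
  fock_ip (expansion s) (f k) = coord k.
Proof.
move=> us Ks ks; rewrite fock_ip_suml; last 2 first.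
- by move=> j /Ks; exact: ff.
- exact/ff/Ks.
rewrite (bigD1_seq k)//= (fo (Ks _ ks) (Ks _ ks)) eqxx mulr1 big_seq_cond big1 ?addr0//.
by move=> j /andP[/Ks Kj jk]; rewrite (fo Kj (Ks _ ks)) (negbTE jk) mulr0.
Qed.

Lemma fock_sq_expansion s : uniq s -> (forall j, j \in s -> K j) ->
  fock_sq (expansion s) = \sum_(k <- s) normc (coord k) ^+ 2.
Proof.
move=> us Ks; have fe := fock_expansion Ks.
apply: complexI; rewrite -(fock_ip_sq fe) [LHS]fock_ip_suml//; last first.
  by move=> j /Ks; exact: ff.
rewrite rmorph_sum big_seq [RHS]big_seq; apply: eq_bigr => k ks.
rewrite (fock_ipC fe (ff (Ks _ ks))) (fock_ip_expansion us Ks ks).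
exact: mulC_conj.
Qed.

Lemma fock_bessel n : fock_sq (residue n) =
  fock_sq g - \sum_(k <- segment 0 n) normc (coord k) ^+ 2.
Proof.
have us := segment_uniq 0 n; have Ks k := @segment_in 0 n k.
have fe := fock_expansion Ks.
rewrite fock_sqD// fock_sq_expansion//.
have -> : fock_ip (expansion (segment 0 n)) g =
    (\sum_(k <- segment 0 n) normc (coord k) ^+ 2)%:C.
  rewrite fock_ip_suml//; last by move=> k /Ks; exact: ff.
  rewrite rmorph_sum big_seq [RHS]big_seq; apply: eq_bigr => k /Ks Kk.
  by rewrite (fock_ipC fg (ff Kk)); exact: mulC_conj.
by rewrite normcN normc1 expr1n mulN1r/=; ring.
Qed.

Lemma fock_sq_residue_le n : fock_sq (residue n) <= fock_sq g.
Proof. by rewrite fock_bessel gerBl sumr_ge0// => k _; exact: sqr_ge0. Qed.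

Lemma fock_ip_residue n k : k \in segment 0 n -> fock_ip (residue n) (f k) = 0.
Proof.
move=> ks; have Ks j := @segment_in 0 n j.
rewrite (fock_ip_linl _ (fock_expansion Ks) fg (ff (Ks _ ks))).
by rewrite (fock_ip_expansion (segment_uniq 0 n) Ks ks) mulN1r addNr.
Qed.

(** A difference of two residues is, up to sign, a block of the expansion, and Bessel's inequality
    bounds the sum of all squared coordinates. *)
Lemma residue_cauchy (e : R) : 0 < e -> exists N, forall n k, (N <= n)%N -> (N <= k)%N ->
  fock_sq (fun z => residue n z - residue k z) <= e.
Proof.
move=> e0.
have bnd n : \sum_(k <- segment 0 n) normc (coord k) ^+ 2 <= fock_sq g.
  by have := fock_bessel n; have := fock_sq_ge0 (residue n); lra.
have [N hN] := segment_tail (fun k _ => sqr_ge0 (normc (coord k))) bnd e0.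
have main n k : (N <= n)%N -> (n <= k)%N ->
    fock_sq (fun z => residue n z - residue k z) <= e.
  move=> Nn nk; rewrite (_ : (fun z => _) = expansion (segment n k)).
    rewrite fock_sq_expansion ?segment_uniq//; last by move=> j /segment_in.
    exact/ltW/hN.
  apply/funext => z; rewrite /residue /expansion (segment_cat nk) big_cat/=; ring.
exists N => n k Nn Nk; have [nk|kn] := leqP n k; first exact: main.
by rewrite fock_sqN; apply: main => //; exact: ltnW.
Qed.

Definition spectral_remainder n : ('I_d -> C) -> C := fun z => L_op ip T h g z -
  \sum_(0 <= k < n | k \in K) (lam k)%:C * rank_one (f k) (f k) g z.

Lemma spectral_remainderE n : spectral_remainder n = fun z =>
  -1 * (\sum_(k <- segment 0 n) ((lam k)%:C * coord k) * f k z) + L_op ip T h g z.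
Proof.
apply/funext => z; rewrite /spectral_remainder mulN1r addrC big_filter.
congr (- _ + _); apply: eq_bigr => k _; by rewrite /rank_one mulrA.
Qed.

Lemma fock_spectral_remainder n : fock (spectral_remainder n).
Proof.
rewrite spectral_remainderE; apply: fock_lin.
  by apply: fock_sum => k /segment_in; exact: ff.
exact: (L_opP ip_norm bT h g).1.
Qed.

Lemma spectral_remainder_small (e : R) : 0 < e ->
  exists N, forall n, (N <= n)%N -> fock_sq (spectral_remainder n) <= e.
Proof.
move=> e0; case: Lf => _ _ _ _ [_ /(_ _ fg)/fine_cvg/cvgrPdist_lt/(_ _ e0)[N _ hN]].
exists N => n /hN/=; rewrite sub0r normrN ger0_norm ?fock_sq_ge0//.
exact: ltW.
Qed.

(* As the residue is orthogonal to the first f_k, pairing it with L g only sees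
   the tail of the spectral decomposition of L g. *)
Lemma iota_residue_le n : rnorm (iota (residue n)) ^+ 2 <=
  Num.sqrt (fock_sq g) * Num.sqrt (fock_sq (spectral_remainder n)).
Proof.
have fr := fock_residue n; have fs := fock_spectral_remainder n.
have fe := fock_expansion (@segment_in 0 n).
have [fL hL] := L_opP ip_norm bT h g.
have ip_zero (a : nat -> C) : \sum_(k <- segment 0 n) a k * fock_ip (f k) (residue n) = 0.
  rewrite big_seq big1// => k ks; have Kk := segment_in ks.
  by rewrite (fock_ipC fr (ff Kk)) fock_ip_residue// conjc0 mulr0.
have E0 : iota (residue n) =
    -1 *: (\sum_(k <- segment 0 n) coord k *: iota (f k)) + iota g.
  by rewrite /residue iota_lin// iota_sum// => k /segment_in.
(* The residue and [g] differ by a combination of the f_k with k < n, whose images are orthogonal to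
   that of the residue. *)
have E1 : ip (iota (residue n)) (iota (residue n)) = ip (iota (residue n)) (iota g).
  rewrite -[in RHS](addKr (-1 *: \sum_(k <- segment 0 n) coord k *: iota (f k)) (iota g)).
  rewrite -E0 ipDr [X in _ = X + _](_ : _ = 0) ?add0r//.
  rewrite -scaleN1r scalerA ipZr ipC ip_suml big_seq big1 ?conjc0 ?mulr0// => k ks.
  have Kk := segment_in ks.
  rewrite ipZl (ipC ip (iota (f k))) (ip_iota_eigen Kk fr) fock_ip_residue//.
  by rewrite mulr0 conjc0 mulr0.
have Fs k : k \in segment 0 n -> fock (f k) by move=> /segment_in; exact: ff.
pose a k := (lam k)%:C * coord k.
have fsum : fock (fun z => \sum_(k <- segment 0 n) a k * f k z) by exact: fock_sum.
have E2 : fock_ip (residue n) (L_op ip T h g) = fock_ip (residue n) (spectral_remainder n).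
  rewrite (fock_ipC fL fr) (fock_ipC fs fr); congr conjc.
  have -> : fock_ip (spectral_remainder n) (residue n) =
      -1 * fock_ip (fun z => \sum_(k <- segment 0 n) a k * f k z) (residue n) +
      fock_ip (L_op ip T h g) (residue n).
    by rewrite spectral_remainderE; exact: fock_ip_linl.
  by rewrite (fock_ip_suml a Fs fr) ip_zero mulr0 add0r.
have := hL _ fr; rewrite -E1 (ip_sq ip_norm) E2 => /(congr1 (@complex.Re R)) E.
rewrite -[leLHS]/(complex.Re (rnorm (iota (residue n)) ^+ 2)%:C) E.
apply: le_trans (ler_norm _) _; apply: le_trans (Re_le_normc _) _.
apply: le_trans (fock_ip_le fr fs) _; apply: ler_wpM2r; first exact: sqrtr_ge0.
by apply: ler_wsqrtr; exact: fock_sq_residue_le.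
Qed.

Lemma iota_residue_small (e : R) : 0 < e ->
  exists N, forall n, (N <= n)%N -> rnorm (iota (residue n)) <= e.
Proof.
move=> e0; pose q := Num.sqrt (fock_sq g) + 1.
have q0 : 0 < q by rewrite ltr_wpDl ?sqrtr_ge0.
(* The square root of this bound is e^2 / q, and [q] exceeds the norm of [g], so the product in
   [iota_residue_le] is at most e^2. *)
have [|N hN] := @spectral_remainder_small ((e ^+ 2 / q) ^+ 2).
  by rewrite exprn_gt0// divr_gt0// exprn_gt0.
exists N => n /hN le; rewrite -(@ler_pXn2r _ 2)// ?nnegrE ?rnorm_ge0 ?(ltW e0)//.
apply: le_trans (iota_residue_le n) _.
apply: (@le_trans _ _ (q * (e ^+ 2 / q))); last by rewrite mulrC divfK// gt_eqF.
rewrite ler_pM ?sqrtr_ge0 ?lerDl//.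
rewrite -[leRHS]ger0_norm; last by rewrite divr_ge0 ?sqr_ge0 ?(ltW q0).
by rewrite -sqrtr_sqr ler_wsqrtr.
Qed.

(* The residues converge to some p with iota p = 0, hence p(T) = 0. *)
Lemma expansion_value z v : zero_set (annihilator T) z ->
  (forall k, K k -> ip (iota (f k)) v = f k z) ->
  ip (iota g) v = g z.
Proof.
move=> Zz hv.
have [p fp hp] := fock_complete fock_residue residue_cauchy.
have fd n : fock (fun z => residue n z - p z) := fock_sub (fock_residue n) fp.
have small1 e : 0 < e -> exists N, forall n, (N <= n)%N ->
    Num.sqrt (fock_sq (fun z => residue n z - p z)) <= e.
  move=> e0; have [|N hN] := hp (e ^+ 2); first by rewrite exprn_gt0.
  exists N => n /hN le; rewrite -[leRHS](ger0_norm (ltW e0)) -sqrtr_sqr.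
  by rewrite ler_wsqrtr.
have [M M0 hM] := op_entire_cvg bT.
have ip0 : op_entire T p h = 0.
  apply: rnorm0_eq0; apply/eqP; rewrite eq_le rnorm_ge0 andbT.
  apply: (le0_of_small (mulr_ge0 M0 (rnorm_ge0 h)) ler01 small1 iota_residue_small) => n.
  (* Both terms have small images under iota: the first by convergence to [p], the second by
     [iota_residue_small]. *)
  have pE : p = fun z => -1 * (residue n z - p z) + residue n z.
    by apply/funext => z'; ring.
  rewrite [in X in X <= _]pE op_entire_linf//; last exact: fock_residue.
  rewrite (le_trans (rnormD _ _))// mul1r lerD//.
  rewrite scaleN1r rnormN (le_trans (hM _ h (fd n)).2)//.
  by rewrite mulrAC.
have pz : p z = 0.
  by apply: Zz; apply: (op_entire_annihilator bT cT dh) ip0.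
have [Kz hKz] := fock_eval_le z.
apply/eqP; rewrite -subr_eq0 -normc_eq0 eq_le normc_ge0 andbT.
apply: (le0_of_small (A := `|Kz|) (B := rnorm v) _ _ small1 iota_residue_small) => //.
  exact: rnorm_ge0.
move=> n; pose s := segment 0 n.
have vE : ip (iota (expansion s)) v = expansion s z.
  rewrite iota_sum ?ip_suml; last by move=> k /segment_in.
  rewrite /expansion big_seq [RHS]big_seq; apply: eq_bigr => k /segment_in Kk.
  by rewrite ipZl hv.
have fe : fock (expansion s) by apply: fock_expansion => k /segment_in.
(* The claim holds for the finite expansion, so only the residue remains; as [p z = 0], its value at
   [z] may be replaced by that of its difference with [p], which is small. *)
have -> : ip (iota g) v - g z = - (residue n z - p z) + ip (iota (residue n)) v.
  have alg (X A r q G e : C) : X = A + e -> G = r + e -> q = 0 ->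
    X - G = - (r - q) + A by move=> -> -> ->; ring.
  apply: (alg _ _ _ _ _ (expansion s z)) pz.
    rewrite -vE -ipDl; congr (ip _ v).
    by rewrite /residue (iota_lin _ fe fg) scaleN1r addrAC addNr add0r.
  by rewrite /residue mulN1r addrAC addNr add0r.
rewrite (le_trans (le_normcD _ _))// normcN lerD//.
  by rewrite (le_trans (hKz _ (fd n)))// ler_wpM2r ?sqrtr_ge0// ler_norm.
by rewrite mulrC; exact: ip_le.
Qed.

End expansion.

Lemma sub_eigen z : zero_set (annihilator T) z ->
  (\esum_(k in K) ((lam k)^-1 * normc (f k z) ^+ 2)%:E < +oo)%E ->
  exists2 v, v != 0 & forall j x, ip (T j x) v = z j * ip x v.
Proof.
move=> Zz Eoo; have [v hv] := spectral_vector Eoo.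
have vm m : ip (op_monomial T m h) v = monomial m z.
  rewrite -(op_entire_monomial T); apply: expansion_value => //.
  exact: fock_monomial.
exists v; last exact: (ip_monomials_eq ip_norm bT cT dh vm).
apply/eqP => v0; have := vm mnm0; rewrite op_monomial0 v0.
have -> : ip h 0 = 0 by rewrite ipC ip0l conjc0.
rewrite /monomial big1; last by move=> j _; rewrite mnm0E.
by move=> /eqP; rewrite eq_sym oner_eq0.
Qed.

End spectral_decomposition_theory.

Theorem corollary1p6 (R : realType) (H : completeNormedModType R[i])
    (ip : {dot H for @conjc R}) (ip_norm : forall x : H, `|x| ^+ 2 = ip x x)
    (d : nat) (T : 'I_d -> {linear H -> H}) (h : H)
    (Th : cyclic_commuting_tuple T h)
    (K : set nat) (lam : nat -> R) (f : nat -> ('I_d -> R[i]) -> R[i])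
    (Lf : spectral_decomposition ip T h K lam f) :
  [set z | zero_set (annihilator T) z /\
           (\esum_(k in K) ((lam k)^-1 * normc (f k z) ^+ 2)%:E < +oo)%E] =
  [set (fun j => (l j)^*) | l in
     joint_eigenvalues (fun j => adjoint setT ip ip (T j))].
Proof.
have [bT _ _] := Th.
apply/seteqP; split => z /=.
- move=> [Zz Eoo]; have [v v0 hv] := sub_eigen ip_norm Th Lf Zz Eoo.
  (* The form is antilinear in its second argument, hence the conjugates. *)
  exists (fun j => conjc (z j)); last by apply/funext => j; rewrite conjcK.
  exists v => // j; apply: (ip_inj ip_norm) => x.
  by rewrite -(adjoint_bounded ip_norm v (bT j)) hv ipZr conjcK.
- move=> [l [v v0 hv] <-]; apply: (eigen_sub ip_norm Th Lf v0) => j x.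
  by rewrite (adjoint_bounded ip_norm v (bT j)) hv ipZr.
Qed.
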